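(* Let $a,b>0$ with $a^2/b^2\in\mathbb{Q}$ and let $R_{a,b}=(0,a)\times(0,b)$. For every fixed $\sigma>0$, $$K_{\sigma,a,b}^{\mathrm{rect}}:=\sup_{\Lambda\in\operatorname{Spec}(-\Delta_{\sigma,R_{a,b}})}\kappa_{\sigma,a,b}^{\mathrm{rect}}(\Lambda)<\infty .$$ Consequently, for every measurable set $V\subset R_{a,b}$ with $|V|>0$ there exists $c_{V,\sigma,a,b}>0$ such that $$\|u\|_{L^2(V)}^2\ \geq\ c_{V,\sigma,a,b}\,\|u\|_{L^2(R_{a,b})}^2$$ for every eigenvalue $\Lambda$ of $-\Delta_{\sigma,R_{a,b}}$ and every $u\in\ker(-\Delta_{\sigma,R_{a,b}}-\Lambda)$.
   Context: $-\Delta_{\sigma,R_{a,b}}$ is the Laplacian on $L^2(R_{a,b})$ with Robin boundary condition $\partial_\nu u+\sigma u=0$ on the boundary ($\nu$ outward unit normal), i.e. the self-adjoint operator of the form $\int|\nabla u|^2+\sigma\int_{\partial R_{a,b}}|u|^2\,ds$ on $H^1(R_{a,b})$. For $\tau>0$ and $n\in\mathbb{Z}_{\geq0}$ let $k_n(\tau)\geq0$ be such that $k_n(\tau)^2$ is the $(n+1)$-st eigenvalue, in increasing order, of $-\varphi''=k^2\varphi$ on $(0,1)$ with $-\varphi'(0)+\tau\varphi(0)=0$, $\varphi'(1)+\tau\varphi(1)=0$. By separation of variables the eigenvalues of $-\Delta_{\sigma,R_{a,b}}$ are $$\Lambda_{n,m}^{a,b}(\sigma)=\frac{k_n(a\sigma)^2}{a^2}+\frac{k_m(b\sigma)^2}{b^2},\qquad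 n,m\in\mathbb{Z}_{\ge0}.$$ For $a\neq b$ each ordered pair $(n,m)$ is one modal class; for $a=b$ each unordered pair $\{n,m\}$ is one modal class. $\kappa_{\sigma,a,b}^{\mathrm{rect}}(\Lambda)$ is the number of distinct modal classes with $\Lambda_{n,m}^{a,b}(\sigma)=\Lambda$. The constants may depend on $\sigma$ and on $a,b$. *)

(* Defs.v *)
From HB Require Import structures.
From mathcomp Require Import all_boot all_order all_algebra.
From mathcomp Require Import complex.
From mathcomp Require Import all_classical all_reals all_analysis.
Set Implicit Arguments.
Unset Strict Implicit.
Unset Printing Implicit Defensive.
Import Order.TTheory GRing.Theory Num.Theory.
Import numFieldNormedType.Exports.
Local Open Scope classical_set_scope.
Local Open Scope ring_scope.
Local Open Scope complex_scope.

(* Complex-valued functions are handled through their real and imaginary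
   parts; an element of L^2 is represented by a measurable function. *)

Definition sqmod (R : realType) (z : R[i]) : R :=
  complex.Re z ^+ 2 + complex.Im z ^+ 2.

Definition cmeasurable (R : realType) d (T : measurableType d)
    (D : set T) (f : T -> R[i]) : Prop :=
  measurable_fun D (fun z => complex.Re (f z)) /\
  measurable_fun D (fun z => complex.Im (f z)).

Definition cintegral (R : realType) d (T : measurableType d)
    (mu : {measure set T -> \bar R}) (D : set T) (f : T -> R[i]) : R[i] :=
  Rintegral mu D (fun z => complex.Re (f z)) +i*
  Rintegral mu D (fun z => complex.Im (f z)).

Definition norm2sq (R : realType) d (T : measurableType d)
    (mu : {measure set T -> \bar R}) (D : set T) (f : T -> R[i]) : \bar R :=
  (\int[mu]_(z in D) (sqmod (f z))%:E)%E.

Definition inL2 (R : realType) d (T : measurableType d)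
    (mu : {measure set T -> \bar R}) (D : set T) (f : T -> R[i]) : Prop :=
  cmeasurable D f /\ (norm2sq mu D f < +oo)%E.

Definition leb1 (R : realType) : {measure set (measurableTypeR R) -> \bar R} :=
  @lebesgue_measure R.

Definition leb2 (R : realType) :
    {measure set (measurableTypeR R * measurableTypeR R) -> \bar R} :=
  (@lebesgue_measure R \x @lebesgue_measure R)%E.

Definition rect (R : realType) (a b : R) : set (R * R) :=
  `]0, a[%classic `*` `]0, b[%classic.

(* The sigma-algebra of the library on R * R is the Borel one; a Lebesgue
   measurable set is a Borel set up to a null set.  The library integral of a
   nonnegative function is a supremum over simple functions below it, so
   norm2sq (leb2 R) V is the Lebesgue integral for these V as well. *)
Definition leb2_measurable (R : realType) (V : set (R * R)) : Prop :=
  exists2 A : set (measurableTypeR R * measurableTypeR R),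
    measurable A & (leb2 R).-negligible (V `+` A).

(* |f|^2 integrated along the boundary, and the integral of f along it. *)
Definition bd_norm2sq (R : realType) (a b : R) (f : R * R -> R[i]) : \bar R :=
  (norm2sq (leb1 R) `]0%R, a[%classic (fun x : R => f (x, 0%R)) +
   norm2sq (leb1 R) `]0%R, a[%classic (fun x : R => f (x, b)) +
   norm2sq (leb1 R) `]0%R, b[%classic (fun y : R => f (0%R, y)) +
   norm2sq (leb1 R) `]0%R, b[%classic (fun y : R => f (a, y)))%E.

Definition bd_cintegral (R : realType) (a b : R) (f : R * R -> R[i]) : R[i] :=
  cintegral (leb1 R) `]0, a[%classic (fun x : R => f (x, 0)) +
  cintegral (leb1 R) `]0, a[%classic (fun x : R => f (x, b)) +
  cintegral (leb1 R) `]0, b[%classic (fun y : R => f (0, y)) +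
  cintegral (leb1 R) `]0, b[%classic (fun y : R => f (a, y)).

Definition bd_inL2 (R : realType) (a b : R) (f : R * R -> R[i]) : Prop :=
  [/\ inL2 (leb1 R) `]0, a[%classic (fun x : R => f (x, 0)),
      inL2 (leb1 R) `]0, a[%classic (fun x : R => f (x, b)),
      inL2 (leb1 R) `]0, b[%classic (fun y : R => f (0, y)) &
      inL2 (leb1 R) `]0, b[%classic (fun y : R => f (a, y))].

Definition pd1 (R : realType) (f : R * R -> R) (z : R * R) : R :=
  derive1 (fun x : R => f (x, z.2)) z.1.

Definition pd2 (R : realType) (f : R * R -> R) (z : R * R) : R :=
  derive1 (fun y : R => f (z.1, y)) z.2.

Definition C1 (R : realType) (f : R * R -> R) : Prop :=
  [/\ forall z, derivable (fun x : R => f (x, z.2)) z.1 1,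
      forall z, derivable (fun y : R => f (z.1, y)) z.2 1,
      continuous f, continuous (pd1 f) & continuous (pd2 f)].

(* Compactly supported C^1 test functions give the same weak derivatives as
   smooth ones. *)
Definition test_fun (R : realType) (a b : R) (phi : R * R -> R) : Prop :=
  C1 phi /\
  exists K : set (R * R),
    [/\ compact K, K `<=` rect a b & forall z, ~ K z -> phi z = 0].

Definition cpd1 (R : realType) (w : R * R -> R[i]) (z : R * R) : R[i] :=
  pd1 (fun t => complex.Re (w t)) z +i* pd1 (fun t => complex.Im (w t)) z.

Definition cpd2 (R : realType) (w : R * R -> R[i]) (z : R * R) : R[i] :=
  pd2 (fun t => complex.Re (w t)) z +i* pd2 (fun t => complex.Im (w t)) z.

Definition cC1 (R : realType) (w : R * R -> R[i]) : Prop :=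
  C1 (fun t => complex.Re (w t)) /\ C1 (fun t => complex.Im (w t)).

(* u belongs to H^1(R_{a,b}) and has weak gradient (g1, g2). *)
Definition H1_grad (R : realType) (a b : R) (u g1 g2 : R * R -> R[i]) : Prop :=
  [/\ inL2 (leb2 R) (rect a b) u,
      inL2 (leb2 R) (rect a b) g1,
      inL2 (leb2 R) (rect a b) g2 &
      forall phi, test_fun a b phi ->
        cintegral (leb2 R) (rect a b) (fun z => u z * (pd1 phi z)%:C) =
        - cintegral (leb2 R) (rect a b) (fun z => g1 z * (phi z)%:C) /\
        cintegral (leb2 R) (rect a b) (fun z => u z * (pd2 phi z)%:C) =
        - cintegral (leb2 R) (rect a b) (fun z => g2 z * (phi z)%:C)].

(* t is the boundary trace of u: the trace operator is the continuous
   extension, from H^1(R_{a,b}) to L^2 of the boundary, of the restriction to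
   the boundary of functions that are C^1 up to the boundary. *)
Definition H1_trace (R : realType) (a b : R) (u g1 g2 t : R * R -> R[i]) :
    Prop :=
  bd_inL2 a b t /\
  exists w : nat -> R * R -> R[i],
    [/\ forall j, cC1 (w j),
        norm2sq (leb2 R) (rect a b) (fun z => w j z - u z)
          @[j --> \oo] --> 0%E,
        norm2sq (leb2 R) (rect a b) (fun z => cpd1 (w j) z - g1 z)
          @[j --> \oo] --> 0%E,
        norm2sq (leb2 R) (rect a b) (fun z => cpd2 (w j) z - g2 z)
          @[j --> \oo] --> 0%E &
        bd_norm2sq a b (fun z => w j z - t z) @[j --> \oo] --> 0%E].

Definition H1 (R : realType) (a b : R) (u g1 g2 t : R * R -> R[i]) : Prop :=
  H1_grad a b u g1 g2 /\ H1_trace a b u g1 g2 t.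

(* The sesquilinear form of the Robin Laplacian on functions with weak
   gradients (g1, g2), (h1, h2) and traces t, s. *)
Definition robin_form (R : realType) (sigma a b : R)
    (g1 g2 t h1 h2 s : R * R -> R[i]) : R[i] :=
  cintegral (leb2 R) (rect a b)
    (fun z => g1 z * (h1 z)^* + g2 z * (h2 z)^*) +
  sigma%:C * bd_cintegral a b (fun z => t z * (s z)^*).

(* Graph of the self-adjoint operator associated with the form: u is in the
   domain and is mapped to f. *)
Definition robin_laplacian (R : realType) (sigma a b : R)
    (u f : R * R -> R[i]) : Prop :=
  inL2 (leb2 R) (rect a b) f /\
  exists g1 g2 t : R * R -> R[i],
    H1 a b u g1 g2 t /\
    forall v h1 h2 s : R * R -> R[i], H1 a b v h1 h2 s ->
      robin_form sigma a b g1 g2 t h1 h2 s =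
      cintegral (leb2 R) (rect a b) (fun z => f z * (v z)^*).

Definition robin_ker (R : realType) (sigma a b : R) (Lam : R[i]) :
    set (R * R -> R[i]) :=
  [set u | robin_laplacian sigma a b u (fun z => Lam * u z)].

Definition robin_eigenvalue (R : realType) (sigma a b : R) (Lam : R[i]) :
    Prop :=
  exists2 u, robin_ker sigma a b Lam u & norm2sq (leb2 R) (rect a b) u != 0%E.

(* Complement of the set of Lam for which -Delta - Lam is a bijection from
   the domain onto L^2 (the operator being closed, its inverse is then
   bounded). *)
Definition robin_spec (R : realType) (sigma a b : R) : set R[i] :=
  [set Lam | ~
    ((forall u, robin_ker sigma a b Lam u ->
        norm2sq (leb2 R) (rect a b) u = 0%E) /\
     (forall f, inL2 (leb2 R) (rect a b) f ->
        exists u, robin_laplacian sigma a b u (fun z => Lam * u z + f z)))].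

(* mu is an eigenvalue of -phi'' = mu phi on (0,1) with -phi'(0) + tau phi(0)
   = 0 and phi'(1) + tau phi(1) = 0; d0 and d1 are the one-sided derivatives
   of phi at the endpoints. *)
Definition robin1_eigenvalue (R : realType) (tau mu : R) : Prop :=
  exists (phi : R -> R) (d0 d1 : R),
    [/\ forall x : R, 0 < x < 1 ->
          [/\ derivable phi x 1, derivable (derive1 phi) x 1 &
              - derive1 (derive1 phi) x = mu * phi x],
        h^-1 * (phi h - phi 0) @[h --> 0^'+] --> d0,
        h^-1 * (phi (1 + h) - phi 1) @[h --> 0^'-] --> d1,
        - d0 + tau * phi 0 = 0 /\ d1 + tau * phi 1 = 0 &
        exists2 x : R, 0 < x < 1 & phi x != 0].

(* The eigenvalues of this problem are simple and positive for tau > 0, so the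
   (n+1)-st one is the eigenvalue with exactly n eigenvalues below it. *)
Definition robin1_nth_eigenvalue (R : realType) (tau : R) (n : nat) : set R :=
  [set mu | robin1_eigenvalue tau mu /\
            ([set nu | robin1_eigenvalue tau nu /\ nu < mu] #= `I_n)%card].

Definition robin_k (R : realType) (n : nat) (tau : R) : R :=
  Num.sqrt (xget 0 (robin1_nth_eigenvalue tau n)).

Definition rect_Lambda (R : realType) (sigma a b : R) (n m : nat) : R :=
  robin_k n (a * sigma) ^+ 2 / a ^+ 2 + robin_k m (b * sigma) ^+ 2 / b ^+ 2.

(* The modal class of (n, m), as the set of ordered pairs it contains. *)
Definition modal_class (R : realType) (a b : R) (p : nat * nat) :
    set (nat * nat) :=
  if a == b then [set p; (p.2, p.1)] else [set p].

Definition kappa_rect (R : realType) (sigma a b : R) (Lam : R[i]) : \bar R :=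
  counting [set modal_class a b p | p in
    [set p : nat * nat | (rect_Lambda sigma a b p.1 p.2)%:C = Lam]].

Definition K_rect (R : realType) (sigma a b : R) : \bar R :=
  ereal_sup [set kappa_rect sigma a b Lam | Lam in robin_spec sigma a b].

(* Main.v *)
Require Import Defs.
From HB Require Import structures.
From mathcomp Require Import all_boot all_order all_algebra.
From mathcomp Require Import all_classical all_reals all_analysis complex.
From mathcomp Require Import measurable_realfun.
From mathcomp Require Import ring lra zify.
Set Implicit Arguments.
Unset Strict Implicit.
Unset Printing Implicit Defensive.
Import Order.TTheory GRing.Theory Num.Theory.
Import numFieldNormedType.Exports.
Local Open Scope classical_set_scope.
Local Open Scope ring_scope.

(** The Robin frequencies of an interval of length [L] are the solutions [w] of
    [L w + 2 atan (w / s) = (n + 1) pi], so [w^2] stays within a constant of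
    [(n pi / L)^2].  With [a^2 Q = b^2 P], the form [Q n^2 + P m^2] therefore
    takes boundedly many values on the pairs [(n, m)] with a given eigenvalue.
    On the quarter circle [w1^2 + w2^2 = const], the same form, with [n] and [m]
    expressed through [w1] and [w2], is strictly convex in [w1^2], so each of
    these values is taken at most twice: multiplicities are bounded.

    The weak formulation, tested against products of one-dimensional modes,
    shows that an eigenfunction is orthogonal to the products with another
    eigenvalue; as the products are complete, it is a sum of boundedly many of
    them, and its restrictions to horizontal and vertical lines are sums of
    boundedly many cosines.  By a Turan-type inequality such a sum is bounded
    at a point by its values at the next points of any arithmetic progression.
    Near a density point of a set of positive measure, most progressions stay in
    the part of the set where the sum is not large, which bounds the sum
    everywhere by its [L^2] norm on the set, with a constant depending on the
    number of cosines only.  Two applications, one in each variable, conclude. *)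

(** * Square integrable functions *)

(** Rationality of a^2 / b^2 enters through the integrality of [qform]: boundedly many values become
    finitely many. The convexity that leaves at most two pairs per value rests on the elementary
    inequality sin t cos t <= t with t = pi/2 - atan(w / s). Completeness on an interval comes from
    Picone's identity rather than from spectral theory: a C^1 function vanishing at the [N] zeros of
    the mode of index [N] has Rayleigh quotient at least [om N ^+ 2], and any C^1 function is
    brought to this case by subtracting a combination of the first [N] modes. For a fixed C^1
    function the distance to the span of these modes is therefore O(1 / om N). The obstacle in the
    second claim is uniformity in the eigenvalue: frequencies are unbounded, so compactness or
    derivative bounds on eigenfunctions would give constants that degenerate. The Turan-type
    inequality depends on the number of cosines and not on their frequencies, so the uniform bound
    on multiplicities is exactly what it needs. *)

Section square_integrable.
Context d (T : measurableType d) (R : realType).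
Variables (mu : {measure set T -> \bar R}) (D : set T).
Hypothesis mD : measurable D.
Implicit Types (f g h : T -> R).

Definition ip f g : R := \int[mu]_(x in D) (f x * g x).

Definition L2 f : Prop :=
  measurable_fun D f /\ (\int[mu]_(x in D) (f x ^+ 2)%:E < +oo)%E.

Lemma L2_sqr_integrable f : L2 f -> mu.-integrable D (EFin \o (fun x => f x ^+ 2)).
Proof.
move=> [mf f2]; apply/integrableP; split.
  by apply/measurable_EFinP; exact: measurable_funX.
under eq_integral do rewrite /= ger0_norm ?sqr_ge0//.
exact: f2.
Qed.

Lemma L2_mul_integrable f g :
  L2 f -> L2 g -> mu.-integrable D (EFin \o (fun x => f x * g x)).
Proof.
move=> Lf Lg.
have i2 : mu.-integrable D (EFin \o (fun x => f x ^+ 2 + g x ^+ 2)).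
  exact: integrableD (L2_sqr_integrable Lf) (L2_sqr_integrable Lg).
apply: le_integrable i2 => //.
  by apply/measurable_EFinP/measurable_funM; [exact: Lf.1|exact: Lg.1].
move=> x Dx /=; rewrite lee_fin [leRHS]ger0_norm ?addr_ge0 ?sqr_ge0//.
have := sqr_ge0 (`|f x| - `|g x|); have := sqr_ge0 (`|f x| + `|g x|).
by rewrite normrM -(real_normK (num_real (f x))) -(real_normK (num_real (g x))); nra.
Qed.

Lemma integrable_L2 f : measurable_fun D f ->
  mu.-integrable D (EFin \o (fun x => f x ^+ 2)) -> L2 f.
Proof.
move=> mf /integrableP[_ h]; split => //.
move: h; under eq_integral do rewrite /= ger0_norm ?sqr_ge0//.
by [].
Qed.

Lemma L2D f g : L2 f -> L2 g -> L2 (fun x => f x + g x).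
Proof.
move=> Lf Lg; apply: integrable_L2.
  by apply: measurable_funD; [exact: Lf.1|exact: Lg.1].
have i := L2_mul_integrable Lf Lg.
have i1 := integrableD mD (L2_sqr_integrable Lf) (L2_sqr_integrable Lg).
apply: eq_integrable (integrableD mD i1 (integrableD mD i i)) => // x _ /=.
by rewrite -!EFinD; congr EFin; ring.
Qed.

Lemma L2Z (c : R) f : L2 f -> L2 (fun x => c * f x).
Proof.
move=> Lf; apply: integrable_L2.
  by apply: measurable_funM => //; exact: Lf.1.
have := L2_sqr_integrable Lf => /(integrableZl mD (c ^+ 2)).
by apply: eq_integrable => // x _ /=; rewrite exprMn EFinM.
Qed.

Lemma L2_eq f g : (forall x, D x -> f x = g x) -> L2 f -> L2 g.
Proof.
move=> fg [mf i]; split; first by apply: eq_measurable_fun mf => x /set_mem/fg.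
by move: i; under eq_integral => x /set_mem Dx do rewrite fg//.
Qed.

Lemma L2N f : L2 f -> L2 (fun x => - f x).
Proof. by move=> /(L2Z (-1)); apply: L2_eq => x _; rewrite mulN1r. Qed.

Lemma L2B f g : L2 f -> L2 g -> L2 (fun x => f x - g x).
Proof. by move=> Lf Lg; apply: L2D => //; exact: L2N. Qed.

Lemma L2_0 : L2 (fun=> 0).
Proof.
split => //; under eq_integral do rewrite expr0n/=.
by rewrite integral0.
Qed.

Lemma L2_sum (I : Type) (r : seq I) (F : I -> T -> R) :
  (forall i, L2 (F i)) -> L2 (fun x => \sum_(i <- r) F i x).
Proof.
move=> LF; elim: r => [|i r IH].
  by apply: L2_eq L2_0 => x _; rewrite big_nil.
by apply: L2_eq (L2D (LF i) IH) => x _; rewrite big_cons.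
Qed.

Lemma L2_bounded f (M : R) : (mu D < +oo)%E -> measurable_fun D f ->
  (forall x, D x -> `|f x| <= M) -> L2 f.
Proof.
move=> muD mf fM; split => //.
have M0 x : D x -> f x ^+ 2 <= M ^+ 2.
  move=> Dx; rewrite -real_normK ?num_real// lerXn2r ?nnegrE ?fM//.
  exact: le_trans (fM _ Dx).
apply: le_lt_trans (_ : \int[mu]_(x in D) (M ^+ 2)%:E < +oo)%E.
  apply: ge0_le_integral => //.
  - by move=> x _; rewrite lee_fin sqr_ge0.
  - by apply/measurable_EFinP; exact: measurable_funX.
by rewrite integral_cst// lte_mul_pinfty// ?lee_fin ?sqr_ge0.
Qed.

Lemma ipC f g : ip f g = ip g f.
Proof. by apply: eq_Rintegral => x _; rewrite mulrC. Qed.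

Lemma eq_ip f f' g g' : (forall x, D x -> f x = f' x) ->
  (forall x, D x -> g x = g' x) -> ip f g = ip f' g'.
Proof. by move=> ff gg; apply: eq_Rintegral => x /set_mem Dx; rewrite ff// gg. Qed.

Lemma ipDl f g h : L2 f -> L2 g -> L2 h ->
  ip (fun x => f x + g x) h = ip f h + ip g h.
Proof.
move=> Lf Lg Lh; rewrite /ip -RintegralD//; try exact: L2_mul_integrable.
by apply: eq_Rintegral => x _; rewrite mulrDl.
Qed.

Lemma ipZl c f h : L2 f -> L2 h -> ip (fun x => c * f x) h = c * ip f h.
Proof.
move=> Lf Lh; rewrite /ip -RintegralZl//; try exact: L2_mul_integrable.
by apply: eq_Rintegral => x _; rewrite mulrA.
Qed.

Lemma ipBl f g h : L2 f -> L2 g -> L2 h ->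
  ip (fun x => f x - g x) h = ip f h - ip g h.
Proof.
move=> Lf Lg Lh; rewrite /ip -RintegralB//; try exact: L2_mul_integrable.
by apply: eq_Rintegral => x _; rewrite mulrBl.
Qed.

Lemma ipDr f g h : L2 f -> L2 g -> L2 h ->
  ip f (fun x => g x + h x) = ip f g + ip f h.
Proof. by move=> Lf Lg Lh; rewrite ipC ipDl// ipC [X in _ + X]ipC. Qed.

Lemma ipZr c f h : L2 f -> L2 h -> ip f (fun x => c * h x) = c * ip f h.
Proof. by move=> Lf Lh; rewrite ipC ipZl// ipC. Qed.

Lemma ipBr f g h : L2 f -> L2 g -> L2 h ->
  ip f (fun x => g x - h x) = ip f g - ip f h.
Proof. by move=> Lf Lg Lh; rewrite ipC ipBl// ipC [X in _ - X]ipC. Qed.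

Lemma ip_suml (I : Type) (r : seq I) (F : I -> T -> R) h :
  (forall i, L2 (F i)) -> L2 h ->
  ip (fun x => \sum_(i <- r) F i x) h = \sum_(i <- r) ip (F i) h.
Proof.
move=> LF Lh; elim: r => [|i r IH].
  rewrite big_nil /ip; under eq_Rintegral do rewrite big_nil mul0r.
  by rewrite /Rintegral integral0.
rewrite big_cons -IH -ipDl//; last exact: L2_sum.
by apply: eq_ip => // x _; rewrite big_cons.
Qed.

Lemma ip_ge0 f : 0 <= ip f f.
Proof. by apply: Rintegral_ge0 => x _; rewrite -expr2 sqr_ge0. Qed.

Lemma ip_sqr f : L2 f -> (\int[mu]_(x in D) (f x ^+ 2)%:E)%E = (ip f f)%:E.
Proof.
move=> Lf; rewrite /ip /Rintegral fineK//.
  by apply: integrable_fin_num => //; exact: L2_mul_integrable.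
Qed.

Lemma cauchy_schwarz f g : L2 f -> L2 g -> ip f g ^+ 2 <= ip f f * ip g g.
Proof.
move=> Lf Lg.
have P (t s : R) : 0 <= t ^+ 2 * ip f f + 2 * (t * s) * ip f g + s ^+ 2 * ip g g.
  have Lt := L2Z t Lf; have Ls := L2Z s Lg.
  have := ip_ge0 (fun x => t * f x + s * g x).
  rewrite ipDl ?ipDr//; last exact: L2D.
  rewrite !ipZl// !ipZr//.
  by rewrite (ipC g f); nra.
(* This choice turns the form into [ip g g] times the difference of the two sides. *)
have A := P (ip g g) (- ip f g).
have B := P 1 (- ip f g).
have := ip_ge0 f; have := ip_ge0 g => g0 f0.
have [g_0|gn0] := eqVneq (ip g g) 0.
  rewrite g_0 in A B *.
  have [->|fg0] := eqVneq (ip f g) 0; first by rewrite expr0n/= mulr0.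
  (* If [g] has norm 0, the form is affine in [s]; for this [s] it would equal -1. *)
  have C := P 1 (- (ip f f + 1) / (2 * ip f g)).
  have E : 2 * (1 * (- (ip f f + 1) / (2 * ip f g))) * ip f g = - (ip f f + 1).
    by field.
  by rewrite E g_0 in C; lra.
have gp : 0 < ip g g by rewrite lt_neqAle eq_sym gn0.
have : 0 <= ip g g * (ip g g * ip f f - ip f g ^+ 2) by nra.
by rewrite pmulr_rge0//; nra.
Qed.

(** Cauchy-Schwarz for [w n - f] and [h]. This is how identities proved for C^1 functions pass to
    the limit in the weak formulation. *)
Lemma ip_cvg (w : nat -> T -> R) f h : (forall n, L2 (w n)) -> L2 f -> L2 h ->
  ip (fun x => w n x - f x) (fun x => w n x - f x) @[n --> \oo] --> 0 ->
  ip (w n) h @[n --> \oo] --> ip f h.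
Proof.
move=> Lw Lf Lh w0.
have Lwf n : L2 (fun x => w n x - f x) by exact: L2B.
suff : (fun n => ip (w n) h - ip f h) @ \oo --> 0 by move/cvg_sub0; apply; exact: cvg_cst.
apply/cvgrPdist_lt => e e0.
have e2 : 0 < e ^+ 2 / (ip h h + 1).
  by rewrite divr_gt0 ?exprn_gt0// ltr_wpDl// ip_ge0.
move/cvgrPdist_lt : w0 => /(_ _ e2); apply: filterS => n.
rewrite !sub0r !normrN (ger0_norm (ip_ge0 _)) ltr_pdivlMr ?ltr_wpDl ?ip_ge0// => H.
rewrite -(ltr_pXn2r (_ : (0 < 2)%N)) ?nnegrE// ?(ltW e0)//.
rewrite real_normK ?num_real// -ipBl//.
apply: le_lt_trans (cauchy_schwarz (Lwf n) Lh) _.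
apply: le_lt_trans H; rewrite ler_wpM2l ?ip_ge0//; lra.
Qed.

End square_integrable.

(** * Calculus of C^1 functions on an interval *)

Section one_dim.
Variable R : realType.
Implicit Types (f g F G : R -> R) (a b x : R).

Definition D1 f f' : Prop := (forall x, is_derive x (1:R) f (f' x)) /\ continuous f'.

Lemma is_derive_cont f f' : (forall x, is_derive x (1:R) f (f' x)) -> continuous f.
Proof.
move=> df x; apply: differentiable_continuous.
by apply/derivable1_diffP; exact: (@ex_derive _ _ _ _ _ _ _ (df x)).
Qed.

Lemma D1_cont f f' : D1 f f' -> continuous f.
Proof. by case=> /is_derive_cont. Qed.

Lemma D1M f f' g g' : D1 f f' -> D1 g g' ->
  D1 (fun x => f x * g x) (fun x => f' x * g x + f x * g' x).
Proof.
move=> Df Dg; split.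
  move=> x; have := Df.1 x; have := Dg.1 x => dg df.
  rewrite (_ : _ + _ = f x *: g' x + g x *: f' x); last by rewrite /GRing.scale/=; ring.
  exact (is_deriveM df dg).
move=> x; apply: cvgD; apply: cvgM.
- exact: Df.2.
- exact: (D1_cont Dg).
- exact: (D1_cont Df).
- exact: Dg.2.
Qed.

Lemma D1D f f' g g' : D1 f f' -> D1 g g' ->
  D1 (fun x => f x + g x) (fun x => f' x + g' x).
Proof.
move=> Df Dg; split.
  by move=> x; have := Df.1 x; have := Dg.1 x => dg df; exact: is_deriveD.
by move=> x; apply: cvgD; [exact: Df.2|exact: Dg.2].
Qed.

Lemma D1_cst (c : R) : D1 (fun=> c) (fun=> 0).
Proof. by split; [move=> x; exact: is_derive_cst|move=> x; exact: cvg_cst]. Qed.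

Lemma D1_eq f f' g g' : f =1 g -> f' =1 g' -> D1 f f' -> D1 g g'.
Proof. by move=> /funext -> /funext ->. Qed.

Lemma D1Z (c : R) f f' : D1 f f' -> D1 (fun x => c * f x) (fun x => c * f' x).
Proof.
move=> Df; apply: D1_eq (D1M (D1_cst c) Df) => x //.
by rewrite mul0r add0r.
Qed.

Lemma D1N f f' : D1 f f' -> D1 (fun x => - f x) (fun x => - f' x).
Proof. by move=> Df; apply: D1_eq (D1Z (-1) Df) => x; rewrite mulN1r. Qed.

Lemma D1B f f' g g' : D1 f f' -> D1 g g' ->
  D1 (fun x => f x - g x) (fun x => f' x - g' x).
Proof. by move=> Df Dg; exact: D1D Df (D1N Dg). Qed.

Lemma D1_sum (I : Type) (r : seq I) (F F' : I -> R -> R) :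
  (forall i, D1 (F i) (F' i)) ->
  D1 (fun x => \sum_(i <- r) F i x) (fun x => \sum_(i <- r) F' i x).
Proof.
move=> DF; elim: r => [|i r IH].
  by apply: D1_eq (D1_cst 0) => x; rewrite big_nil.
by apply: D1_eq (D1D (DF i) IH) => x; rewrite big_cons.
Qed.

Lemma FTC a b f f' : a < b -> D1 f f' ->
  \int[leb1 R]_(x in `]a, b[) f' x = f b - f a.
Proof.
move=> ab Df.
have cc : {within `[a, b], continuous f'}.
  by apply: continuous_subspaceT; exact: Df.2.
have i : (leb1 R).-integrable `[a, b]%classic (EFin \o f').
  by apply: continuous_compact_integrable => //; exact: segment_compact.
rewrite Rintegral_itv_obnd_cbnd; last first.
  by apply: integrableS i => //; exact: subset_itv_oo_cc.
rewrite Rintegral_itv_bndo_bndc; last first.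
  by apply: integrableS i => //; exact: subset_itv_co_cc.
have cf := D1_cont Df.
rewrite /Rintegral (@continuous_FTC2 R f' f a b)//.
- split.
  + by move=> x _; exact: (@ex_derive _ _ _ _ _ _ _ (Df.1 x)).
  + by apply: cvg_at_right_filter; exact: cf.
  + by apply: cvg_at_left_filter; exact: cf.
- by move=> x _; rewrite derive1E; exact: (@derive_val _ _ _ _ _ _ _ (Df.1 x)).
Qed.

Lemma continuous_bounded a b f : continuous f ->
  exists M : R, forall x, a <= x <= b -> `|f x| <= M.
Proof.
move=> cf; have cw : {within `[a, b], continuous f} by exact: continuous_subspaceT.
have c := continuous_compact cw (@segment_compact R a b).
have := compact_bounded c; rewrite /bounded_near => -[M [_ HM]].
exists (M + 1) => x xab.
by apply: (HM (M + 1)); [rewrite ltrDl|exists x => //=; rewrite in_itv].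
Qed.

Lemma leb1_itv a b : (leb1 R `]a, b[%classic < +oo)%E.
Proof.
have := @lebesgue_measure_itv R `]a, b[; rewrite /leb1 => /= ->.
by case: ifP => _; rewrite ltry.
Qed.

Lemma continuous_L2 a b f : continuous f -> L2 (leb1 R) `]a, b[%classic f.
Proof.
move=> cf; have [M HM] := continuous_bounded a b cf.
apply: (@L2_bounded _ _ _ _ _ _ _ M) => //; first exact: leb1_itv.
- apply: measurable_funTS; exact: continuous_measurable_fun.
- by move=> x /=; rewrite in_itv /= => /andP[ax xb]; apply: HM; rewrite !ltW.
Qed.

Lemma ibp a b f f' g g' : a < b -> D1 f f' -> D1 g g' ->
  ip (leb1 R) `]a, b[ f' g = f b * g b - f a * g a - ip (leb1 R) `]a, b[ f g'.
Proof.
move=> ab Df Dg; rewrite -(FTC ab (D1M Df Dg)) /ip RintegralD//.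
- by rewrite addrK.
- apply: L2_mul_integrable => //; apply: continuous_L2; [exact: Df.2|exact: D1_cont Dg].
- apply: L2_mul_integrable => //; apply: continuous_L2; [exact: D1_cont Df|exact: Dg.2].
Qed.

End one_dim.

(** * Modes of an interval *)

Section phase.
Variable R : realType.
Implicit Types (t k x : R) (n : nat).

(* The Robin conditions on (0,1) read tan k = 2 t k / (k^2 - t^2), that is, the
   phase is a multiple of pi. *)
Definition phase t k : R := k + 2 * atan (k / t).

Lemma is_derive_phase t k : 0 < t ->
  is_derive k (1:R) (phase t) (1 + 2 * t / (k ^+ 2 + t ^+ 2)).
Proof.
move=> t0; rewrite /phase.
apply: is_derive_eq; rewrite /GRing.scale /=.
have H : 1 + (k / t) ^+ 2 = (k ^+ 2 + t ^+ 2) / t ^+ 2.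
  by field; rewrite gt_eqF.
have H2 : k ^+ 2 + t ^+ 2 != 0 by rewrite gt_eqF// ltr_wpDl ?exprn_gt0// sqr_ge0.
by rewrite H; field; rewrite H2 gt_eqF.
Qed.

Lemma phase_cont t : 0 < t -> continuous (phase t).
Proof. by move=> t0; apply: is_derive_cont => x; exact: is_derive_phase. Qed.

Lemma phase_mono t : 0 < t -> {mono phase t : x y / x <= y}.
Proof.
move=> t0; apply: le_mono => x y xy; rewrite /phase.
by rewrite ltrD// ltr_pM2l// lt_atan// ltr_pM2r ?invr_gt0.
Qed.

Lemma phase_incr t : 0 < t -> {mono phase t : x y / x < y}.
Proof. by move=> t0; exact/leW_mono/phase_mono. Qed.

Lemma phase_root t n : 0 < t -> exists k, 0 < k /\ phase t k = n.+1%:R * pi.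
Proof.
move=> t0; have p0 := pi_gt0 R.
have n1 : 0 < n.+1%:R * (pi : R) by rewrite mulr_gt0.
have [||c cin pc] := @IVT R (phase t) 0 (n.+1%:R * pi) (n.+1%:R * pi) (ltW n1).
- by apply: continuous_subspaceT; exact: phase_cont.
- rewrite ge_min le_max /phase mul0r atan0 mulr0 addr0 (ltW n1)/=.
  apply/orP; right; rewrite lerDl mulr_ge0// -[leLHS]atan0 le_atan//.
  by rewrite divr_ge0 ?(ltW n1) ?(ltW t0).
exists c; split => //; rewrite lt_neqAle; move: cin; rewrite in_itv/= => /andP[-> _].
rewrite andbT; apply/eqP => c0; move: pc; rewrite -c0 /phase mul0r atan0 mulr0 addr0.
by move=> H; rewrite -H ltxx in n1.
Qed.

(** Monotonicity of the phase makes the root unique; [robin_kE] identifies it with [robin_k n t]. *)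
Definition kap t n : R := xget 0 [set k | 0 < k /\ phase t k = n.+1%:R * pi].

Lemma kapP t n : 0 < t -> 0 < kap t n /\ phase t (kap t n) = n.+1%:R * pi.
Proof.
move=> t0; have [k kP] := phase_root n t0.
by rewrite /kap; case: xgetP => [y _ []//|/(_ k)]; case.
Qed.

Lemma kap_gt0 t n : 0 < t -> 0 < kap t n.
Proof. by move=> /(kapP n)[]. Qed.

Lemma kap_phase t n : 0 < t -> phase t (kap t n) = n.+1%:R * pi.
Proof. by move=> /(kapP n)[]. Qed.

Lemma kap_uniq t n k : 0 < t -> phase t k = n.+1%:R * pi -> k = kap t n.
Proof.
move=> t0; rewrite -(kap_phase n t0).
exact/inc_inj/phase_mono.
Qed.

Lemma kap_mono t : 0 < t -> {mono kap t : n m / (n < m)%N >-> n < m}.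
Proof.
move=> t0 n m; rewrite -(phase_incr t0) !kap_phase// ltr_pM2r ?pi_gt0//.
by rewrite ltr_nat ltnS.
Qed.

Lemma kap_gt t n : 0 < t -> n%:R * pi < kap t n.
Proof.
move=> t0; have := kap_phase n t0; rewrite /phase => H.
have := atan_ltpi2 (kap t n / t); rewrite -natr1 in H.
by lra.
Qed.

Lemma sin_atan (x : R) : sin (atan x) = x * cos (atan x).
Proof.
rewrite -[X in _ = X * _](atanK x) /tan mulrVK// unitfE.
by rewrite gt_eqF// cos_gt0_pihalf// atan_gtNpi2 atan_ltpi2.
Qed.

Lemma cosDnpi x n : cos (x + n%:R * pi) = (-1) ^+ n * cos x.
Proof.
elim: n x => [|n IH] x; first by rewrite mul0r addr0 mul1r.
by rewrite -natr1 mulrDl mul1r addrA cosDpi IH exprS mulN1r mulNr.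
Qed.

Lemma sinDnpi x n : sin (x + n%:R * pi) = (-1) ^+ n * sin x.
Proof.
elim: n x => [|n IH] x; first by rewrite mul0r addr0 mul1r.
by rewrite -natr1 mulrDl mul1r addrA sinDpi IH exprS mulN1r mulNr.
Qed.

End phase.

Section modes.
Variables (R : realType) (L s : R).
Hypotheses (L0 : 0 < L) (s0 : 0 < s).

(** Scaling (0, L) to (0, 1) multiplies the Robin parameter by [L]. The shift [th] is the angle in
    (0, pi/2) with om tan th = s, which is the condition at 0 for the cosine [md]. *)
Definition om n : R := kap (L * s) n / L.
Definition th n : R := pi / 2 - atan (om n / s).
Definition md n (x : R) : R := cos (om n * x - th n).
Definition md' n (x : R) : R := - om n * sin (om n * x - th n).

Let Ls0 : 0 < L * s. Proof. exact: mulr_gt0. Qed.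

Lemma om_gt0 n : 0 < om n.
Proof. by rewrite divr_gt0// kap_gt0. Qed.

Lemma om_phase n : om n * L + 2 * atan (om n / s) = n.+1%:R * pi.
Proof.
rewrite -(kap_phase n Ls0) /phase /om mulfVK ?gt_eqF//.
by congr (_ + _ * atan _); rewrite invfM mulrA.
Qed.

Lemma om_mono : {mono om : n m / (n < m)%N >-> n < m}.
Proof. by move=> n m; rewrite /om ltr_pM2r ?invr_gt0// kap_mono. Qed.

Lemma om_gt n : n%:R * pi / L < om n.
Proof. by rewrite /om ltr_pM2r ?invr_gt0// kap_gt. Qed.

Lemma th_gt0 n : 0 < th n.
Proof. by rewrite /th subr_gt0 atan_ltpi2. Qed.

Lemma th_lt n : th n < pi / 2.
Proof.
rewrite /th ltrBlDr ltrDl -[ltLHS]atan0 lt_atan//.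
by rewrite divr_gt0 ?om_gt0.
Qed.

(** The phase equation in symmetric form: the argument of the cosine runs from -th to th + n pi, so
    the mode is even or odd about the midpoint and the condition at [L] mirrors the one at 0. *)
Lemma om_th n : om n * L = n%:R * pi + 2 * th n.
Proof.
have := om_phase n; rewrite /th -natr1 mulrDl mul1r mulrBr mulrC.
have -> : 2 * (pi / 2) = pi :> R by field.
by move=> H; lra.
Qed.

Lemma th_tan n : om n * sin (th n) = s * cos (th n).
Proof.
rewrite /th -opprB cosN sinN cosBpihalf sinBpihalf opprK sin_atan.
by rewrite mulrA; congr (_ * _); rewrite mulrC mulfVK ?gt_eqF.
Qed.

Lemma md_D1 n : D1 (md n) (md' n).
Proof.
split; last first.
  apply: (@is_derive_cont _ _ (fun x => - om n ^+ 2 * md n x)) => x.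
  by rewrite /md /md'; apply: is_derive_eq; rewrite /GRing.scale/=; ring.
by move=> x; rewrite /md /md'; apply: is_derive_eq; rewrite /GRing.scale/=; ring.
Qed.

Lemma md'_D1 n : D1 (md' n) (fun x => - om n ^+ 2 * md n x).
Proof.
split; last first.
  move=> x; apply: cvgM; first exact: cvg_cst.
  exact: (D1_cont (md_D1 n)).
move=> x; rewrite /md /md'; apply: is_derive_eq; rewrite /GRing.scale/=; ring.
Qed.

Lemma md_bc0 n : md' n 0 = s * md n 0.
Proof. by rewrite /md /md' mulr0 sub0r sinN cosN mulrNN th_tan. Qed.

Lemma md_bcL n : md' n L = - s * md n L.
Proof.
rewrite /md /md' (_ : om n * L - th n = th n + n%:R * pi); last by rewrite om_th; ring.
by rewrite cosDnpi sinDnpi mulrCA mulNr th_tan mulrCA mulNr.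
Qed.

Lemma md0_gt0 n : 0 < md n 0.
Proof.
rewrite /md mulr0 sub0r cosN cos_gt0_pihalf// th_lt andbT.
by rewrite (lt_trans _ (th_gt0 n))// oppr_lt0 divr_gt0 ?pi_gt0.
Qed.

End modes.

(** * Completeness of the modes of an interval *)

Section picone.
Variable R : realType.
Implicit Types (f g e : R -> R) (a b x : R).

(** The base point [c] is kept strictly to the left of the interval of interest, so that [G] has a
    two-sided derivative at the endpoints as well. *)
Lemma antiderivative (c : R) g : continuous g -> exists G : R -> R,
  (forall x, c < x -> is_derive x (1:R) G (g x)) /\
  (forall a b, c < a -> a < b -> \int[leb1 R]_(x in `]a, b[) g x = G b - G a).
Proof.
move=> cg.
pose G x := (\int[lebesgue_measure]_(t in `[c, x]) g t)%R.
have ig a b : (leb1 R).-integrable `[a, b]%classic (EFin \o g).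
  apply: continuous_compact_integrable; first exact: segment_compact.
  exact: continuous_subspaceT.
have dG x : c < x -> is_derive x (1:R) G (g x).
  move=> cx.
  have x1 : x < x + 1 by rewrite ltrDl.
  have [d1 d2] := @continuous_FTC1_closed R g c x (x + 1) x1 (ig c (x + 1)) cx (cg x).
  by apply: (DeriveDef d1); rewrite -derive1E.
exists G; split => // a b ca ab.
rewrite /G Rintegral_itvB//; last first.
- by rewrite bnd_simp ltW.
- by rewrite bnd_simp ltW.
- rewrite Rintegral_itv_bndo_bndc//.
  by apply: integrableS (ig a b) => //; exact: subset_itv_oo_cc.
Qed.

(** At a common zero, where the zero of [e] is simple, Caratheodory's factorizations f = p (y - x)
    and e = q (y - x) turn the quotient into f p e' / q. Its value at [x] is 0, which is also what
    division by zero gives. *)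
Lemma picone_cont f f' e e' x : D1 f f' -> D1 e e' ->
  e x != 0 \/ (f x = 0 /\ e x = 0 /\ e' x != 0) ->
  {for x, continuous (fun y => f y ^+ 2 * e' y / e y)}.
Proof.
move=> Df De [ex|[fx [ex e'x]]].
  apply: cvgM; last by apply: cvgV => //; exact: (D1_cont De).
  apply: cvgM; last exact: De.2.
  by apply: cvgM; exact: (D1_cont Df).
have /is_derive1_caratheodory[p [pE pc px]] := Df.1 x.
have /is_derive1_caratheodory[q [qE qc qx]] := De.1 x.
rewrite (_ : (fun y => _) = (fun y => f y * p y * e' y / q y)); last first.
  apply/funext => y; have := pE y; have := qE y; rewrite fx ex !subr0 => -> fE.
  have [->|yx] := eqVneq y x; first by rewrite fx expr0n/= !mul0r.
  have yx0 : y - x != 0 by rewrite subr_eq0.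
  rewrite expr2 {2}fE invfM.
  by move: (q y)^-1 => r; field.
apply: cvgM; last by apply: cvgV => //; rewrite qx.
apply: cvgM; last exact: De.2.
by apply: cvgM => //; exact: (D1_cont Df).
Qed.

(** Picone's identity: if e'' = - w e, then f'^2 - w f^2 - (f^2 e' / e)' is the square of f' - f e'
    / e. Hence [G - h] is nondecreasing by the mean value theorem. *)
Lemma picone_piece f f' e e' w G a b : a < b ->
  D1 f f' -> D1 e e' -> D1 e' (fun x => - w * e x) ->
  (forall x, a < x < b -> e x != 0) ->
  (forall x, x = a \/ x = b -> e x != 0 \/ (f x = 0 /\ e x = 0 /\ e' x != 0)) ->
  (forall x, a <= x <= b -> is_derive x (1:R) G (f' x ^+ 2 - w * f x ^+ 2)) ->
  G a - f a ^+ 2 * e' a / e a <= G b - f b ^+ 2 * e' b / e b.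
Proof.
move=> ab Df De De' en eab dG.
pose h x := f x ^+ 2 * e' x / e x.
have ch x : a <= x <= b -> {for x, continuous h}.
  move=> /andP[ax xb]; apply: picone_cont Df De _.
  have [xa|xa] := eqVneq x a; first by apply: eab; left.
  have [xb'|xb'] := eqVneq x b; first by apply: eab; right.
  by left; apply: en; rewrite !lt_neqAle eq_sym xa xb' ax xb.
have cG x : a <= x <= b -> {for x, continuous G}.
  move=> xab; apply: differentiable_continuous.
  by apply/derivable1_diffP; exact: (@ex_derive _ _ _ _ _ _ _ (dG x xab)).
have dP x : x \in `]a, b[%R -> is_derive x (1:R) (fun x => G x - h x)
    ((f' x - f x * (e' x / e x)) ^+ 2).
  rewrite in_itv /= => xab; have e0 := en x xab.
  have {xab}xab : a <= x <= b by case/andP: xab => *; rewrite !ltW.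
  have d1 := dG x xab; have d2 := Df.1 x; have d3 := De.1 x; have d4 := De'.1 x.
  have d5 : is_derive x (1:R) h
     (2 * f x * f' x * e' x / e x + f x ^+ 2 * (- w * e x) / e x
       - f x ^+ 2 * e' x ^+ 2 / e x ^+ 2).
    have d6 : is_derive x (1:R) (fun y => (e y)^-1) (- (e x) ^- 2 *: e' x).
      exact: (is_deriveV e0 d3).
    rewrite /h; apply: is_derive_eq; rewrite /GRing.scale/=.
    by field.
  rewrite (_ : _ ^+ 2 = f' x ^+ 2 - w * f x ^+ 2 -
     (2 * f x * f' x * e' x / e x + f x ^+ 2 * (- w * e x) / e x
       - f x ^+ 2 * e' x ^+ 2 / e x ^+ 2)); last by field.
  exact (is_deriveB d1 d5).
have [|c _ E] := MVT ab dP.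
  apply: continuous_in_subspaceT => x /set_mem/=; rewrite in_itv/= => xab.
  by apply: cvgB; [exact: cG|exact: ch].
by rewrite -subr_ge0 -/(h a) -/(h b) E mulr_ge0 ?sqr_ge0// subr_ge0 ltW.
Qed.
End picone.

Section completeness.
Variables (R : realType) (L s : R).
Hypotheses (L0 : 0 < L) (s0 : 0 < s).
Notation om := (om L s).
Notation th := (th L s).
Notation md := (md L s).
Notation md' := (md' L s).
Notation ip1 := (ip (leb1 R) `]0, L[%classic).
Implicit Types (f g : R -> R) (n N : nat).

Definition robinq f f' g g' : R := ip1 f' g' + s * f 0 * g 0 + s * f L * g L.

Lemma D1_L2 f f' : D1 f f' -> L2 (leb1 R) `]0, L[%classic f.
Proof. by move=> Df; apply: continuous_L2; exact: D1_cont Df. Qed.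

Lemma D1_L2' f f' : D1 f f' -> L2 (leb1 R) `]0, L[%classic f'.
Proof. by move=> Df; apply: continuous_L2; exact: Df.2. Qed.

Let mdD n := md_D1 L s n.
Let L2md n : L2 (leb1 R) `]0, L[%classic (md n). Proof. exact: D1_L2 (mdD n). Qed.
Let L2md' n : L2 (leb1 R) `]0, L[%classic (md' n). Proof. exact: D1_L2' (mdD n). Qed.

(** Integration by parts: the boundary terms of the form cancel by the Robin conditions of the
    mode. *)
Lemma robinq_md f f' n : D1 f f' ->
  robinq f f' (md n) (md' n) = om n ^+ 2 * ip1 f (md n).
Proof.
move=> Df; rewrite /robinq (ibp L0 Df (md'_D1 L s n)).
rewrite (md_bc0 _ s0) (md_bcL L0 s0) ipZr//; last exact: D1_L2 Df.
ring.
Qed.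

Lemma md_orth i j : i != j -> ip1 (md i) (md j) = 0.
Proof.
move=> ij; have A := robinq_md j (mdD i); have B := robinq_md i (mdD j).
have C : robinq (md i) (md' i) (md j) (md' j) = robinq (md j) (md' j) (md i) (md' i).
  by rewrite /robinq ipC; ring.
rewrite A B [in RHS]ipC in C.
have : (om i ^+ 2 - om j ^+ 2) * ip1 (md i) (md j) = 0 by rewrite mulrBl C subrr.
move/eqP; rewrite mulf_eq0 => /orP[|/eqP//].
rewrite subr_eq0 eqrXn2// ?ltW ?om_gt0// => /eqP oij.
move: ij; rewrite neq_ltn -!(om_mono L0 s0) oij ltxx.
by [].
Qed.

(** Positivity is read off the form, where the boundary term at 0 is positive. *)
Lemma md_ip_gt0 n : 0 < ip1 (md n) (md n).
Proof.
have o2 : 0 < om n ^+ 2 by rewrite exprn_gt0// om_gt0.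
rewrite -(pmulr_rgt0 _ o2) -(robinq_md n (mdD n)) /robinq -!mulrA.
have := md0_gt0 L0 s0 n => m0.
have h1 : 0 < s * (md n 0 * md n 0) by rewrite !mulr_gt0.
have h2 : 0 <= s * (md n L * md n L) by apply: mulr_ge0; [exact: ltW|rewrite -expr2 sqr_ge0].
have := ip_ge0 (leb1 R) `]0, L[%classic (md' n); lra.
Qed.

Section span.
Variables (N : nat) (c : 'I_N -> R).

Definition mdsum (x : R) : R := \sum_(i < N) c i * md i x.
Definition mdsum' (x : R) : R := \sum_(i < N) c i * md' i x.

Lemma mdsum_D1 : D1 mdsum mdsum'.
Proof. by apply: D1_sum => i; apply: D1Z; exact: mdD. Qed.

Lemma mdsum_md (j : 'I_N) : ip1 mdsum (md j) = c j * ip1 (md j) (md j).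
Proof.
rewrite ip_suml//; last by move=> i; exact: L2Z.
rewrite (bigD1 j)//= big1 ?addr0 ?ipZl// => i ij.
by rewrite ipZl// md_orth ?mulr0.
Qed.

Lemma ip_mdsum f : L2 (leb1 R) `]0, L[%classic f ->
  ip1 f mdsum = \sum_(i < N) c i * ip1 f (md i).
Proof.
move=> Lf; rewrite ipC ip_suml//; last by move=> i; exact: L2Z.
by apply: eq_bigr => i _; rewrite ipZl// ipC.
Qed.

Lemma robinq_mdsum f f' : D1 f f' ->
  robinq f f' mdsum mdsum' = \sum_(i < N) c i * (om i ^+ 2 * ip1 f (md i)).
Proof.
move=> Df; under eq_bigr do rewrite -(robinq_md _ Df).
have Lf := D1_L2' Df.
rewrite /robinq ipC ip_suml//; last by move=> i; exact: L2Z.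
rewrite /mdsum !mulr_sumr -!big_split/=; apply: eq_bigr => i _.
by rewrite ipZl// (ipC (leb1 R) _ (md' i) f'); ring.
Qed.

End span.

Lemma robinqB f f' g g' : D1 f f' -> D1 g g' ->
  robinq (fun x => f x - g x) (fun x => f' x - g' x)
         (fun x => f x - g x) (fun x => f' x - g' x) =
  robinq f f' f f' - 2 * robinq f f' g g' + robinq g g' g g'.
Proof.
move=> Df Dg; rewrite /robinq.
have Lf := D1_L2' Df; have Lg := D1_L2' Dg.
rewrite ipBl//; last exact: L2B.
by rewrite !ipBr// (ipC (leb1 R) _ g' f'); ring.
Qed.

Definition node N (j : nat) : R := (j%:R * pi + pi / 2 + th N) / om N.

Lemma md_node N j : md N (node N j) = 0.
Proof.
rewrite /md /node mulrC mulfVK ?gt_eqF ?om_gt0// addrK addrC cosDnpi cos_pihalf.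
by rewrite mulr0.
Qed.

Lemma md'_node N j : md' N (node N j) != 0.
Proof.
rewrite /md' /node [om N * (_ / _)]mulrC mulfVK; last by rewrite gt_eqF ?om_gt0.
rewrite addrK addrC sinDnpi sin_pihalf.
by rewrite mulr1 mulf_neq0 ?signr_eq0// oppr_eq0; apply/lt0r_neq0/om_gt0.
Qed.

(** Endpoints of the [N.+1] nodal intervals of [md N]: 0, then the [N] zeros, then [L] at index
    [N.+1]. *)
Definition nodal_end N (j : nat) : R :=
  if j is j'.+1 then if (j' < N)%N then node N j' else L else 0.

Lemma om_node N j : om N * node N j = j%:R * pi + pi / 2 + th N.
Proof. by rewrite /node mulrC mulfVK// gt_eqF ?om_gt0. Qed.

Lemma nodal_end_lt N j : (j <= N)%N -> nodal_end N j < nodal_end N j.+1.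
Proof.
have o0 := om_gt0 L0 s0 N; have t0 := th_gt0 L s N; have p0 := pi_gt0 R.
have tl := th_lt L0 s0 N.
move=> jN; rewrite -(ltr_pM2l o0) /nodal_end; case: j jN => [|j] jN.
  rewrite mulr0; case: ifP => _; last by rewrite mulr_gt0.
  by rewrite om_node mul0r add0r addr_gt0// divr_gt0.
rewrite jN om_node; case: ifP => jN'.
  by rewrite om_node -natr1; nra.
have -> : N = j.+1 by apply/eqP; rewrite eqn_leq jN andbT leqNgt jN'.
have := om_th L0 s0 j.+1; rewrite -natr1; have := th_gt0 L s j.+1; nra.
Qed.

Lemma md_neq0 N j x : (j <= N)%N -> nodal_end N j < x < nodal_end N j.+1 -> md N x != 0.
Proof.
have o0 := om_gt0 L0 s0 N; have t0 := th_gt0 L s N; have p0 := pi_gt0 R.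
have tl := th_lt L0 s0 N.
move=> jN; rewrite -(ltr_pM2l o0) -(ltr_pM2l o0 x) => /andP[H1 H2].
(* On the nodal interval of index [j] the argument of the cosine stays within pi/2 of j pi; at the
   ends 0 and [L] this holds because th < pi/2. *)
have [h1 h2] : - (pi / 2) < om N * x - th N - j%:R * pi /\
   om N * x - th N - j%:R * pi < pi / 2.
  split.
    move: H1; rewrite /nodal_end; case: j jN {H2} => [|j] jN; first by rewrite mulr0; lra.
    have e : j.+1%:R * pi = j%:R * pi + pi :> R by rewrite -natr1 mulrDl mul1r.
    by rewrite jN om_node e; lra.
  move: H2; rewrite /nodal_end; case: ifP => jN'; first by rewrite om_node; lra.
  have -> : j = N by apply/eqP; rewrite eqn_leq jN leqNgt jN'.
  by rewrite (om_th L0 s0); lra.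
rewrite /md -[om N * x - th N](subrK (j%:R * pi)) cosDnpi.
by rewrite mulf_neq0 ?signr_eq0// gt_eqF// cos_gt0_pihalf// h1 h2.
Qed.

Lemma mdL_neq0 N : md N L != 0.
Proof.
rewrite /md (om_th L0 s0) (_ : _ - _ = th N + N%:R * pi); last by ring.
rewrite cosDnpi mulf_neq0 ?signr_eq0// gt_eqF// cos_gt0_pihalf// th_lt// andbT.
by rewrite (lt_trans _ (th_gt0 _ _ _))// oppr_lt0 divr_gt0 ?pi_gt0.
Qed.

(** The Picone inequalities of the nodal intervals add up: the terms f^2 e' / e vanish at the zeros
    of the mode because [f] does, and at 0 and [L] they are the Robin terms of the form. *)
Lemma picone N f f' : D1 f f' -> (forall j, (j < N)%N -> f (node N j) = 0) ->
  om N ^+ 2 * ip1 f f <= robinq f f' f f'.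
Proof.
move=> Df fz; set w := om N ^+ 2.
have cg : continuous (fun x => f' x ^+ 2 - w * f x ^+ 2).
  move=> x; apply: cvgB; first by apply: cvgM; exact: Df.2.
  apply: cvgM; first exact: cvg_cst.
  by apply: cvgM; exact: (D1_cont Df).
have [G [dG GE]] := antiderivative (-1) cg.
pose P x := G x - f x ^+ 2 * md' N x / md N x.
have pt0 j : (j <= N.+1)%N -> 0 <= nodal_end N j.
  elim: j => [//|j IH] jN; apply: le_trans (IH _) _; first exact: ltnW.
  by rewrite ltW// nodal_end_lt.
have step j : (j <= N)%N -> P (nodal_end N j) <= P (nodal_end N j.+1).
  move=> jN.
  apply: (picone_piece (w := w) (nodal_end_lt jN) Df (mdD N)).
  - exact: md'_D1.
  - by move=> x; exact: md_neq0.
  - have m0 : md N 0 != 0 by rewrite gt_eqF// md0_gt0.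
    have mL := mdL_neq0 N.
    move=> x [|] ->.
      case: j jN => [|j] jN; first by left.
      by rewrite /= jN; right; rewrite fz// md_node md'_node.
    rewrite /=; case: ifP => jN'; last by left.
    by right; rewrite fz// md_node md'_node.
  - move=> x /andP[jx _]; apply: dG; apply: lt_le_trans jx.
    by rewrite (lt_le_trans _ (pt0 _ _)) ?ltrN10// ltnW.
have H : P 0 <= P L.
  have -> : L = nodal_end N N.+1 by rewrite /= ltnn.
  have : forall j, (j <= N.+1)%N -> P 0 <= P (nodal_end N j).
    elim=> [//|j IH] jN; apply: le_trans (IH _) (step _ _) => //; exact: ltnW.
  by apply.
have E : ip1 f' f' - w * ip1 f f = G L - G 0.
  have i := L2_sqr_integrable (D1_L2 Df).
  rewrite -GE ?ltrN10// RintegralB//; last 2 first.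
  - exact: L2_sqr_integrable (D1_L2' Df).
  - by apply: eq_integrable (integrableZl _ w i).
  by rewrite RintegralZl.
have e0 : f 0 ^+ 2 * md' N 0 / md N 0 = s * f 0 * f 0.
  by rewrite md_bc0//; field; rewrite gt_eqF// md0_gt0.
have eL : f L ^+ 2 * md' N L / md N L = - (s * f L * f L).
  by rewrite md_bcL//; field; rewrite mdL_neq0.
move: H; rewrite /P e0 eL /robinq; lra.
Qed.

Section approximation.
Variables (N : nat).

Lemma mdsum_robinq (c : 'I_N -> R) : robinq (mdsum c) (mdsum' c) (mdsum c) (mdsum' c) =
  \sum_(i < N) c i ^+ 2 * om i ^+ 2 * ip1 (md i) (md i).
Proof.
rewrite (robinq_mdsum _ (mdsum_D1 c)); apply: eq_bigr => i _.
by rewrite mdsum_md; ring.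
Qed.

Lemma mdsum_ip (c : 'I_N -> R) : ip1 (mdsum c) (mdsum c) =
  \sum_(i < N) c i ^+ 2 * ip1 (md i) (md i).
Proof.
rewrite (ip_mdsum _ (D1_L2 (mdsum_D1 c))); apply: eq_bigr => i _.
by rewrite mdsum_md; ring.
Qed.

Definition node_mx : 'M[R]_N := \matrix_(i < N, j < N) md i (node N j).

Lemma om_lt_sqr (i : 'I_N) : 0 < om N ^+ 2 - om i ^+ 2.
Proof.
rewrite subr_gt0 ltrXn2r ?nnegrE ?(om_mono L0 s0)//.
by apply: ltW; exact: om_gt0.
Qed.

(* A combination of the first N modes vanishing at the zeros of the next one
   has Rayleigh quotient at least om N ^+ 2 by Picone, and less unless it is 0. *)
Lemma node_mx_unit : node_mx \in unitmx.
Proof.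
rewrite -row_free_unit -kermx_eq0; apply/eqP/row_matrixP => i0.
rewrite row0; set v := row i0 _.
have v0 : v *m node_mx = 0 by apply/sub_kermxP; exact: row_sub.
pose c i := v 0 i.
have cz j : (j < N)%N -> mdsum c (node N j) = 0.
  move=> jN; move/rowP : v0 => /(_ (Ordinal jN)); rewrite !mxE => E.
  by rewrite -[RHS]E; apply: eq_bigr => i _; rewrite [node_mx _ _]mxE.
have := picone (mdsum_D1 c) cz; rewrite mdsum_robinq mdsum_ip mulr_sumr.
rewrite -subr_ge0 -sumrB => H.
have T i : 0 <= c i ^+ 2 * (om N ^+ 2 - om i ^+ 2) * ip1 (md i) (md i).
  apply: mulr_ge0 (ip_ge0 _ _ _); apply: mulr_ge0; first exact: sqr_ge0.
  exact/ltW/om_lt_sqr.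
have S0 : \sum_(i < N) c i ^+ 2 * (om N ^+ 2 - om i ^+ 2) * ip1 (md i) (md i) = 0.
  apply/eqP; rewrite eq_le sumr_ge0 ?andbT; last by move=> i _; exact: T.
  rewrite -oppr_ge0; apply: le_trans H _; rewrite -sumrN le_eqVlt; apply/orP; left.
  by apply/eqP/eq_bigr => i _; ring.
apply/rowP => i; rewrite [RHS]mxE -/(c i).
move/eqP : S0; rewrite psumr_eq0; last by move=> k _; exact: T.
move=> /allP/(_ i)/(_ (mem_index_enum i))/=.
rewrite mulf_eq0 (gt_eqF (md_ip_gt0 i)) orbF mulf_eq0 (gt_eqF (om_lt_sqr i)) orbF.
by rewrite sqrf_eq0 => /eqP.
Qed.

(** Let g be the combination of the first [N] modes that agrees with [f] at the zeros of [md N]; it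
    exists by [node_mx_unit]. Apply [picone] to f - g: the cross terms vanish by orthogonality, and
    the form at g is at most om N ^ 2 times its squared norm. *)
Lemma poincare f f' : D1 f f' -> (forall i : 'I_N, ip1 f (md i) = 0) ->
  om N ^+ 2 * ip1 f f <= robinq f f' f f'.
Proof.
move=> Df f0.
pose v := \row_j f (node N j) *m invmx node_mx.
pose c i := v 0 i.
have Dc := mdsum_D1 c.
have Lf := D1_L2 Df; have Lc := D1_L2 Dc.
have vE : v *m node_mx = \row_j f (node N j) by rewrite /v mulmxKV// node_mx_unit.
have cz j : (j < N)%N -> f (node N j) - mdsum c (node N j) = 0.
  move=> jN; move/rowP : vE => /(_ (Ordinal jN)); rewrite [LHS]mxE [RHS]mxE /= => <-.
  by apply/eqP; rewrite subr_eq0; apply/eqP/eq_bigr => i _; rewrite [node_mx _ _]mxE.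
have := picone (D1B Df Dc) cz.
have z1 : ip1 f (mdsum c) = 0.
  by rewrite ip_mdsum// big1// => i _; rewrite f0 mulr0.
have z2 : robinq f f' (mdsum c) (mdsum' c) = 0.
  by rewrite robinq_mdsum// big1// => i _; rewrite f0 !mulr0.
rewrite robinqB// z2 mulr0 subr0 ipBl//; last exact: L2B.
rewrite !ipBr// (ipC (leb1 R) _ (mdsum c) f) z1 mdsum_robinq mdsum_ip.
suff : \sum_(i < N) c i ^+ 2 * om i ^+ 2 * ip1 (md i) (md i) <=
    om N ^+ 2 * \sum_(i < N) c i ^+ 2 * ip1 (md i) (md i) by lra.
rewrite mulr_sumr; apply: ler_sum => i _.
rewrite mulrA ler_wpM2r ?ip_ge0// mulrC ler_wpM2r ?sqr_ge0//.
by rewrite -subr_ge0 ltW// om_lt_sqr.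
Qed.

End approximation.

(** The remainder of the orthogonal projection satisfies [poincare], while its form is at most the
    form of [f], which does not depend on [N]. *)
Lemma md_approx f f' (eps : R) : D1 f f' -> 0 < eps ->
  exists N (c : 'I_N -> R),
    ip1 (fun x => f x - mdsum c x) (fun x => f x - mdsum c x) < eps.
Proof.
move=> Df e0.
pose C := robinq f f' f f'.
have C0 : 0 <= C.
  by rewrite /C /robinq -!mulrA -!expr2 !addr_ge0 ?ip_ge0// mulr_ge0 ?sqr_ge0 ?ltW.
(* This makes om N exceed (C + 1) / eps + 1; the summand [L] accounts for the 1, which lets om N ^ 2
   dominate (C + 1) / eps. *)
pose N := Num.bound ((C + 1) * L / eps + L).
exists N; pose c (i : 'I_N) := ip1 f (md i) / ip1 (md i) (md i); exists c.
have Dc := mdsum_D1 c; have Dr := D1B Df Dc.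
have Lf := D1_L2 Df; have Lc := D1_L2 Dc.
have r0 (i : 'I_N) : ip1 (fun x => f x - mdsum c x) (md i) = 0.
  by rewrite ipBl// mdsum_md /c mulfVK ?subrr// gt_eqF ?md_ip_gt0.
have := poincare Dr r0.
rewrite robinqB// mdsum_robinq robinq_mdsum//.
rewrite (eq_bigr (fun i : 'I_N => c i ^+ 2 * om i ^+ 2 * ip1 (md i) (md i))); last first.
  move=> i _; rewrite /c; field; rewrite gt_eqF ?md_ip_gt0//.
set S := \sum_(i < N) _ => H.
have S0 : 0 <= S.
  by apply: sumr_ge0 => i _; apply: mulr_ge0; [apply: mulr_ge0; exact: sqr_ge0|exact: ip_ge0].
have {}H : om N ^+ 2 * ip1 (fun x => f x - mdsum c x) (fun x => f x - mdsum c x) <= C.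
  by rewrite /C; lra.
have oN : (C + 1) / eps + 1 < om N.
  apply: lt_trans (om_gt L0 s0 N).
  rewrite ltr_pdivlMr// mulrDl mul1r mulrAC.
  have b : (C + 1) * L / eps + L < N%:R.
    apply: archi_boundP; rewrite addr_ge0 ?(ltW L0)// divr_ge0 ?(ltW e0)//.
    by rewrite mulr_ge0 ?(ltW L0)// addr_ge0.
  rewrite (lt_le_trans b)// ler_peMr// (le_trans _ (pi_ge2 R))//.
  by rewrite ler1n.
have a0 : 0 < (C + 1) / eps by rewrite divr_gt0// ltr_wpDl.
have a1 : (C + 1) / eps < om N ^+ 2 by nra.
rewrite -(ltr_pM2l (lt_trans a0 a1)) (le_lt_trans H)//.
by move: a1; rewrite ltr_pdivrMr//; lra.
Qed.

End completeness.

(** * Integration on the rectangle *)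

Section plane.
Variable R : realType.
Notation T2 := (measurableTypeR R * measurableTypeR R)%type.
Implicit Types (F G : R * R -> R).

(** Countably many boxes with rational corners suffice to fill an open set. *)
Lemma open_measurable2 (O : set (R * R)) : open O -> measurable (O : set T2).
Proof.
move=> oO.
pose B (t : (rat * rat) * (rat * rat)) : set T2 :=
  `]ratr t.1.1, ratr t.1.2[%classic `*` `]ratr t.2.1, ratr t.2.2[%classic.
rewrite (_ : O = \bigcup_t (B t `&` [set z | B t `<=` O])).
  apply: countable_bigcupT_measurable => [|t]; first exact: countableP.
  have [h|h] := pselect (B t `<=` O).
    rewrite (_ : _ `&` _ = B t); last by apply/seteqP; split => [z []|z Bz].
    by apply: measurableX; exact: measurable_itv.
  by rewrite (_ : _ `&` _ = set0)//; apply/seteqP; split => [z []|z Bz].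
apply/seteqP; split => [[x y] Oz|z [t _ [Bt BO]]]; last exact: BO.
have := open_nbhs_nbhs (conj oO Oz) => -[[A1 A2] /= [nA1 nA2] AO].
have itv (A : set R) (w : R) : nbhs w A ->
    exists p q : rat, `](ratr p), (ratr q)[%classic w /\ `](ratr p), (ratr q)[ `<=` A.
  move=> [e /= e0 eA].
  have [p] : exists p : rat, ratr p \in `](w - e), w[.
    by apply: rat_in_itvoo; rewrite ltrBlDr ltrDl.
  have [q] : exists q : rat, ratr q \in `]w, (w + e)[.
    by apply: rat_in_itvoo; rewrite ltrDl.
  rewrite !in_itv/= => /andP[wq qe] /andP[ep pw].
  exists p, q; split; first by rewrite in_itv/= pw wq.
  move=> v /=; rewrite in_itv/= => /andP[pv vq]; apply: eA; rewrite /ball/=.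
  by rewrite ltr_norml; apply/andP; split; lra.
have [p1 [q1 [x1 s1]]] := itv _ _ nA1; have [p2 [q2 [x2 s2]]] := itv _ _ nA2.
exists ((p1, q1), (p2, q2)) => //; split; first by split.
by move=> [u v] [/= hu hv]; apply: AO; split; [exact: s1|exact: s2].
Qed.

Lemma continuous_measurable2 F : continuous F -> measurable_fun (setT : set T2) F.
Proof.
move=> /continuousP cF; apply: (measurability _ (RGenOpens.measurableE R)).
move=> _ [_ [a [b ->] <-]]; rewrite setTI; apply: open_measurable2.
exact/cF/interval_open.
Qed.

Section box.
Variables (a b : R).
Hypotheses (a0 : 0 < a) (b0 : 0 < b).
Notation mu := (leb2 R).
Notation D := (rect a b : set T2).

Lemma mrect : measurable D.
Proof. by apply: measurableX; exact: measurable_itv. Qed.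

Lemma leb1_itv0 (c : R) : 0 < c -> leb1 R `]0, c[%classic = c%:E.
Proof.
move=> c0; have := @lebesgue_measure_itv R `]0, c[; rewrite /leb1 => /= ->.
by rewrite lte_fin c0 -EFinB subr0.
Qed.

Lemma leb2_rect : mu D = (a * b)%:E.
Proof.
have := @product_measure1E _ _ (measurableTypeR R) (measurableTypeR R) R
  (@lebesgue_measure R) (@lebesgue_measure R) `]0, a[%classic `]0, b[%classic.
move=> E; transitivity (leb1 R `]0%R, a[%classic * leb1 R `]0%R, b[%classic)%E.
  by apply: E; exact: measurable_itv.
by rewrite !leb1_itv0.
Qed.

Lemma continuous_bounded2 F : continuous F -> exists M : R, forall z, D z -> `|F z| <= M.
Proof.
move=> cF.
have cw : {within `[0, a]%classic `*` `[0, b]%classic, continuous F}.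
  exact: continuous_subspaceT.
have c := continuous_compact cw (compact_setX (@segment_compact R 0 a) (@segment_compact R 0 b)).
have := compact_bounded c; rewrite /bounded_near => -[M [_ HM]].
exists (M + 1) => z [z1 z2].
apply: (HM (M + 1)); first by rewrite ltrDl.
by exists z => //; split; exact: subset_itv_oo_cc.
Qed.

Lemma continuous_L2_2 F : continuous F -> L2 mu D F.
Proof.
move=> cF; have [M HM] := continuous_bounded2 cF.
apply: (@L2_bounded _ _ _ _ _ mrect _ M) => //.
  by have := leb2_rect => /= ->; rewrite ltry.
by apply: measurable_funTS; exact: continuous_measurable2.
Qed.

Lemma continuous_integrable2 F : continuous F -> mu.-integrable D (EFin \o F).
Proof.
move=> cF; have L1 : L2 mu D (fun=> 1) by apply: continuous_L2_2 => x; exact: cvg_cst.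
have := L2_mul_integrable mrect (continuous_L2_2 cF) L1.
by apply: eq_integrable => //; [exact: mrect|move=> x _ /=; rewrite mulr1].
Qed.

Lemma continuous_integrable1 (c d : R) (f : R -> R) : continuous f ->
  (leb1 R).-integrable `]c, d[%classic (EFin \o f).
Proof.
move=> cf; have L1 : L2 (leb1 R) `]c, d[%classic (fun=> 1).
  by apply: continuous_L2 => x; exact: cvg_cst.
have := L2_mul_integrable _ (continuous_L2 c d cf) L1.
move=> /(_ (measurable_itv _)); apply: eq_integrable; first exact: measurable_itv.
by move=> x _ /=; rewrite mulr1.
Qed.

Lemma continuous_slice1 F y : continuous F -> continuous (fun x => F (x, y)).
Proof.
move=> cF x; apply: (@continuous_comp _ _ _ (fun x => (x, y)) F); last exact: cF.
exact: (cvg_pair (G := nbhs x) (H := nbhs y) cvg_id (cvg_cst y)).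
Qed.

Lemma continuous_slice2 F x : continuous F -> continuous (fun y => F (x, y)).
Proof.
move=> cF y; apply: (@continuous_comp _ _ _ (fun y => (x, y)) F); last exact: cF.
exact: (cvg_pair (G := nbhs x) (H := nbhs y) (cvg_cst x) cvg_id).
Qed.

Lemma restrict_rect F x y : ((EFin \o F) \_ D) (x, y) =
  if y \in `]0, b[ then ((EFin \o (fun x => F (x, y))) \_ `]0, a[) x else 0%E.
Proof.
rewrite /= !patchE /rect in_setX/=.
have -> : (x \in `]0, a[%classic) = (x \in `]0, a[) by rewrite mem_setE.
have -> : (y \in `]0, b[%classic) = (y \in `]0, b[) by rewrite mem_setE.
by case: (y \in _); case: (x \in _); rewrite ?andbF.
Qed.

Lemma fubini_yx F : continuous F -> \int[mu]_(z in D) F z =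
  \int[leb1 R]_(y in `]0, b[) \int[leb1 R]_(x in `]0, a[) F (x, y).
Proof.
move=> cF.
have iF := continuous_integrable2 cF.
rewrite /Rintegral; congr fine.
rewrite integral_mkcond.
have iF' : mu.-integrable setT ((EFin \o F) \_ D).
  by apply/(integrable_mkcond _ mrect).
rewrite [LHS](_ : _ = \int[mu]_z ((EFin \o F) \_ D) z)%E //.
rewrite /leb2 -integral21_prod_meas1//.
rewrite [RHS]integral_mkcond; apply: eq_integral => y _.
rewrite /fubini_G patchE mem_setE.
transitivity (\int[leb1 R]_x (if y \in `]0%R, b[%R then
    ((EFin \o (fun x => F (x, y))) \_ `]0%R, a[%classic) x else 0))%E.
  by apply: eq_integral => x _; exact: restrict_rect.
case: ifPn => yb; last by rewrite integral0.
rewrite -integral_mkcond fineK//.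
apply: integrable_fin_num => //; apply: continuous_integrable1.
exact: continuous_slice1.
Qed.

Lemma fubini_xy F : continuous F -> \int[mu]_(z in D) F z =
  \int[leb1 R]_(x in `]0, a[) \int[leb1 R]_(y in `]0, b[) F (x, y).
Proof.
move=> cF.
have iF := continuous_integrable2 cF.
rewrite /Rintegral; congr fine.
rewrite integral_mkcond.
have iF' : mu.-integrable setT ((EFin \o F) \_ D).
  by apply/(integrable_mkcond _ mrect).
rewrite [LHS](_ : _ = \int[mu]_z ((EFin \o F) \_ D) z)%E //.
rewrite /leb2 -integral12_prod_meas1//.
rewrite [RHS]integral_mkcond; apply: eq_integral => x _.
rewrite /fubini_F patchE mem_setE.
transitivity (\int[leb1 R]_y (if x \in `]0%R, a[%R then
    ((EFin \o (fun y => F (x, y))) \_ `]0%R, b[%classic) y else 0))%E.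
  apply: eq_integral => y _; apply: etrans (restrict_rect F x y) _.
  by rewrite !patchE !mem_setE; case: ifP; case: ifP.
case: ifPn => yb; last by rewrite integral0.
rewrite -integral_mkcond fineK//.
apply: integrable_fin_num => //; apply: continuous_integrable1.
exact: continuous_slice2.
Qed.

Definition DX F F1 := (forall y, D1 (fun x => F (x, y)) (fun x => F1 (x, y))) /\
  continuous F1.
Definition DY F F2 := (forall x, D1 (fun y => F (x, y)) (fun y => F2 (x, y))) /\
  continuous F2.

Lemma int_DX F F1 : DX F F1 ->
  \int[mu]_(z in D) F1 z = \int[leb1 R]_(y in `]0, b[) (F (a, y) - F (0, y)).
Proof.
move=> [dF cF]; rewrite fubini_yx//; apply: eq_Rintegral => y _.
exact: (FTC a0 (dF y)).
Qed.

Lemma int_DY F F2 : DY F F2 ->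
  \int[mu]_(z in D) F2 z = \int[leb1 R]_(x in `]0, a[) (F (x, b) - F (x, 0)).
Proof.
move=> [dF cF]; rewrite fubini_xy//; apply: eq_Rintegral => x _.
exact: (FTC b0 (dF x)).
Qed.

Lemma continuous_tensor (g h : R -> R) : continuous g -> continuous h ->
  continuous (fun z : R * R => g z.1 * h z.2).
Proof.
move=> cg ch z; apply: cvgM.
  by apply: (@continuous_comp _ _ _ fst g); [exact: cvg_fst|exact: cg].
by apply: (@continuous_comp _ _ _ snd h); [exact: cvg_snd|exact: ch].
Qed.

Lemma ip_tensor (g h g' h' : R -> R) :
  continuous g -> continuous h -> continuous g' -> continuous h' ->
  ip mu D (fun z => g z.1 * h z.2) (fun z => g' z.1 * h' z.2) =
  ip (leb1 R) `]0, a[%classic g g' * ip (leb1 R) `]0, b[%classic h h'.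
Proof.
move=> cg ch cg' ch'; rewrite /ip.
have cgg : continuous (fun x => g x * g' x) by move=> x; apply: cvgM; [exact: cg|exact: cg'].
have chh : continuous (fun x => h x * h' x) by move=> x; apply: cvgM; [exact: ch|exact: ch'].
transitivity (\int[mu]_(z in D) ((g z.1 * g' z.1) * (h z.2 * h' z.2))).
  by apply: eq_Rintegral => z _; ring.
rewrite fubini_xy; last exact: (continuous_tensor cgg chh).
transitivity (\int[leb1 R]_(x in `]0, a[) ((g x * g' x) *
   \int[leb1 R]_(y in `]0, b[) (h y * h' y))).
  apply: eq_Rintegral => x _; rewrite /= RintegralZl//.
  exact: continuous_integrable1.
rewrite RintegralZr//; exact: continuous_integrable1.
Qed.

End box.
End plane.

(** * Completeness of the products of modes *)

Section vanishing_integrals.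
Context d (T : measurableType d) (R : realType).
Variables (mu : {measure set T -> \bar R}) (D : set T) (U : T -> R).
Hypotheses (mD : measurable D) (iU : mu.-integrable D (EFin \o U)).

Let I (S : set T) : \bar R := (\int[mu]_(z in D `&` S) (U z)%:E)%E.

(** The sets [A] with this property form a Dynkin system, complements being handled by [I X = 0].
    The set [X] freezes a constraint on the other coordinate, so that generators can be replaced by
    Borel sets one coordinate at a time. *)
Lemma dynkin_integral_eq0 d3 (T3 : measurableType d3) (h : T -> T3) (X : set T)
    (G : set (set T3)) :
  measurable_fun setT h -> measurable X ->
  @measurable _ T3 = <<s G >> -> setI_closed G ->
  (forall A, G A -> I (X `&` h @^-1` A) = 0%E) -> I X = 0%E ->
  forall A, measurable A -> I (X `&` h @^-1` A) = 0%E.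
Proof.
move=> mh mX mG GI G0 IX A mA.
have mhA B : measurable B -> measurable (h @^-1` B).
  by move=> mB; rewrite -[_ @^-1` _]setTI; exact: mh.
have mDX B : measurable B -> measurable (D `&` (X `&` h @^-1` B)).
  by move=> mB; apply: measurableI => //; apply: measurableI => //; exact: mhA.
have iS S : measurable S -> mu.-integrable (D `&` S) (EFin \o U).
  by move=> mS; apply: integrableS iU => //; exact: measurableI.
apply: (@dynkin_induction _ T3 G (fun A => I (X `&` h @^-1` A) = 0%E) mG GI) => //.
- by rewrite preimage_setT setIT.
- move=> S mS IS.
  have E : D `&` X = (D `&` (X `&` h @^-1` S)) `|` (D `&` (X `&` h @^-1` (~` S))).
    by rewrite -!setIUr preimage_setC setUv setIT.
  have := IX; rewrite /I E integral_setU//.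
  + by rewrite -/(I _) IS add0e.
  + exact: mDX.
  + by apply: mDX; exact: measurableC.
  + by rewrite -E; case/integrableP: (iS X mX).
  + apply/disj_set2P; rewrite preimage_setC.
    by apply/seteqP; split => // z [[_ [_ zS]] [_ [_ zNS]]].
- move=> F mF tF IF.
  rewrite /I preimage_bigcup setI_bigcupr setI_bigcupr integral_bigcup//.
  + by apply: eseries0 => i _ _; exact: IF.
  + apply/trivIset_setIl/trivIset_setIl/trivIsetP => i j _ _ ij.
    by rewrite -preimage_setI (proj1 trivIsetP tF)// preimage_set0.
  + by move=> k; exact: mDX.
  + rewrite -setI_bigcupr -setI_bigcupr; apply: iS; apply: measurableI => //.
    by apply: bigcup_measurable => k _; exact: mhA.
- by rewrite -mG.
Qed.

End vanishing_integrals.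

(** * C^1 approximations of the indicator of a half-line *)

Section smooth_steps.
Variable R : realType.

Lemma D1_expR (f f' : R -> R) : D1 f f' ->
  D1 (fun x => expR (f x)) (fun x => f' x * expR (f x)).
Proof.
move=> Df.
have H x : is_derive x (1:R) (fun x => expR (f x)) (f' x * expR (f x)).
  have d1 := Df.1 x.
  by apply: is_derive_eq; rewrite /GRing.scale/= mulrC.
split => // x; apply: cvgM; first exact: Df.2.
exact: (is_derive_cont H).
Qed.

Lemma D1_lin (c e : R) : D1 (fun x => c * x + e) (fun=> c).
Proof.
split; last by move=> x; exact: cvg_cst.
by move=> x; apply: is_derive_eq; rewrite /GRing.scale/=; ring.
Qed.

(* At x = c the inner exponent is j: the limit is the indicator of ]-oo, c[ at
   every point. *)
Definition step (c : R) (j : nat) (x : R) : R :=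
  expR (- expR (j%:R ^+ 2 * x + (j%:R - j%:R ^+ 2 * c))).

Lemma step_D1 c j : exists g', D1 (step c j) g'.
Proof.
by eexists; apply: D1_expR; apply: D1N; apply: D1_expR; exact: D1_lin.
Qed.

Lemma step_ge0 c j x : 0 <= step c j x.
Proof. exact: expR_ge0. Qed.

Lemma step_le1 c j x : step c j x <= 1.
Proof. by rewrite /step -[leRHS]expR0 ler_expR oppr_le0 expR_ge0. Qed.

Lemma expR_cvg0 (u : nat -> R) (N : nat) : (forall j, (N <= j)%N -> u j <= - j%:R) ->
  (fun j => expR (u j)) @ \oo --> (0 : R).
Proof.
move=> uN; have h := @cvgn_expR R.
apply: (@squeeze_cvgr _ _ _ _ (fun=> 0) (fun n => expR (1 *- n))) => //.
  by exists N => // n /= Nn; rewrite expR_ge0 ler_expR uN.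
exact: cvg_cst.
Qed.

Lemma step_cvg c x : (fun j => step c j x) @ \oo --> (\1_(`]-oo, c[%classic) x : R).
Proof.
rewrite indicE mem_setE in_itv/=.
case: ltP => xc /=; last first.
  apply: (@expR_cvg0 _ 0) => j _; rewrite lerN2.
  apply: le_trans (expR_ge1Dx _); rewrite -lerBlDl.
  have : 0 <= j%:R ^+ 2 * (x - c) by rewrite mulr_ge0 ?sqr_ge0 ?subr_ge0.
  lra.
rewrite mulr1n -expR0 -[in X in expR X]oppr0.
have cE : continuous (fun y : R => expR (- y)).
  move=> y; apply: (@continuous_comp _ _ _ -%R expR); first exact: oppr_continuous.
  exact: continuous_expR.
apply: (continuous_cvg _ (cE 0)).
(* For j >= N, j (c - x) exceeds 2, hence the inner exponent j^2 (x - c) + j is at most -j. *)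
pose N := Num.bound (2 / (c - x)).
have cx : 0 < c - x by rewrite subr_gt0.
have Nd : 2 / (c - x) < N%:R by apply: archi_boundP; rewrite divr_ge0 ?ltW.
apply: (@expR_cvg0 _ N) => j Nj.
have : 2 < j%:R * (c - x).
  rewrite -ltr_pdivrMr// (lt_le_trans Nd)// ler_nat//.
have : 0 <= j%:R :> R by [].
set J : R := j%:R; nra.
Qed.

End smooth_steps.

Section plane_completeness.
Variables (R : realType) (a b s : R).
Hypotheses (a0 : 0 < a) (b0 : 0 < b) (s0 : 0 < s).
Notation mu := (leb2 R).
Notation T2 := (measurableTypeR R * measurableTypeR R)%type.
Notation D := (rect a b : set T2).
Notation ip2 := (ip mu D).
Variable U : R * R -> R.
Hypothesis LU : L2 mu D U.
Hypothesis U0 : forall n m, ip2 U (fun z => md a s n z.1 * md b s m z.2) = 0.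

Let mD : measurable D. Proof. exact: mrect. Qed.

Lemma L2_tensor (g h : R -> R) : continuous g -> continuous h ->
  L2 mu D (fun z => g z.1 * h z.2).
Proof. by move=> cg ch; apply: continuous_L2_2 => //; exact: continuous_tensor. Qed.

Lemma md_cont (L : R) n : continuous (md L s n).
Proof. exact: D1_cont (md_D1 _ _ _). Qed.

Lemma mdsum_cont (L : R) N (c : 'I_N -> R) : continuous (mdsum L s c).
Proof. exact: D1_cont (mdsum_D1 _ _ _). Qed.

Lemma ip_small_eq0 (A B C : R) : 0 <= A -> 0 <= B ->
  (forall e, 0 < e -> C ^+ 2 <= A * (e * B)) -> C = 0.
Proof.
move=> A0 B0 H; apply/eqP; rewrite -sqrf_eq0 eq_le sqr_ge0 andbT.
apply/ler_addgt0Pr => e e0; rewrite add0r.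
have e1 : 0 < e / (A * B + 1) by rewrite divr_gt0// ltr_wpDl// mulr_ge0.
apply: le_trans (H _ e1) _.
have AB : 0 <= A * B by rewrite mulr_ge0.
rewrite (_ : A * _ = e * (A * B) / (A * B + 1)); last by field; rewrite gt_eqF// ltr_wpDl.
rewrite ler_pdivrMr ?ltr_wpDl//; nra.
Qed.

(** Subtracting from [g] a combination of modes leaves the product with [U] unchanged and makes the
    norm of the other factor as small as desired. *)
Lemma ip2_mdr g g' m : D1 g g' -> ip2 U (fun z => g z.1 * md b s m z.2) = 0.
Proof.
move=> Dg; have cg := D1_cont Dg.
apply: (ip_small_eq0 (ip_ge0 mu D U) (ip_ge0 (leb1 R) `]0, b[%classic (md b s m))) => e e0.
have [N [c Hc]] := md_approx a0 s0 Dg e0.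
have cS : continuous (mdsum a s c) by exact: mdsum_cont.
have cm : continuous (md b s m) by exact: md_cont.
have cgS : continuous (fun x => g x - mdsum a s c x).
  by move=> x; apply: cvgB; [exact: cg|exact: cS].
have S0 : ip2 U (fun z => mdsum a s c z.1 * md b s m z.2) = 0.
  have -> : (fun z : T2 => mdsum a s c z.1 * md b s m z.2) =
      (fun z => \sum_(i < N) (c i * (md a s i z.1 * md b s m z.2))).
    by apply/funext => z; rewrite /mdsum mulr_suml; apply: eq_bigr => i _; rewrite mulrA.
  rewrite ipC ip_suml//; last by move=> i; apply: L2Z => //; apply: L2_tensor; exact: md_cont.
  rewrite big1// => i _; rewrite ipZl//; last by apply: L2_tensor; exact: md_cont.
  by rewrite ipC U0 mulr0.
rewrite (_ : ip2 U _ = ip2 U (fun z => (g z.1 - mdsum a s c z.1) * md b s m z.2)); last first.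
  have -> : (fun z : T2 => (g z.1 - mdsum a s c z.1) * md b s m z.2) =
      (fun z => g z.1 * md b s m z.2 - mdsum a s c z.1 * md b s m z.2).
    by apply/funext => z; rewrite mulrBl.
  by rewrite ipBr ?S0 ?subr0//; apply: L2_tensor.
apply: le_trans (cauchy_schwarz mD LU (L2_tensor cgS cm)) _.
rewrite (ip_tensor a0 b0 cgS cm cgS cm) ler_wpM2l ?ip_ge0// ler_wpM2r ?ip_ge0//.
exact: ltW.
Qed.

Lemma ip2_tensor_eq0 g g' h h' : D1 g g' -> D1 h h' ->
  ip2 U (fun z => g z.1 * h z.2) = 0.
Proof.
move=> Dg Dh; have cg := D1_cont Dg; have ch := D1_cont Dh.
apply: (ip_small_eq0 (ip_ge0 mu D U) (ip_ge0 (leb1 R) `]0, a[%classic g)) => e e0.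
have [N [c Hc]] := md_approx b0 s0 Dh e0.
have cS : continuous (mdsum b s c) by exact: mdsum_cont.
have chS : continuous (fun x => h x - mdsum b s c x).
  by move=> x; apply: cvgB; [exact: ch|exact: cS].
have S0 : ip2 U (fun z => g z.1 * mdsum b s c z.2) = 0.
  have -> : (fun z : T2 => g z.1 * mdsum b s c z.2) =
      (fun z => \sum_(i < N) (c i * (g z.1 * md b s i z.2))).
    by apply/funext => z; rewrite /mdsum mulr_sumr; apply: eq_bigr => i _; rewrite mulrCA.
  rewrite ipC ip_suml//; last first.
    by move=> i; apply: L2Z => //; apply: L2_tensor => //; exact: md_cont.
  rewrite big1// => i _; rewrite ipZl//; last by apply: L2_tensor => //; exact: md_cont.
  by rewrite ipC (ip2_mdr _ Dg) mulr0.
rewrite (_ : ip2 U _ = ip2 U (fun z => g z.1 * (h z.2 - mdsum b s c z.2))); last first.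
  have -> : (fun z : T2 => g z.1 * (h z.2 - mdsum b s c z.2)) =
      (fun z => g z.1 * h z.2 - g z.1 * mdsum b s c z.2).
    by apply/funext => z; rewrite mulrBr.
  by rewrite ipBr ?S0 ?subr0//; apply: L2_tensor.
apply: le_trans (cauchy_schwarz mD LU (L2_tensor cg chS)) _.
rewrite (ip_tensor a0 b0 cg chS cg chS) ler_wpM2l ?ip_ge0// mulrC ler_wpM2r ?ip_ge0//.
exact: ltW.
Qed.

Lemma L2_integrable : mu.-integrable D (EFin \o U).
Proof.
have L1 : L2 mu D (fun=> 1) by apply: continuous_L2_2 => // x; exact: cvg_cst.
have := L2_mul_integrable mD LU L1.
by apply: eq_integrable => // x _ /=; rewrite mulr1.
Qed.

(** The indicator of a quadrant is the everywhere limit of products of [step] functions with values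
    in [0, 1]; [|U|] dominates. *)
Lemma integral_corner_eq0 (c e : R) :
  (\int[mu]_(z in D `&` (`]-oo, c[ `*` `]-oo, e[)) (U z)%:E = 0)%E.
Proof.
pose f_ j (z : R * R) := U z * (step c j z.1 * step e j z.2).
pose f (z : R * R) := U z * (\1_(`]-oo, c[%classic) z.1 * \1_(`]-oo, e[%classic) z.2).
have cst j (t : R) : continuous (step t j).
  by have [g' Dg] := @step_D1 R t j; exact: D1_cont Dg.
have f0 j : (\int[mu]_(z in D) (f_ j z)%:E = 0)%E.
  have [g1 D1] := @step_D1 R c j; have [g2 D2] := @step_D1 R e j.
  have := ip2_tensor_eq0 D1 D2; rewrite /ip /Rintegral => H.
  rewrite -[LHS]fineK; first by rewrite [X in X%:E]H.
  apply: integrable_fin_num => //; apply: L2_mul_integrable => //.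
  exact: L2_tensor.
have iU := L2_integrable.
have [||||| _ _] := @dominated_convergence _ T2 R mu D mD (fun j z => (f_ j z)%:E)
   (fun z => (f z)%:E) (fun z => `|U z|%:E).
- move=> j; apply/measurable_EFinP; apply: measurable_funM; first exact: LU.1.
  by have := L2_tensor (cst j c) (cst j e); case.
- apply/measurable_EFinP; apply: measurable_funM; first exact: LU.1.
  apply: measurable_funTS; apply: measurable_funM.
    by apply: measurableT_comp measurable_fst; exact: measurable_indic.
  by apply: measurableT_comp measurable_snd; exact: measurable_indic.
- apply: aeW => z Dz; apply: cvg_EFin; first exact: nearW.
  by apply: cvgM; [exact: cvg_cst|apply: cvgM; exact: step_cvg].
- by have := integrable_norm iU.
- apply: aeW => z j Dz; rewrite lee_fin normrM ler_piMr//.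
  by rewrite ger0_norm ?mulr_ge0 ?step_ge0// mulr_ile1 ?step_ge0 ?step_le1.
move=> H.
have : (\int[mu]_(z in D) (f z)%:E = 0)%E.
  move: H; rewrite (_ : (fun n => _) = (fun=> 0%E)); last by apply/funext.
  by move=> /cvg_lim <-//; rewrite lim_cst.
move=> <-; rewrite integral_mkcondr; apply: eq_integral => -[x y] _.
rewrite /f patchE in_setX/= !indicE.
by case: (x \in _); case: (y \in _); rewrite /= ?(mulr0, mul0r, mulr1).
Qed.

(** Three Dynkin arguments extend the vanishing of the integral: from quadrants to Borel sets in the
    first coordinate, then in the second, then from measurable rectangles to all measurable sets. *)
Lemma L2_complete : ae_eq mu D (EFin \o U) (cst 0%E).
Proof.
have iU := L2_integrable.
have GI : setI_closed (@RGenInftyO.G R).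
  move=> _ _ [x ->] [y ->]; exists (Num.min x y).
  by apply/seteqP; split => z /=; rewrite !in_itv/= lt_min; [move=> [-> ->]|move/andP].
have mG : @measurable _ (measurableTypeR R) = <<s @RGenInftyO.G R >>.
  exact: RGenInftyO.measurableE.
have m1 (A : set (measurableTypeR R)) : measurable A -> measurable (fst @^-1` A : set T2).
  by move=> mA; rewrite -[_ @^-1` _]setTI; exact: measurable_fst.
have m2 (A : set (measurableTypeR R)) : measurable A -> measurable (snd @^-1` A : set T2).
  by move=> mA; rewrite -[_ @^-1` _]setTI; exact: measurable_snd.
have Da z : D z -> z.1 < a by move=> [/= + _]; rewrite in_itv/= => /andP[].
have Db z : D z -> z.2 < b by move=> [/= _ +]; rewrite in_itv/= => /andP[].
have stepA e (A : set (measurableTypeR R)) : measurable A ->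
    (\int[mu]_(z in D `&` (snd @^-1` `]-oo, (e : R)[ `&` fst @^-1` A)) (U z)%:E = 0)%E.
  apply: (dynkin_integral_eq0 mD iU measurable_fst _ mG GI).
  - exact: m2.
  - move=> _ [c ->]; rewrite -[RHS](integral_corner_eq0 c e); congr (integral _ _ _).
    by apply/seteqP; split => z [Dz [h1 h2]]; split.
  (* The whole line may be replaced by []-oo, a[], since first coordinates in [D] are less than
     [a]. *)
  - rewrite -[RHS](integral_corner_eq0 a e); congr (integral _ _ _).
    apply/seteqP; split => z [Dz h]; split => //; last by case: h.
    by split => //; rewrite /= in_itv/= Da.
have stepB (A B : set (measurableTypeR R)) : measurable A -> measurable B ->
    (\int[mu]_(z in D `&` (fst @^-1` A `&` snd @^-1` B)) (U z)%:E = 0)%E.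
  move=> mA; apply: (dynkin_integral_eq0 mD iU measurable_snd _ mG GI).
  - exact: m1.
  - move=> _ [c ->]; rewrite -[RHS](stepA c A mA); congr (integral _ _ _).
    by apply/seteqP; split => z [Dz [h1 h2]]; split.
  - rewrite -[RHS](stepA b A mA); congr (integral _ _ _).
    apply/seteqP; split => z [Dz h]; split => //; last by case: h.
    by split => //; rewrite /= in_itv/= Db.
have stepC (S : set T2) : measurable S ->
    (\int[mu]_(z in D `&` (setT `&` id @^-1` S)) (U z)%:E = 0)%E.
  apply: (dynkin_integral_eq0 mD iU (@measurable_id _ _ _) _
    (measurable_prod_measurableType _ _)) => //.
  - move=> _ _ [A1 mA1 [B1 mB1 <-]] [A2 mA2 [B2 mB2 <-]].
    exists (A1 `&` A2); first exact: measurableI.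
    by exists (B1 `&` B2); [exact: measurableI|rewrite setXI].
  - move=> _ [A mA [B mB <-]]; rewrite -[RHS](stepB A B mA mB).
    congr (integral _ _ _).
    by apply/seteqP; split => z [Dz]; [move=> [_ [h1 h2]]|move=> [h1 h2]]; split.
  - rewrite -[RHS](stepB setT setT measurableT measurableT); congr (integral _ _ _).
    by rewrite !preimage_setT setIT.
apply: integral_ae_eq => //.
move=> E ED mE; rewrite integral0 -[RHS](stepC E mE); congr (integral _ _ _).
by apply/seteqP; split => z; [move=> Ez; split => //; exact: ED|move=> [_ [_]]].
Qed.

End plane_completeness.

(** * The weak formulation *)

Section components.
Local Open Scope complex_scope.
Context d (T : measurableType d) (R : realType).
Variables (mu : {measure set T -> \bar R}) (D : set T).
Hypothesis mD : measurable D.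
Implicit Types (f : T -> R[i]).

Let ReF f : T -> R := fun z => complex.Re (f z).
Let ImF f : T -> R := fun z => complex.Im (f z).

Lemma measurable_sqmod f : cmeasurable D f -> measurable_fun D (fun z => (sqmod (f z))%:E).
Proof.
move=> [mr mi]; apply/measurable_EFinP.
by apply: measurable_funD; exact: measurable_funX.
Qed.

Lemma le_int_sqmod f (h : T -> R) : cmeasurable D f -> measurable_fun D h ->
  (forall z, h z ^+ 2 <= sqmod (f z)) ->
  (\int[mu]_(z in D) (h z ^+ 2)%:E <= norm2sq mu D f)%E.
Proof.
move=> mf mh hf; apply: ge0_le_integral => //.
- by move=> z _; rewrite lee_fin sqr_ge0.
- by apply/measurable_EFinP; exact: measurable_funX.
- exact: measurable_sqmod.
- by move=> z _; rewrite lee_fin hf.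
Qed.

Lemma inL2_Re f : inL2 mu D f -> L2 mu D (ReF f).
Proof.
move=> [mf lf]; split; first exact: mf.1.
apply: le_lt_trans lf; apply: le_int_sqmod => //; first exact: mf.1.
by move=> z; rewrite /sqmod lerDl sqr_ge0.
Qed.

Lemma inL2_Im f : inL2 mu D f -> L2 mu D (ImF f).
Proof.
move=> [mf lf]; split; first exact: mf.2.
apply: le_lt_trans lf; apply: le_int_sqmod => //; first exact: mf.2.
by move=> z; rewrite /sqmod lerDr sqr_ge0.
Qed.

Lemma L2_inL2 f : L2 mu D (ReF f) -> L2 mu D (ImF f) -> inL2 mu D f.
Proof.
move=> Lr Li; split; first by split; [exact: Lr.1|exact: Li.1].
rewrite /norm2sq /sqmod; under eq_integral do rewrite EFinD.
rewrite ge0_integralD//.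
- by rewrite lte_add_pinfty//; [exact: Lr.2|exact: Li.2].
- by move=> z _; rewrite lee_fin sqr_ge0.
- by apply/measurable_EFinP/measurable_funX; exact: Lr.1.
- by move=> z _; rewrite lee_fin sqr_ge0.
- by apply/measurable_EFinP/measurable_funX; exact: Li.1.
Qed.

Lemma norm2sqE f : L2 mu D (ReF f) -> L2 mu D (ImF f) ->
  norm2sq mu D f = (ip mu D (ReF f) (ReF f) + ip mu D (ImF f) (ImF f))%:E.
Proof.
move=> Lr Li; rewrite EFinD -!ip_sqr// /norm2sq /sqmod.
under eq_integral do rewrite EFinD.
rewrite ge0_integralD//.
- by move=> z _; rewrite lee_fin sqr_ge0.
- by apply/measurable_EFinP/measurable_funX; exact: Lr.1.
- by move=> z _; rewrite lee_fin sqr_ge0.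
- by apply/measurable_EFinP/measurable_funX; exact: Li.1.
Qed.

Lemma norm2sq_cvg0 (f_ : nat -> T -> R[i]) :
  (forall j, L2 mu D (ReF (f_ j))) -> (forall j, L2 mu D (ImF (f_ j))) ->
  norm2sq mu D (f_ j) @[j --> \oo] --> 0%E ->
  ip mu D (ReF (f_ j)) (ReF (f_ j)) @[j --> \oo] --> 0 /\
  ip mu D (ImF (f_ j)) (ImF (f_ j)) @[j --> \oo] --> 0.
Proof.
move=> Lr Li.
have -> : (fun j => norm2sq mu D (f_ j)) = (fun j =>
  (ip mu D (ReF (f_ j)) (ReF (f_ j)) + ip mu D (ImF (f_ j)) (ImF (f_ j)))%:E).
  by apply/funext => j; rewrite norm2sqE.
move=> /fine_cvgP[_ /= h].
split; apply: (@squeeze_cvgr _ _ _ _ (fun=> 0) (fun j =>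
  ip mu D (ReF (f_ j)) (ReF (f_ j)) + ip mu D (ImF (f_ j)) (ImF (f_ j)))) => //.
- by apply: nearW => j; rewrite ip_ge0 lerDl ip_ge0.
- exact: cvg_cst.
- by apply: nearW => j; rewrite ip_ge0 lerDr ip_ge0.
- exact: cvg_cst.
Qed.

Lemma ReB (x y : R[i]) : complex.Re (x - y) = complex.Re x - complex.Re y.
Proof. by case: x; case: y. Qed.

Lemma ImB (x y : R[i]) : complex.Im (x - y) = complex.Im x - complex.Im y.
Proof. by case: x; case: y. Qed.

Lemma L2_ReB f g : L2 mu D (ReF f) -> L2 mu D (ReF g) ->
  L2 mu D (fun z => complex.Re (f z - g z)).
Proof. by move=> Lf Lg; apply: L2_eq (L2B mD Lf Lg) => z _; rewrite ReB. Qed.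

Lemma L2_ImB f g : L2 mu D (ImF f) -> L2 mu D (ImF g) ->
  L2 mu D (fun z => complex.Im (f z - g z)).
Proof. by move=> Lf Lg; apply: L2_eq (L2B mD Lf Lg) => z _; rewrite ImB. Qed.

End components.

Section weak_form.
Local Open Scope complex_scope.
Variables (R : realType) (a b s : R).
Hypotheses (a0 : 0 < a) (b0 : 0 < b) (s0 : 0 < s).
Notation mu := (leb2 R).
Notation T2 := (measurableTypeR R * measurableTypeR R)%type.
Notation D := (rect a b : set T2).
Notation ip2 := (ip mu D).
Notation ipa := (ip (leb1 R) `]0, a[%classic).
Notation ipb := (ip (leb1 R) `]0, b[%classic).
Notation L2a := (L2 (leb1 R) `]0, a[%classic).
Notation L2b := (L2 (leb1 R) `]0, b[%classic).
Implicit Types (F V : R * R -> R).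

Let mD : measurable D. Proof. exact: mrect. Qed.

Lemma C1_DX F : C1 F -> DX F (pd1 F).
Proof.
move=> [d1 d2 cF c1 c2]; split => // y; split; last exact: continuous_slice1.
by move=> x; apply: DeriveDef; [exact: (d1 (x, y))|rewrite /pd1 derive1E].
Qed.

Lemma C1_DY F : C1 F -> DY F (pd2 F).
Proof.
move=> [d1 d2 cF c1 c2]; split => // x; split; last exact: continuous_slice2.
by move=> y; apply: DeriveDef; [exact: (d2 (x, y))|rewrite /pd2 derive1E].
Qed.

Lemma C1_cont F : C1 F -> continuous F.
Proof. by case. Qed.

Lemma DXY_C1 F F1 F2 : continuous F -> DX F F1 -> DY F F2 ->
  [/\ C1 F, pd1 F = F1 & pd2 F = F2].
Proof.
move=> cF [d1 c1] [d2 c2].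
have p1 : pd1 F = F1.
  apply/funext => -[x y]; rewrite /pd1/= derive1E.
  exact: (@derive_val _ _ _ _ _ _ _ ((d1 y).1 x)).
have p2 : pd2 F = F2.
  apply/funext => -[x y]; rewrite /pd2/= derive1E.
  exact: (@derive_val _ _ _ _ _ _ _ ((d2 x).1 y)).
split => //; split; rewrite ?p1 ?p2//.
- by move=> [x y]/=; exact: (@ex_derive _ _ _ _ _ _ _ ((d1 y).1 x)).
- by move=> [x y]/=; exact: (@ex_derive _ _ _ _ _ _ _ ((d2 x).1 y)).
Qed.

Definition tensor (g h : R -> R) (z : R * R) : R := g z.1 * h z.2.

Lemma tensor_cont g h : continuous g -> continuous h -> continuous (tensor g h).
Proof. exact: continuous_tensor. Qed.

Lemma tensor_DX g g' h : D1 g g' -> continuous h -> DX (tensor g h) (tensor g' h).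
Proof.
move=> Dg ch; split; last by apply: tensor_cont => //; exact: Dg.2.
move=> y; apply: D1_eq (D1Z (h y) Dg) => x; exact: mulrC.
Qed.

Lemma tensor_DY g h h' : continuous g -> D1 h h' -> DY (tensor g h) (tensor g h').
Proof.
move=> cg Dh; split; last by apply: tensor_cont => //; exact: Dh.2.
by move=> x; exact: (D1Z (g x) Dh).
Qed.

Lemma DXM F F1 V V1 : continuous F -> continuous V -> DX F F1 -> DX V V1 ->
  DX (fun z => F z * V z) (fun z => F1 z * V z + F z * V1 z).
Proof.
move=> cF cV DF DV; split; first by move=> y; exact: D1M (DF.1 y) (DV.1 y).
move=> z; apply: cvgD; apply: cvgM; [exact: DF.2|exact: cV|exact: cF|exact: DV.2].
Qed.

Lemma DYM F F1 V V1 : continuous F -> continuous V -> DY F F1 -> DY V V1 ->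
  DY (fun z => F z * V z) (fun z => F1 z * V z + F z * V1 z).
Proof.
move=> cF cV DF DV; split; first by move=> y; exact: D1M (DF.1 y) (DV.1 y).
move=> z; apply: cvgD; apply: cvgM; [exact: DF.2|exact: cV|exact: cF|exact: DV.2].
Qed.

Lemma ibpX F F1 V V1 : continuous F -> continuous V -> DX F F1 -> DX V V1 ->
  ip2 F1 V + ip2 F V1 =
  ipb (fun y => F (a, y)) (fun y => V (a, y)) - ipb (fun y => F (0, y)) (fun y => V (0, y)).
Proof.
move=> cF cV DF DV.
have LF := continuous_L2_2 a0 b0 cF; have LV := continuous_L2_2 a0 b0 cV.
have LF1 := continuous_L2_2 a0 b0 DF.2; have LV1 := continuous_L2_2 a0 b0 DV.2.
rewrite /ip -RintegralD//; try exact: L2_mul_integrable.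
rewrite (int_DX a0 b0 (DXM cF cV DF DV)) RintegralB//.
- by apply: L2_mul_integrable => //; apply: continuous_L2; exact: continuous_slice2.
- by apply: L2_mul_integrable => //; apply: continuous_L2; exact: continuous_slice2.
Qed.

Lemma ibpY F F1 V V1 : continuous F -> continuous V -> DY F F1 -> DY V V1 ->
  ip2 F1 V + ip2 F V1 =
  ipa (fun x => F (x, b)) (fun x => V (x, b)) - ipa (fun x => F (x, 0)) (fun x => V (x, 0)).
Proof.
move=> cF cV DF DV.
have LF := continuous_L2_2 a0 b0 cF; have LV := continuous_L2_2 a0 b0 cV.
have LF1 := continuous_L2_2 a0 b0 DF.2; have LV1 := continuous_L2_2 a0 b0 DV.2.
rewrite /ip -RintegralD//; try exact: L2_mul_integrable.
rewrite (int_DY a0 b0 (DYM cF cV DF DV)) RintegralB//.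
- by apply: L2_mul_integrable => //; apply: continuous_L2; exact: continuous_slice1.
- by apply: L2_mul_integrable => //; apply: continuous_L2; exact: continuous_slice1.
Qed.

Definition bdip F V : R :=
  ipa (fun x => F (x, 0)) (fun x => V (x, 0)) +
  ipa (fun x => F (x, b)) (fun x => V (x, b)) +
  ipb (fun y => F (0, y)) (fun y => V (0, y)) +
  ipb (fun y => F (a, y)) (fun y => V (a, y)).

Definition mode n m := tensor (md a s n) (md b s m).
Definition mode1 n m := tensor (md' a s n) (md b s m).
Definition mode2 n m := tensor (md a s n) (md' b s m).
Definition lam n m := om a s n ^+ 2 + om b s m ^+ 2.

Lemma mode_cont n m : continuous (mode n m).
Proof. by apply: tensor_cont; exact: md_cont. Qed.
Lemma mode1_cont n m : continuous (mode1 n m).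
Proof. by apply: tensor_cont; [exact: (md_D1 _ _ _).2|exact: md_cont]. Qed.
Lemma mode2_cont n m : continuous (mode2 n m).
Proof. by apply: tensor_cont; [exact: md_cont|exact: (md_D1 _ _ _).2]. Qed.
Lemma mode_DX n m : DX (mode n m) (mode1 n m).
Proof. by apply: tensor_DX; [exact: md_D1|exact: md_cont]. Qed.
Lemma mode_DY n m : DY (mode n m) (mode2 n m).
Proof. by apply: tensor_DY; [exact: md_cont|exact: md_D1]. Qed.

(** On each side of the rectangle the outward derivative of the mode is -s times the mode, so the
    boundary terms of the integrations by parts cancel the boundary integral of the Robin form. *)
Lemma green F n m : C1 F ->
  ip2 (pd1 F) (mode1 n m) + ip2 (pd2 F) (mode2 n m) + s * bdip F (mode n m) =
  lam n m * ip2 F (mode n m).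
Proof.
move=> CF; have cF := C1_cont CF; have DF := C1_DX CF; have DF' := C1_DY CF.
have D11 : DX (mode1 n m) (fun z => - om a s n ^+ 2 * mode n m z).
  have [h1 h2] := tensor_DX (md'_D1 a s n) (md_cont (s := s) (L := b) (n := m)).
  have e : (fun z => - om a s n ^+ 2 * mode n m z) =
    tensor (fun x => - om a s n ^+ 2 * md a s n x) (md b s m).
    by apply/funext => z; rewrite /mode /tensor mulrA.
  by rewrite e; split.
have D22 : DY (mode2 n m) (fun z => - om b s m ^+ 2 * mode n m z).
  have [h1 h2] := tensor_DY (md_cont (s := s) (L := a) (n := n)) (md'_D1 b s m).
  have e : (fun z => - om b s m ^+ 2 * mode n m z) =
    tensor (md a s n) (fun x => - om b s m ^+ 2 * md b s m x).
    by apply/funext => z; rewrite /mode /tensor mulrCA.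
  by rewrite e; split.
have c1 : continuous (mode1 n m) by exact: mode1_cont.
have c2 : continuous (mode2 n m) by exact: mode2_cont.
have E1 := ibpX cF c1 DF D11.
have E2 := ibpY cF c2 DF' D22.
have LF := continuous_L2_2 a0 b0 cF.
have Lm := continuous_L2_2 a0 b0 (@mode_cont n m).
rewrite ipZr// in E1; rewrite ipZr// in E2.
have Lfb x : L2b (fun y => F (x, y)) by apply: continuous_L2; exact: continuous_slice2.
have Lfa y : L2a (fun x => F (x, y)) by apply: continuous_L2; exact: continuous_slice1.
have Lmb x : L2b (fun y => mode n m (x, y)).
  by apply: continuous_L2; apply: continuous_slice2; exact: mode_cont.
have Lma y : L2a (fun x => mode n m (x, y)).
  by apply: continuous_L2; apply: continuous_slice1; exact: mode_cont.
have B1 : (fun y => mode1 n m (a, y)) = (fun y => - s * mode n m (a, y)).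
  by apply/funext => y; rewrite /mode1 /mode /tensor/= (md_bcL a0 s0) mulrA.
have B2 : (fun y => mode1 n m (0, y)) = (fun y => s * mode n m (0, y)).
  by apply/funext => y; rewrite /mode1 /mode /tensor/= (md_bc0 _ s0) mulrA.
have B3 : (fun x => mode2 n m (x, b)) = (fun x => - s * mode n m (x, b)).
  by apply/funext => y; rewrite /mode2 /mode /tensor/= (md_bcL b0 s0) mulrCA.
have B4 : (fun x => mode2 n m (x, 0)) = (fun x => s * mode n m (x, 0)).
  by apply/funext => y; rewrite /mode2 /mode /tensor/= (md_bc0 _ s0) mulrCA.
rewrite B1 B2 !ipZr// in E1; rewrite B3 B4 !ipZr// in E2.
by rewrite /bdip /lam; lra.
Qed.

Definition bdL2 T : Prop :=
  [/\ L2a (fun x => T (x, 0)), L2a (fun x => T (x, b)),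
      L2b (fun y => T (0, y)) & L2b (fun y => T (a, y))].

(** Real counterpart of [H1], reduced to simultaneous approximation of function, gradient and trace
    by C^1 functions. [green] is passed to the limit along such a sequence. *)
Definition RH U G1 G2 T : Prop :=
  [/\ L2 mu D U, L2 mu D G1, L2 mu D G2, bdL2 T &
  exists W : nat -> R * R -> R, [/\ forall j, C1 (W j),
    ip2 (fun z => W j z - U z) (fun z => W j z - U z) @[j --> \oo] --> 0,
    ip2 (fun z => pd1 (W j) z - G1 z) (fun z => pd1 (W j) z - G1 z) @[j --> \oo] --> 0,
    ip2 (fun z => pd2 (W j) z - G2 z) (fun z => pd2 (W j) z - G2 z) @[j --> \oo] --> 0 &
    bdip (fun z => W j z - T z) (fun z => W j z - T z) @[j --> \oo] --> 0]].

Lemma cont_bdL2 F : continuous F -> bdL2 F.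
Proof.
by move=> cF; split; apply: continuous_L2;
  (exact: continuous_slice1 || exact: continuous_slice2).
Qed.

Lemma bdip_cvg (W : nat -> R * R -> R) T V : (forall j, bdL2 (W j)) -> bdL2 T -> bdL2 V ->
  bdip (fun z => W j z - T z) (fun z => W j z - T z) @[j --> \oo] --> 0 ->
  bdip (W j) V @[j --> \oo] --> bdip T V.
Proof.
move=> LW [T1 T2 T3 T4] [V1 V2 V3 V4] h.
have sq (f : nat -> R) : (forall j, 0 <= f j <= bdip (fun z => W j z - T z) (fun z => W j z - T z)) ->
    f @ \oo --> 0.
  move=> fj; apply: (@squeeze_cvgr _ _ _ _ (fun=> 0)
     (fun j => bdip (fun z => W j z - T z) (fun z => W j z - T z)) _ _ 0 _ h).
    by apply: nearW => j.
  exact: cvg_cst.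
have g0 := ip_ge0.
apply: cvgD; first apply: cvgD; first apply: cvgD.
- apply: ip_cvg => //; first by move=> j; have [] := LW j.
  apply: sq => j; rewrite g0/= /bdip -!addrA lerDl !addr_ge0//; exact: g0.
- apply: ip_cvg => //; first by move=> j; have [] := LW j.
  apply: sq => j; rewrite g0/= /bdip -!addrA addrCA lerDl !addr_ge0//; exact: g0.
- apply: ip_cvg => //; first by move=> j; have [] := LW j.
  apply: sq => j; rewrite g0/= /bdip addrAC lerDr !addr_ge0//; exact: g0.
- apply: ip_cvg => //; first by move=> j; have [] := LW j.
  apply: sq => j; rewrite g0/= /bdip lerDr !addr_ge0//; exact: g0.
Qed.

Lemma RH_green U G1 G2 T n m : RH U G1 G2 T ->
  ip2 G1 (mode1 n m) + ip2 G2 (mode2 n m) + s * bdip T (mode n m) =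
  lam n m * ip2 U (mode n m).
Proof.
move=> [LU LG1 LG2 LT [W [CW h0 h1 h2 h3]]].
have cm : continuous (mode n m) by exact: mode_cont.
have cm1 : continuous (mode1 n m) by exact: mode1_cont.
have cm2 : continuous (mode2 n m) by exact: mode2_cont.
have Lm := continuous_L2_2 a0 b0 cm.
have Lm1 := continuous_L2_2 a0 b0 cm1; have Lm2 := continuous_L2_2 a0 b0 cm2.
have LW j : L2 mu D (W j) by apply: continuous_L2_2 => //; exact: C1_cont.
have LW1 j : L2 mu D (pd1 (W j)) by apply: continuous_L2_2 => //; case: (CW j).
have LW2 j : L2 mu D (pd2 (W j)) by apply: continuous_L2_2 => //; case: (CW j).
have k0 := ip_cvg mD LW LU Lm h0.
have k1 := ip_cvg mD LW1 LG1 Lm1 h1.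
have k2 := ip_cvg mD LW2 LG2 Lm2 h2.
have LbW j : bdL2 (W j) by apply: cont_bdL2; exact: C1_cont.
have k3 := bdip_cvg LbW LT (cont_bdL2 cm) h3.
have l1 : (fun j => lam n m * ip2 (W j) (mode n m)) @ \oo --> lam n m * ip2 U (mode n m).
  by apply: cvgM k0; exact: cvg_cst.
have l2 : (fun j => ip2 (pd1 (W j)) (mode1 n m) + ip2 (pd2 (W j)) (mode2 n m) +
   s * bdip (W j) (mode n m)) @ \oo -->
   ip2 G1 (mode1 n m) + ip2 G2 (mode2 n m) + s * bdip T (mode n m).
  by apply: cvgD; [exact: cvgD k1 k2|apply: cvgM k3; exact: cvg_cst].
have e : (fun j => ip2 (pd1 (W j)) (mode1 n m) + ip2 (pd2 (W j)) (mode2 n m) +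
   s * bdip (W j) (mode n m)) = (fun j => lam n m * ip2 (W j) (mode n m)).
  by apply/funext => j; exact: green.
rewrite e in l2.
exact: (cvg_unique _ l2 l1).
Qed.

Lemma bd_norm2sqE (f : R * R -> R[i]) :
  bdL2 (fun z => complex.Re (f z)) -> bdL2 (fun z => complex.Im (f z)) ->
  bd_norm2sq a b f =
  (bdip (fun z => complex.Re (f z)) (fun z => complex.Re (f z)) +
   bdip (fun z => complex.Im (f z)) (fun z => complex.Im (f z)))%:E.
Proof.
move=> [r1 r2 r3 r4] [i1 i2 i3 i4]; rewrite /bd_norm2sq.
have mI c : measurable (`]0, c[%classic : set (measurableTypeR R)) by exact: measurable_itv.
rewrite (norm2sqE (mI a) r1 i1) (norm2sqE (mI a) r2 i2).
rewrite (norm2sqE (mI b) r3 i3) (norm2sqE (mI b) r4 i4).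
rewrite -!EFinD; congr EFin; rewrite /bdip.
have q (x1 x2 x3 x4 y1 y2 y3 y4 : R) : x1 + y1 + (x2 + y2) + (x3 + y3) + (x4 + y4) =
  x1 + x2 + x3 + x4 + (y1 + y2 + y3 + y4) by ring.
exact: q.
Qed.

Lemma H1_RH u g1 g2 t : H1 a b u g1 g2 t ->
  RH (fun z => complex.Re (u z)) (fun z => complex.Re (g1 z))
     (fun z => complex.Re (g2 z)) (fun z => complex.Re (t z)) /\
  RH (fun z => complex.Im (u z)) (fun z => complex.Im (g1 z))
     (fun z => complex.Im (g2 z)) (fun z => complex.Im (t z)).
Proof.
move=> [[Lu Lg1 Lg2 _] [[t1 t2 t3 t4] [w [Cw h0 h1 h2 h3]]]].
have [Lur Lui] := (inL2_Re mD Lu, inL2_Im mD Lu).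
have [L1r L1i] := (inL2_Re mD Lg1, inL2_Im mD Lg1).
have [L2r L2i] := (inL2_Re mD Lg2, inL2_Im mD Lg2).
have mI c : measurable (`]0, c[%classic : set (measurableTypeR R)) by exact: measurable_itv.
have [t1r t1i] := (inL2_Re (mI a) t1, inL2_Im (mI a) t1).
have [t2r t2i] := (inL2_Re (mI a) t2, inL2_Im (mI a) t2).
have [t3r t3i] := (inL2_Re (mI b) t3, inL2_Im (mI b) t3).
have [t4r t4i] := (inL2_Re (mI b) t4, inL2_Im (mI b) t4).
have Cr j := (Cw j).1; have Ci j := (Cw j).2.
have LC F : C1 F -> [/\ L2 mu D F, L2 mu D (pd1 F) & L2 mu D (pd2 F)].
  by move=> [_ _ c0 c1 c2]; split; apply: continuous_L2_2.
have [||k0r k0i] := @norm2sq_cvg0 _ T2 R mu D mD (fun j z => w j z - u z) _ _ h0.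
- by move=> j; apply: L2_ReB => //; have [] := LC _ (Cr j).
- by move=> j; apply: L2_ImB => //; have [] := LC _ (Ci j).
have [||k1r k1i] := @norm2sq_cvg0 _ T2 R mu D mD (fun j z => cpd1 (w j) z - g1 z) _ _ h1.
- by move=> j; have [_ h _] := LC _ (Cr j); exact: (L2_ReB (f := cpd1 (w j)) mD h L1r).
- by move=> j; have [_ h _] := LC _ (Ci j); exact: (L2_ImB (f := cpd1 (w j)) mD h L1i).
have [||k2r k2i] := @norm2sq_cvg0 _ T2 R mu D mD (fun j z => cpd2 (w j) z - g2 z) _ _ h2.
- by move=> j; have [_ _ h] := LC _ (Cr j); exact: (L2_ReB (f := cpd2 (w j)) mD h L2r).
- by move=> j; have [_ _ h] := LC _ (Ci j); exact: (L2_ImB (f := cpd2 (w j)) mD h L2i).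
pose Wr j z := complex.Re (w j z); pose Wi j z := complex.Im (w j z).
pose Tr z := complex.Re (t z); pose Ti z := complex.Im (t z).
have LWr j := cont_bdL2 (C1_cont (Cr j)); have LWi j := cont_bdL2 (C1_cont (Ci j)).
have E j : bd_norm2sq a b (fun z => w j z - t z) =
   (bdip (fun z => Wr j z - Tr z) (fun z => Wr j z - Tr z) +
    bdip (fun z => Wi j z - Ti z) (fun z => Wi j z - Ti z))%:E.
  have [r1 r2 r3 r4] := LWr j; have [i1 i2 i3 i4] := LWi j.
  have eR : (fun z => complex.Re (w j z - t z)) = (fun z => Wr j z - Tr z).
    by apply/funext => z; exact: ReB.
  have eI : (fun z => complex.Im (w j z - t z)) = (fun z => Wi j z - Ti z).
    by apply/funext => z; exact: ImB.
  have bR : bdL2 (fun z => complex.Re (w j z - t z)) by rewrite eR; split; apply: L2B.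
  have bI : bdL2 (fun z => complex.Im (w j z - t z)) by rewrite eI; split; apply: L2B.
  by apply: etrans (bd_norm2sqE bR bI) _; rewrite eR eI.
have [k3r k3i] : bdip (fun z => Wr j z - Tr z) (fun z => Wr j z - Tr z) @[j --> \oo] --> 0 /\
    bdip (fun z => Wi j z - Ti z) (fun z => Wi j z - Ti z) @[j --> \oo] --> 0.
  move: h3; under eq_fun do rewrite E; move=> /fine_cvgP[_ /= h].
  have p F : 0 <= bdip F F by rewrite /bdip !addr_ge0// ip_ge0.
  split; apply: (@squeeze_cvgr _ _ _ _ (fun=> 0) _ _ _ 0 _ h);
    (try exact: cvg_cst); apply: nearW => j; rewrite p/=.
    by rewrite lerDl; exact: p.
  by rewrite lerDr; exact: p.
have eR (f : nat -> T2 -> R[i]) g :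
   (fun j => ip2 (fun z => complex.Re (f j z - g z)) (fun z => complex.Re (f j z - g z))) =
   (fun j => ip2 (fun z => complex.Re (f j z) - complex.Re (g z))
                 (fun z => complex.Re (f j z) - complex.Re (g z))).
  by apply/funext => j; apply: eq_ip => z _; rewrite ReB.
have eI (f : nat -> T2 -> R[i]) g :
   (fun j => ip2 (fun z => complex.Im (f j z - g z)) (fun z => complex.Im (f j z - g z))) =
   (fun j => ip2 (fun z => complex.Im (f j z) - complex.Im (g z))
                 (fun z => complex.Im (f j z) - complex.Im (g z))).
  by apply/funext => j; apply: eq_ip => z _; rewrite ImB.
rewrite (eR (fun j => w j) u) in k0r; rewrite (eI (fun j => w j) u) in k0i.
rewrite (eR (fun j => cpd1 (w j)) g1) in k1r; rewrite (eI (fun j => cpd1 (w j)) g1) in k1i.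
rewrite (eR (fun j => cpd2 (w j)) g2) in k2r; rewrite (eI (fun j => cpd2 (w j)) g2) in k2i.
split; split => //.
- exists Wr; split; [exact: Cr|exact: k0r|exact: k1r|exact: k2r|exact: k3r].
- exists Wi; split; [exact: Ci|exact: k0i|exact: k1i|exact: k2i|exact: k3i].
Qed.

Definition toC (V : R * R -> R) (z : R * R) : R[i] := (V z)%:C.

Lemma toC_L2 V : L2 mu D V -> inL2 mu D (toC V).
Proof. by move=> LV; apply: L2_inL2 => //=; exact: L2_0. Qed.

Lemma toC_inL2_1 (c : R) (V : R -> R) :
  L2 (leb1 R) `]0, c[%classic V -> inL2 (leb1 R) `]0, c[%classic (fun x => (V x)%:C).
Proof. by move=> LV; apply: L2_inL2 => //=; exact: L2_0. Qed.

Lemma pd1_cst0 : pd1 (fun=> 0 : R) = (fun=> 0).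
Proof. by apply/funext => z; rewrite /pd1 derive1_cst. Qed.

Lemma pd2_cst0 : pd2 (fun=> 0 : R) = (fun=> 0).
Proof. by apply/funext => z; rewrite /pd2 derive1_cst. Qed.

Lemma C1_cst0 : C1 (fun=> 0 : R).
Proof.
split; rewrite ?pd1_cst0 ?pd2_cst0; try by move=> z; exact: cvg_cst.
- by move=> z; exact: derivable_cst.
- by move=> z; exact: derivable_cst.
Qed.

Lemma norm2sq_0 d (T : measurableType d) (nu : {measure set T -> \bar R}) (E : set T)
  (f : T -> R[i]) : (forall z, f z = 0) -> norm2sq nu E f = 0%E.
Proof.
move=> f0; rewrite /norm2sq; under eq_integral do rewrite f0 /sqmod/= expr0n/= addr0.
exact: integral0.
Qed.

Lemma test_fun_edge phi z : test_fun a b phi -> ~ rect a b z -> phi z = 0.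
Proof. by move=> [_ [K [_ KD]]] H zD; apply: H => /KD. Qed.

Lemma Re_toC (x : R[i]) (y : R) : complex.Re (x * y%:C) = complex.Re x * y.
Proof. by case: x => p q /=; rewrite mulr0 subr0. Qed.

Lemma Im_toC (x : R[i]) (y : R) : complex.Im (x * y%:C) = complex.Im x * y.
Proof. by case: x => p q /=; rewrite mulr0 add0r. Qed.

Lemma cintegral_toC d (T : measurableType d) (nu : {measure set T -> \bar R}) (E : set T)
  (f : T -> R[i]) (V : T -> R) : cintegral nu E (fun z => f z * (V z)%:C) =
  ip nu E (fun z => complex.Re (f z)) V +i* ip nu E (fun z => complex.Im (f z)) V.
Proof.
rewrite /cintegral; congr (_ +i* _); apply: eq_Rintegral => z _.
  exact: Re_toC.
exact: Im_toC.
Qed.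

Lemma ip0l d (T : measurableType d) (nu : {measure set T -> \bar R}) (E : set T)
  (V : T -> R) : ip nu E (fun=> 0) V = 0.
Proof.
rewrite /ip; under eq_Rintegral do rewrite mul0r.
by rewrite /Rintegral integral0.
Qed.

(** Makes the modes admissible in the weak formulation. Test functions vanish on the edges, so
    integration by parts gives the weak gradient; the constant sequence gives the trace. *)
Lemma C1_H1 V : C1 V -> H1 a b (toC V) (toC (pd1 V)) (toC (pd2 V)) (toC V).
Proof.
move=> CV; have [_ _ cV c1 c2] := CV.
have DV := C1_DX CV; have DV' := C1_DY CV.
have LV := continuous_L2_2 a0 b0 cV.
split.
  split; [exact: toC_L2|apply: toC_L2; exact: continuous_L2_2|apply: toC_L2; exact: continuous_L2_2|].
  move=> phi Tphi; have [Cphi _] := Tphi.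
  have cphi := C1_cont Cphi.
  have edge x y : ~~ (0 < x < a) || ~~ (0 < y < b) -> phi (x, y) = 0.
    move=> h; apply: test_fun_edge Tphi _ => -[/=]; rewrite !in_itv/= => h1 h2.
    by rewrite h1 h2 in h.
  rewrite !cintegral_toC !ip0l; split.
    have := ibpX cV cphi DV (C1_DX Cphi).
    rewrite [ipb _ (fun y => phi (a, y))]ipC [ipb _ (fun y => phi (0, y))]ipC.
    have -> : (fun y => phi (a, y)) = (fun=> 0).
      by apply/funext => y; apply: edge; rewrite ltxx andbF.
    have -> : (fun y => phi (0, y)) = (fun=> 0).
      by apply/funext => y; apply: edge; rewrite ltxx.
    rewrite !ip0l subr0 => /eqP; rewrite addrC addr_eq0 => /eqP E.
    by rewrite [ip _ _ _ _]E; congr (_ +i* _); rewrite oppr0.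
  have := ibpY cV cphi DV' (C1_DY Cphi).
  rewrite [ipa _ (fun y => phi (y, b))]ipC [ipa _ (fun y => phi (y, 0))]ipC.
  have -> : (fun y => phi (y, b)) = (fun=> 0).
    by apply/funext => y; apply: edge; rewrite ltxx !andbF orbT.
  have -> : (fun y => phi (y, 0)) = (fun=> 0).
    by apply/funext => y; apply: edge; rewrite ltxx orbT.
  rewrite !ip0l subr0 => /eqP; rewrite addrC addr_eq0 => /eqP E.
  by rewrite [ip _ _ _ _]E; congr (_ +i* _); rewrite oppr0.
have [b1 b2 b3 b4] := cont_bdL2 cV.
split; first by split; exact: toC_inL2_1.
exists (fun=> toC V).
have p1 z : cpd1 (toC V) z = toC (pd1 V) z.
  by rewrite /cpd1 /toC/= pd1_cst0.
have p2 z : cpd2 (toC V) z = toC (pd2 V) z.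
  by rewrite /cpd2 /toC/= pd2_cst0.
split.
- by move=> _; split; [exact: CV|exact: C1_cst0].
- by under eq_fun do (rewrite norm2sq_0; last by move=> z; rewrite subrr); exact: cvg_cst.
- by under eq_fun do (rewrite norm2sq_0; last by move=> z; rewrite p1 subrr); exact: cvg_cst.
- by under eq_fun do (rewrite norm2sq_0; last by move=> z; rewrite p2 subrr); exact: cvg_cst.
- rewrite /bd_norm2sq; under eq_fun do (rewrite !norm2sq_0; try by move=> z; rewrite subrr).
  by rewrite !adde0; exact: cvg_cst.
Qed.

Lemma mode_C1 n m : [/\ C1 (mode n m), pd1 (mode n m) = mode1 n m &
  pd2 (mode n m) = mode2 n m].
Proof.
by apply: DXY_C1; [exact: mode_cont|exact: mode_DX|exact: mode_DY].
Qed.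

Lemma mul_conj_real (x : R[i]) (y : R) : x * Num.conj (y%:C) = x * y%:C.
Proof. by congr (_ * _); exact: conjc_real. Qed.

Lemma robin_ker_L2 Lam u : robin_ker s a b Lam u -> inL2 mu D u.
Proof. by move=> [_ [g1 [g2 [t [[[]]]]]]]. Qed.

(** These are the real and imaginary parts of (p + iq)(x + iy) = l (x + iy). *)
Lemma complex_mul_eq0 (p q x y l : R) :
  p * x - q * y = l * x -> p * y + q * x = l * y -> l%:C != p +i* q -> x = 0 /\ y = 0.
Proof.
move=> E1 E2 ne.
have A : (p - l) * (x ^+ 2 + y ^+ 2) = 0.
  have -> : (p - l) * (x ^+ 2 + y ^+ 2) =
    (p * x - q * y - l * x) * x + (p * y + q * x - l * y) * y by ring.
  by rewrite E1 E2 !subrr !mul0r addr0.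
have B : q * (x ^+ 2 + y ^+ 2) = 0.
  have -> : q * (x ^+ 2 + y ^+ 2) =
    (p * y + q * x - l * y) * x - (p * x - q * y - l * x) * y by ring.
  by rewrite E1 E2 !subrr !mul0r subr0.
have [/eqP|xy] := eqVneq (x ^+ 2 + y ^+ 2) 0.
  by rewrite paddr_eq0 ?sqr_ge0// !sqrf_eq0 => /andP[/eqP -> /eqP ->].
move/eqP : A; rewrite mulf_eq0 (negbTE xy) orbF subr_eq0 => /eqP pl.
move/eqP : B; rewrite mulf_eq0 (negbTE xy) orbF => /eqP q0.
by move: ne; rewrite pl q0 eqxx.
Qed.

(** Test the equation with the mode: one side is [lam n m] times the inner product by [RH_green],
    the other is [Lam] times it. A complex [Lam] mixes the real and imaginary parts of [u], so both
    are treated together. *)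
Lemma robin_ker_orth Lam u n m : robin_ker s a b Lam u -> (lam n m)%:C != Lam ->
  ip2 (fun z => complex.Re (u z)) (mode n m) = 0 /\
  ip2 (fun z => complex.Im (u z)) (mode n m) = 0.
Proof.
move=> [_ [g1 [g2 [t [Hu E]]]]] ne.
have [CV e1 e2] := mode_C1 n m.
have HV := C1_H1 CV; rewrite e1 e2 in HV.
have {E} := E _ _ _ _ HV.
have [[Lu Lg1 Lg2 _] [[t1 t2 t3 t4] _]] := Hu.
have [RHr RHi] := H1_RH Hu.
have Gr := RH_green n m RHr; have Gi := RH_green n m RHi.
have Lm : L2 mu D (mode n m) by apply: continuous_L2_2 => //; exact: mode_cont.
have Lm1 : L2 mu D (mode1 n m) by apply: continuous_L2_2 => //; exact: mode1_cont.
have Lm2 : L2 mu D (mode2 n m) by apply: continuous_L2_2 => //; exact: mode2_cont.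
set Ur := fun z => complex.Re (u z) in Gr *; set Ui := fun z => complex.Im (u z) in Gi *.
have -> : robin_form s a b g1 g2 t (toC (mode1 n m)) (toC (mode2 n m)) (toC (mode n m)) =
   (lam n m * ip2 Ur (mode n m)) +i* (lam n m * ip2 Ui (mode n m)).
  rewrite -Gr -Gi /robin_form.
  have -> : bd_cintegral a b (fun z => t z * Num.conj (toC (mode n m) z)) =
    bdip (fun z => complex.Re (t z)) (mode n m) +i* bdip (fun z => complex.Im (t z)) (mode n m).
    have -> : (fun z => t z * Num.conj (toC (mode n m) z)) =
      (fun z => t z * (mode n m z)%:C) by apply/funext => z; exact: mul_conj_real.
    by rewrite /bd_cintegral !cintegral_toC.
  have -> : cintegral mu D (fun z => g1 z * Num.conj (toC (mode1 n m) z) +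
      g2 z * Num.conj (toC (mode2 n m) z)) =
    (ip2 (fun z => complex.Re (g1 z)) (mode1 n m) + ip2 (fun z => complex.Re (g2 z)) (mode2 n m)) +i*
    (ip2 (fun z => complex.Im (g1 z)) (mode1 n m) + ip2 (fun z => complex.Im (g2 z)) (mode2 n m)).
    rewrite /cintegral /ip -!RintegralD//; try by apply: L2_mul_integrable => //;
      (exact: inL2_Re || exact: inL2_Im).
    congr (_ +i* _); apply: eq_Rintegral => z _; rewrite !mul_conj_real.
      by case: (g1 z) => p q; case: (g2 z) => p' q' /=; rewrite !mulr0 !subr0.
    by case: (g1 z) => p q; case: (g2 z) => p' q' /=; rewrite !mulr0 !add0r.
  by apply/eqP; rewrite eq_complex/= !mul0r subr0 addr0 !eqxx.
case: Lam ne => p q ne.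
have -> : cintegral mu D (fun z => (p +i* q) * u z * Num.conj (toC (mode n m) z)) =
   (p * ip2 Ur (mode n m) - q * ip2 Ui (mode n m)) +i*
   (p * ip2 Ui (mode n m) + q * ip2 Ur (mode n m)).
  have Lr : L2 mu D Ur by exact: inL2_Re.
  have Li : L2 mu D Ui by exact: inL2_Im.
  rewrite -!ipZl// -ipBl -?ipDl//; try exact: L2Z.
  rewrite /cintegral /ip; congr (_ +i* _); apply: eq_Rintegral => z _; rewrite mul_conj_real.
    by rewrite Re_toC /Ur /Ui; case: (u z).
  by rewrite Im_toC /Ur /Ui; case: (u z).
by move=> [E1 E2]; apply: (complex_mul_eq0 _ _ ne).
Qed.

End weak_form.

(** * The one-dimensional eigenvalue problem *)

Section ode.
Variable R : realType.
Implicit Types (f g phi : R -> R) (x y t mu k : R).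

Lemma derive0_cst g : (forall x, 0 < x < 1 -> is_derive x (1:R) g 0) ->
  forall x y, 0 < x < 1 -> 0 < y < 1 -> g x = g y.
Proof.
move=> dg; suff H x y : 0 < x -> y < 1 -> x < y -> g x = g y.
  move=> x y /andP[x0 x1] /andP[y0 y1].
  by case: (ltgtP x y) => [xy|yx|->//]; [exact: H|apply/esym/H].
move=> x0 y1 xy.
have [z||c _] := @MVT R g (fun=> 0) x y xy.
- rewrite in_itv/= => /andP[xz zy]; apply: dg.
  by rewrite (lt_trans x0)//= (lt_trans zy).
- apply: continuous_in_subspaceT => z /set_mem/=; rewrite in_itv/= => /andP[xz zy].
  apply: differentiable_continuous; apply/derivable1_diffP.
  apply: (@ex_derive _ _ _ _ _ _ _ (dg z _)).
  by rewrite (lt_le_trans x0)//= (le_lt_trans zy).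
by rewrite mul0r => /eqP; rewrite subr_eq0 => /eqP.
Qed.

Definition eigenfun mu phi := forall x : R, 0 < x < 1 ->
  [/\ derivable phi x 1, derivable (derive1 phi) x 1 &
      - derive1 (derive1 phi) x = mu * phi x].

Lemma eigenfun_derive mu phi : eigenfun mu phi -> forall x, 0 < x < 1 ->
  is_derive x (1:R) phi (derive1 phi x) /\
  is_derive x (1:R) (derive1 phi) (- mu * phi x).
Proof.
move=> E x xI; have [d1 d2 d3] := E x xI; split.
  by apply: (DeriveDef d1); rewrite derive1E.
by apply: (DeriveDef d2); rewrite -derive1E mulNr -d3 opprK.
Qed.

Let half : 0 < (2^-1 : R) < 1. Proof. by rewrite invr_gt0 ltr0n invf_lt1 ?ltr1n. Qed.

(** Variation of constants: [al] and [be] are the coefficients of cosine and sine expressed through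
    phi and phi', and their derivatives vanish. They are evaluated at 1/2 as a sample interior
    point. *)
Lemma eigenfun_pos k phi : 0 < k -> eigenfun (k ^+ 2) phi -> exists A B,
  forall x, 0 < x < 1 -> phi x = A * cos (k * x) + B * sin (k * x).
Proof.
move=> k0 /eigenfun_derive E.
pose al x := phi x * cos (k * x) - derive1 phi x * sin (k * x) / k.
pose be x := phi x * sin (k * x) + derive1 phi x * cos (k * x) / k.
have k1 : k != 0 by rewrite gt_eqF.
have ca := @derive0_cst al; have cb := @derive0_cst be.
exists (al 2^-1), (be 2^-1) => x xI.
rewrite (ca _ _ x)// ?(cb _ _ x)//.
- have := cos2Dsin2 (k * x); rewrite /al /be => cs.
  transitivity (phi x * (cos (k * x) ^+ 2 + sin (k * x) ^+ 2)); first by rewrite cs mulr1.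
  by field.
- move=> y yI; have [d1 d2] := E y yI; rewrite /be.
  by apply: is_derive_eq; rewrite /GRing.scale/=; field.
- move=> y yI; have [d1 d2] := E y yI; rewrite /al.
  by apply: is_derive_eq; rewrite /GRing.scale/=; field.
Qed.

(** Here phi' + k phi and phi' - k phi are multiples of single exponentials. *)
Lemma eigenfun_neg k phi : 0 < k -> eigenfun (- k ^+ 2) phi -> exists A B,
  forall x, 0 < x < 1 -> phi x = A * expR (k * x) + B * expR (- k * x).
Proof.
move=> k0 /eigenfun_derive E.
pose al x := (derive1 phi x + k * phi x) * expR (- k * x).
pose be x := (derive1 phi x - k * phi x) * expR (k * x).
have k1 : k != 0 by rewrite gt_eqF.
have ca := @derive0_cst al; have cb := @derive0_cst be.
exists (al 2^-1 / (2 * k)), (- be 2^-1 / (2 * k)) => x xI.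
rewrite (ca _ _ x)// ?(cb _ _ x)//.
- have := expRxMexpNx_1 (k * x); rewrite /al /be mulNr => cs.
  transitivity (phi x * (expR (k * x) * expR (- (k * x)))); first by rewrite cs mulr1.
  by field.
- move=> y yI; have [d1 d2] := E y yI; rewrite /be.
  by apply: is_derive_eq; rewrite /GRing.scale/=; ring.
- move=> y yI; have [d1 d2] := E y yI; rewrite /al.
  by apply: is_derive_eq; rewrite /GRing.scale/=; ring.
Qed.

Lemma eigenfun_zero phi : eigenfun 0 phi -> exists A B,
  forall x, 0 < x < 1 -> phi x = A + B * x.
Proof.
move=> /eigenfun_derive E.
pose be x := derive1 phi x.
have cb := @derive0_cst be.
have {}cb x y : 0 < x < 1 -> 0 < y < 1 -> be x = be y.
  apply: cb => z zI; have [d1 d2] := E z zI; rewrite /be.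
  by apply: is_derive_eq; rewrite oppr0 mul0r.
pose al x := phi x - be 2^-1 * x.
have ca := @derive0_cst al.
exists (al 2^-1), (be 2^-1) => x xI.
rewrite (ca _ _ x)//; first by rewrite /al subrK.
move=> y yI; have [d1 d2] := E y yI; rewrite /al.
apply: is_derive_eq; rewrite /GRing.scale/=.
by rewrite -/(be y) (cb y 2^-1)//; ring.
Qed.

Lemma quotient_cvg f (f' c : R) : is_derive c (1:R) f f' ->
  h^-1 * (f (c + h) - f c) @[h --> 0^'] --> f'.
Proof.
move=> df.
have : h^-1 *: ((f \o shift c) (h *: (1:R)) - f c) @[h --> 0^'] --> f'.
  have := @ex_derive _ _ _ _ _ _ _ df; rewrite /derivable => /cvg_ex[l' hl'].
  by have /= <- := @derive_val _ _ _ _ _ _ _ df; rewrite /derive (cvg_lim _ hl').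
have -> // : (fun h => h^-1 * (f (c + h) - f c)) =
    (fun h => h^-1 *: ((f \o shift c) (h *: (1:R)) - f c)).
by apply/funext => h; rewrite /= /GRing.scale/= mulr1 (addrC c).
Qed.

(** The equation says nothing about phi at an endpoint; the convergence of the difference quotient
    does, since it forces one-sided continuity and hence the value of the interior formula. [F]
    stands for either one-sided filter at 0. *)
Lemma one_sided (F : set_system R) (FF : ProperFilter F) phi f (f' c l : R) :
  (forall A, 0^' A -> F A) ->
  (\forall h \near F, phi (c + h) = f (c + h)) -> is_derive c (1:R) f f' ->
  h^-1 * (phi (c + h) - phi c) @[h --> F] --> l ->
  phi c = f c /\ l = f'.
Proof.
move=> hF pf df hl.
have F0 : h @[h --> F] --> (0 : R) by move=> A nA; apply: hF; exact: nbhs_dnbhs nA.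
have Fn0 : \forall h \near F, h != 0 by apply: hF; exact: (nbhs_dnbhs_neq (0:R)).
have cf : {for c, continuous f}.
  by apply: differentiable_continuous; apply/derivable1_diffP; exact: (@ex_derive _ _ _ _ _ _ _ df).
have fc : f (c + h) @[h --> F] --> f c.
  have : c + h @[h --> F] --> c by rewrite -[X in _ --> X]addr0; apply: cvgD => //; exact: cvg_cst.
  exact: (continuous_cvg _ cf).
have pc : phi (c + h) @[h --> F] --> phi c.
  have : h * (h^-1 * (phi (c + h) - phi c)) + phi c @[h --> F] --> 0 * l + phi c.
    by apply: cvgD; [exact: cvgM|exact: cvg_cst].
  rewrite mul0r add0r; apply: cvg_trans; apply: near_eq_cvg; near=> h.
  by rewrite mulrA mulfV ?mul1r ?subrK//; near: h.
have e1 : phi c = f c.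
  have fc' : phi (c + h) @[h --> F] --> f c.
    by apply: cvg_trans fc; apply: near_eq_cvg; apply: filterS pf => h ->.
  exact: (cvg_unique _ pc fc').
split => //.
have hl' : h^-1 * (phi (c + h) - phi c) @[h --> F] --> f'.
  move=> A nA; have := hF _ (quotient_cvg df nA); apply: filterS2 pf => h ph.
  by rewrite /= ph e1.
exact: (cvg_unique _ hl hl').
Unshelve. all: by end_near. Qed.

End ode.

Section robin1.
Variables (R : realType) (t : R).
Hypothesis t0 : 0 < t.

Lemma sin_eq0_pos (x : R) : 0 < x -> sin x = 0 -> exists n : nat, x = n.+1%:R * pi.
Proof.
move=> x0 sx; have p0 := pi_gt0 R.
have xp : 0 <= x / pi by rewrite ltW// divr_gt0.
have /andP[] := truncn_itv xp; set m := Num.trunc _.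
rewrite ler_pdivlMr// ltr_pdivrMr// -natr1 mulrDl mul1r => h1 h2.
have sr : sin (x - m%:R * pi) = 0.
  by apply/eqP; have := sinDnpi (x - m%:R * pi) m; rewrite subrK sx => /esym/eqP;
    rewrite mulf_eq0 signr_eq0.
have r0 : x = m%:R * pi.
  apply/eqP; rewrite -subr_eq0; apply/negPn/negP => ne.
  have := @sin_gt0_pi R (x - m%:R * pi); rewrite sr ltxx => H.
  have // : false by apply: H; rewrite lt_neqAle eq_sym ne subr_ge0 h1/= ltrBlDl.
case: m r0 {h1 h2 sr} => [|m] r0; last by exists m.
by move: x0; rewrite r0 mul0r ltxx.
Qed.

Lemma bc_interior (phi f f' : R -> R) (d0 d1 : R) :
  (forall x, 0 < x < 1 -> phi x = f x) -> (forall x, is_derive x (1:R) f (f' x)) ->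
  h^-1 * (phi h - phi 0) @[h --> 0^'+] --> d0 ->
  h^-1 * (phi (1 + h) - phi 1) @[h --> 0^'-] --> d1 ->
  [/\ phi 0 = f 0, phi 1 = f 1, d0 = f' 0 & d1 = f' 1].
Proof.
move=> pf df h0 h1.
have h0' : h^-1 * (phi (0 + h) - phi 0) @[h --> 0^'+] --> d0.
  by under eq_fun do rewrite add0r.
have r0 : \forall h \near 0^'+, phi (0 + h) = f (0 + h).
  near=> h; rewrite add0r; apply: pf; apply/andP; split; near: h.
    exact: nbhs_right_gt.
  exact: nbhs_right_lt.
have l1 : \forall h \near 0^'-, phi (1 + h) = f (1 + h).
  near=> h; apply: pf; rewrite gtrDl addrC -ltrBlDr sub0r; apply/andP; split; near: h.
    by apply: nbhs_left_gt; rewrite oppr_lt0.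
  exact: nbhs_left_lt.
have s0 A : (0:R)^' A -> 0^'+ A.
  by rewrite /at_right /dnbhs /within/=; apply: filterS => x h xp; apply: h; rewrite gt_eqF.
have s1 A : (0:R)^' A -> 0^'- A.
  by rewrite /at_left /dnbhs /within/=; apply: filterS => x h xp; apply: h; rewrite lt_eqF.
have [e0 e0'] := one_sided _ s0 r0 (df 0) h0'.
have [e1 e1'] := one_sided _ s1 l1 (df 1) h1.
by split.
Unshelve. all: by end_near. Qed.

Lemma robin1_eigenvalueP mu : robin1_eigenvalue t mu <-> exists n, mu = kap t n ^+ 2.
Proof.
split; last first.
  move=> [n ->].
  have kE : om 1 t n = kap t n by rewrite /om mul1r divr1.
  have o1 := @ltr01 R.
  exists (md 1 t n), (md' 1 t n 0), (md' 1 t n 1).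
  have D := md_D1 1 t n; have D' := md'_D1 1 t n.
  have de : derive1 (md 1 t n) = md' 1 t n.
    by apply/funext => x; rewrite derive1E; exact: (@derive_val _ _ _ _ _ _ _ (D.1 x)).
  split.
  - move=> x _; rewrite de; split.
    + exact: (@ex_derive _ _ _ _ _ _ _ (D.1 x)).
    + exact: (@ex_derive _ _ _ _ _ _ _ (D'.1 x)).
    + by rewrite derive1E (@derive_val _ _ _ _ _ _ _ (D'.1 x)) kE mulNr opprK.
  - apply: cvg_dnbhs_at_right; have := quotient_cvg (D.1 0).
    by under eq_fun do rewrite add0r.
  - by apply: cvg_dnbhs_at_left; exact: quotient_cvg (D.1 1).
  - by rewrite (md_bc0 _ t0) (md_bcL o1 t0) mulNr addNr addNr.
  - have c0 : md 1 t n x @[x --> 0^'+] --> md 1 t n 0.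
      by apply: cvg_at_right_filter; exact: (D1_cont D).
    have [x /= [h1 h2 h3]] : exists x : R, [/\ 0 < x, x < 1 & 0 < md 1 t n x].
      near (0:R)^'+ => x; exists x; split; near: x.
      + exact: nbhs_right_gt.
      + exact: nbhs_right_lt.
      + by apply: (cvgr_gt _ c0); exact: md0_gt0.
    by exists x; [rewrite h1 h2|rewrite gt_eqF].
move=> [phi [d0 [d1 [E h0 h1 [bc0 bc1] [x0 xI px]]]]].
have [mu0|mu0|mu0] := ltgtP mu 0.
- have k0 : 0 < Num.sqrt (- mu) by rewrite sqrtr_gt0 oppr_gt0.
  have muE : mu = - Num.sqrt (- mu) ^+ 2 by rewrite sqr_sqrtr ?opprK// oppr_ge0 ltW.
  move: E; rewrite muE; set k := Num.sqrt (- mu) in k0 *.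
  move=> /(eigenfun_neg k0)[A [B AB]].
  have [|e0 e1 e2 e3] := @bc_interior phi (fun x => A * expR (k * x) + B * expR (- k * x))
     (fun x => k * A * expR (k * x) - k * B * expR (- k * x)) d0 d1 AB _ h0 h1.
    by move=> x; apply: is_derive_eq; rewrite /GRing.scale/=; ring.
  exfalso; move: bc0 bc1; rewrite e0 e1 e2 e3 !mulr0 !mulr1 expR0 !mulr1.
  have EE : expR k * expR (- k) = 1 by exact: expRxMexpNx_1.
  have E1 : 1 < expR k by rewrite expR_gt1.
  have E2 : 0 < expR (- k) by exact: expR_gt0.
  set X := expR k in EE E1 *; set Y := expR (- k) in EE E2 *.
  have Y1 : Y < X by nra.
  move=> q1 q2.
  (* Elimination of [B]: the second factor is, up to sign, the determinant of the two boundary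
     conditions. *)
  have q3 : A * (X * (t + k) ^+ 2 - Y * (t - k) ^+ 2) = 0.
    transitivity ((t + k) * (k * A * X - k * B * Y + t * (A * X + B * Y)) -
       (t - k) * Y * (- (k * A - k * B) + t * (A + B))); first by ring.
    by rewrite q1 q2 !mulr0 subrr.
  have q4 : 0 < X * (t + k) ^+ 2 - Y * (t - k) ^+ 2.
    have tk : 0 < 4 * (t * k) by rewrite !mulr_gt0.
    have : (t - k) ^+ 2 < (t + k) ^+ 2.
      by rewrite -subr_gt0 (_ : _ - _ = 4 * (t * k))//; ring.
    have : 0 <= (t - k) ^+ 2 by exact: sqr_ge0.
    nra.
  move/eqP : q3; rewrite mulf_eq0 (gt_eqF q4) orbF => /eqP A0.
  have B0 : B = 0.
    have : B * (t + k) = 0 by move: q1; rewrite A0; lra.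
    by move/eqP; rewrite mulf_eq0 (gt_eqF (addr_gt0 t0 k0)) orbF => /eqP.
  by move: px; rewrite AB// A0 B0 !mul0r addr0 eqxx.
- have k0 : 0 < Num.sqrt mu by rewrite sqrtr_gt0.
  have muE : mu = Num.sqrt mu ^+ 2 by rewrite sqr_sqrtr// ltW.
  move: E; rewrite muE; set k := Num.sqrt mu in k0 *.
  move=> /(eigenfun_pos k0)[A [B AB]].
  have [|e0 e1 e2 e3] := @bc_interior phi (fun x => A * cos (k * x) + B * sin (k * x))
     (fun x => - k * A * sin (k * x) + k * B * cos (k * x)) d0 d1 AB _ h0 h1.
    by move=> x; apply: is_derive_eq; rewrite /GRing.scale/=; ring.
  move: bc0 bc1; rewrite e0 e1 e2 e3 !mulr0 !mulr1 cos0 sin0 !mulr0 !addr0 !add0r !mulr1.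
  move=> q1 q2.
  have k1 : k != 0 by rewrite gt_eqF.
  have BE : B = t * A / k.
    by apply: (mulfI k1); rewrite mulrCA mulfV// mulr1; lra.
  have A0 : A != 0.
    by apply: contraNneq px => A0; rewrite AB// BE A0 mulr0 !mul0r addr0.
  have q3 : (t ^+ 2 - k ^+ 2) * sin k + 2 * k * t * cos k = 0.
    apply: (mulfI A0); rewrite mulr0.
    transitivity (k * (- k * A * sin k + k * B * cos k + t * (A * cos k + B * sin k))).
      by rewrite BE; field.
    by rewrite q2 mulr0.
  (* With tan y = k / t, expanding sin(k + 2 y) gives cos^2 y / t^2 times the characteristic
     equation [q3]. *)
  have sp : sin (phase t k) = 0.
    rewrite /phase mulr2n mulrDl mul1r sinD sinD cosD sin_atan.
    have t1 : t != 0 by rewrite gt_eqF.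
    transitivity (cos (atan (k / t)) ^+ 2 / t ^+ 2 *
      ((t ^+ 2 - k ^+ 2) * sin k + 2 * k * t * cos k)); first by field.
    by rewrite q3 mulr0.
  have pp : 0 < phase t k.
    rewrite /phase ltr_pwDl// mulr_ge0// -[leLHS]atan0 le_atan//.
    by rewrite ltW// divr_gt0.
  have [n nE] := sin_eq0_pos pp sp.
  by exists n; rewrite (kap_uniq t0 nE).
- move: E; rewrite mu0 => /eigenfun_zero[A [B AB]].
  have [|e0 e1 e2 e3] := @bc_interior phi (fun x => A + B * x)
     (fun x => B) d0 d1 AB _ h0 h1.
    by move=> x; apply: is_derive_eq; rewrite /GRing.scale/=; ring.
  exfalso; move: bc0 bc1; rewrite e0 e1 e2 e3 !mulr0 !mulr1 addr0 => q1 q2.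
  have q3 : A * (t * (2 + t)) = 0 by nra.
  have q4 : 0 < t * (2 + t) by rewrite mulr_gt0// addr_gt0.
  move/eqP : q3; rewrite mulf_eq0 (gt_eqF q4) orbF => /eqP A0.
  have B0 : B = 0 by move: q1; rewrite A0; lra.
  by move: px; rewrite AB// A0 B0 mul0r addr0 eqxx.
Unshelve. all: by end_near. Qed.

(** As [kap t] is increasing, exactly [m] eigenvalues lie below [kap t m ^+ 2]; comparing cardinals
    pins down the index of the value chosen by [xget]. *)
Lemma robin_kE n : robin_k n t = kap t n.
Proof.
have kp m : 0 <= kap t m by rewrite ltW// kap_gt0.
have inj : injective (fun i => kap t i ^+ 2).
  move=> i j /eqP; rewrite eqrXn2// => /eqP kij.
  by case: (ltngtP i j) => // h; [move: (kap_mono t0 i j)|move: (kap_mono t0 j i)];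
    rewrite kij ltxx h.
have card m : ([set nu | robin1_eigenvalue t nu /\ nu < kap t m ^+ 2] #= `I_m)%card.
  rewrite (_ : [set _ | _] = (fun i => kap t i ^+ 2) @` `I_m).
    by apply: inj_card_eq => i j _ _; exact: inj.
  apply/seteqP; split => [nu [/robin1_eigenvalueP[i ->]]|_ [i /= im <-]].
    by rewrite ltr_pXn2r ?nnegrE// kap_mono// => im; exists i.
  split; first by apply/robin1_eigenvalueP; exists i.
  by rewrite ltr_pXn2r ?nnegrE// kap_mono.
rewrite /robin_k; case: xgetP => [mu _ [/robin1_eigenvalueP[m ->] cm]|/(_ (kap t n ^+ 2))].
  rewrite sqrtr_sqr ger0_norm//; congr kap.
  by apply/card_eq_II; apply: card_eq_trans cm; rewrite card_eq_sym; exact: card.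
by case; split => //; apply/robin1_eigenvalueP; exists n.
Qed.

End robin1.

(** * Boundedness of the multiplicities *)

Section trigo_bounds.
Variable R : realType.
Implicit Types x : R.

Lemma sin_le_id x : 0 < x -> sin x <= x.
Proof.
move=> x0.
have [|c _] := @MVT R (@sin R) (@cos R) 0 x x0 (fun y _ => is_derive_sin y).
  by apply: continuous_subspaceT; exact: continuous_sin.
by rewrite sin0 !subr0 => ->; rewrite ler_piMl ?cos_le1// ltW.
Qed.

Lemma id_cos_le_sin x : 0 < x < pi / 2 -> x * cos x <= sin x.
Proof.
move=> /andP[x0 xp].
have dg (y : R) : is_derive y (1:R) (fun y => sin y - y * cos y) (y * sin y).
  by apply: is_derive_eq; rewrite /GRing.scale/=; ring.
have [|c] := @MVT R (fun y => sin y - y * cos y) (fun y => y * sin y) 0 x x0 (fun y _ => dg y).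
  by apply: continuous_subspaceT => z; exact: (is_derive_cont dg).
rewrite in_itv/= => /andP[c0 cx].
rewrite sin0 mul0r !subr0 => E; rewrite -subr_ge0 E.
rewrite mulr_ge0 ?(ltW x0)// mulr_ge0 ?(ltW c0)// ltW// sin_gt0_pihalf// c0.
exact: lt_trans xp.
Qed.

End trigo_bounds.

(** * Convexity of the squared mode index in the squared frequency *)

Section convexity.
Variables (R : realType) (L s : R).
Hypotheses (L0 : 0 < L) (s0 : 0 < s).
Implicit Types (w x y : R).

(** Pi times the mode index, extended to real frequencies: see [idx_om]. *)
Definition idx w : R := L * w - pi + 2 * atan (w / s).
Definition idx' w : R := L + 2 * s / (w ^+ 2 + s ^+ 2).
(* The derivative of idx^2 with respect to w^2. *)
Definition slope w : R := idx w * idx' w / w.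

Let S0 w : 0 < w ^+ 2 + s ^+ 2.
Proof. by rewrite ltr_wpDl ?exprn_gt0// sqr_ge0. Qed.

Lemma is_derive_idx w : is_derive w (1:R) idx (idx' w).
Proof.
apply: is_derive_eq; rewrite /GRing.scale /= /idx'.
have H : 1 + (w / s) ^+ 2 = (w ^+ 2 + s ^+ 2) / s ^+ 2 by field; rewrite gt_eqF.
by rewrite H; field; rewrite gt_eqF// gt_eqF.
Qed.

Lemma is_derive_idx' w : is_derive w (1:R) idx' (- 4 * s * w / (w ^+ 2 + s ^+ 2) ^+ 2).
Proof.
rewrite /idx'; have H : w ^+ 2 + s ^+ 2 != 0 by rewrite gt_eqF.
have d : is_derive w (1:R) (fun w => (w ^+ 2 + s ^+ 2)^-1) (- (w ^+ 2 + s ^+ 2) ^- 2 *: (2 * w)).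
  apply: (@is_deriveV _ (fun w => w ^+ 2 + s ^+ 2)) => //.
  by apply: is_derive_eq; rewrite /GRing.scale/=; ring.
by apply: is_derive_eq; rewrite /GRing.scale/=; field.
Qed.

Lemma idx_mono : {homo idx : x y / x <= y}.
Proof.
move=> x y xy; rewrite /idx lerD ?lerB ?ler_wpM2l ?(ltW L0)//.
by rewrite le_atan// ler_wpM2r// invr_ge0 ltW.
Qed.

(** With t = pi/2 - atan(w / s), [idx w] is L w - 2 t and sin t cos t is s w / (w^2 + s^2); the
    claim becomes sin t cos t <= t, that is, sin 2t <= 2t. *)
Lemma idx_le w : 0 < w -> idx w <= w * (L - 2 * s / (w ^+ 2 + s ^+ 2)).
Proof.
move=> w0; pose t := pi / 2 - atan (w / s).
have t0 : 0 < t by rewrite subr_gt0 atan_ltpi2.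
have E : idx w = L * w - 2 * t by rewrite /idx /t; field.
have st : w * sin t = s * cos t.
  rewrite /t -opprB cosN sinN cosBpihalf sinBpihalf opprK sin_atan.
  by rewrite mulrA; congr (_ * _); rewrite mulrC mulfVK ?gt_eqF.
have cs := cos2Dsin2 t.
have : sin t * cos t <= t.
  have := sin_le_id (mulr_gt0 (ltr0n R 2) t0); rewrite mulrDl mul1r sinD; lra.
have -> : sin t * cos t = s * w / (w ^+ 2 + s ^+ 2).
  have : (w ^+ 2 + s ^+ 2) * (sin t * cos t) = s * w * (cos t ^+ 2 + sin t ^+ 2).
    transitivity (w * (w * sin t) * cos t + s * sin t * (s * cos t)); first by ring.
    transitivity (w * (s * cos t) * cos t + s * sin t * (w * sin t)); last by ring.
    by rewrite st.
  rewrite cs mulr1 => <-; field; rewrite gt_eqF//.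
rewrite E => h.
have -> : w * (L - 2 * s / (w ^+ 2 + s ^+ 2)) = L * w - 2 * (s * w / (w ^+ 2 + s ^+ 2)).
  by field; rewrite gt_eqF.
lra.
Qed.

Lemma is_derive_slope w : 0 < w -> is_derive w (1:R) slope
  ((w * idx' w ^+ 2 + w * idx w * (- 4 * s * w / (w ^+ 2 + s ^+ 2) ^+ 2) - idx w * idx' w) / w ^+ 2).
Proof.
move=> w0; have w1 : w != 0 by rewrite gt_eqF.
have d1 := is_derive_idx w; have d2 := is_derive_idx' w.
have d3 : is_derive w (1:R) (fun w : R => w^-1) (- w ^- 2 *: 1) by exact: is_deriveV.
rewrite /slope; apply: is_derive_eq; rewrite /GRing.scale/=; field.
by rewrite w1 gt_eqF.
Qed.

(** With e = 2 s / (w^2 + s^2) and r = w^2 / (w^2 + s^2) <= 1, the numerator is w (L + e)^2 - idx (L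
    + e + 2 e r). By [idx_le] the subtracted term is at most w (L - e)(L + 3 e), which is w (L +
    e)^2 - 4 w e^2. *)
Lemma slope_deriv_gt0 w : 0 < w -> 0 <= idx w ->
  0 < (w * idx' w ^+ 2 + w * idx w * (- 4 * s * w / (w ^+ 2 + s ^+ 2) ^+ 2) - idx w * idx' w) / w ^+ 2.
Proof.
move=> w0 i0; apply: divr_gt0; last by rewrite exprn_gt0.
have := idx_le w0; rewrite /idx'; set e := 2 * s / (w ^+ 2 + s ^+ 2) => ile.
have e0 : 0 < e by rewrite divr_gt0// mulr_gt0.
pose r := w ^+ 2 / (w ^+ 2 + s ^+ 2).
have r0 : 0 <= r by rewrite divr_ge0// ?sqr_ge0// ltW.
have r1 : r <= 1 by rewrite ler_pdivrMr// mul1r lerDl sqr_ge0.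
have -> : w * (L + e) ^+ 2 + w * idx w * (- 4 * s * w / (w ^+ 2 + s ^+ 2) ^+ 2) - idx w * (L + e) =
  w * (L + e) ^+ 2 - idx w * (L + e + 2 * e * r).
  by rewrite /e /r; field; rewrite gt_eqF.
have Le : 0 <= L - e by rewrite -(pmulr_rge0 _ w0) (le_trans i0).
have er : 0 <= e * r by rewrite mulr_ge0// ltW.
have p0 : 0 <= L + e + 2 * e * r by rewrite -mulrA; lra.
have : idx w * (L + e + 2 * e * r) <= w * (L - e) * (L + e + 2 * e * r) by rewrite ler_wpM2r.
have : (L - e) * (L + e + 2 * e * r) <= (L - e) * (L + e + 2 * e).
  by rewrite ler_wpM2l// lerD2l; nra.
have : 0 < w * (4 * (e * e)).
  by apply: mulr_gt0 => //; apply: mulr_gt0 => //; exact: mulr_gt0.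
nra.
Qed.

Lemma slope_incr x y : 0 < x -> 0 <= idx x -> x < y -> slope x < slope y.
Proof.
move=> x0 ix xy.
have [z||c] := @MVT R slope (fun w => (w * idx' w ^+ 2 + w * idx w * (- 4 * s * w / (w ^+ 2 + s ^+ 2) ^+ 2) - idx w * idx' w) / w ^+ 2) x y xy.
- by rewrite in_itv/= => /andP[xz _]; apply: is_derive_slope; exact: lt_trans xz.
- apply: continuous_in_subspaceT => z /set_mem/=; rewrite in_itv/= => /andP[xz _].
  apply: differentiable_continuous; apply/derivable1_diffP.
  exact: (@ex_derive _ _ _ _ _ _ _ (is_derive_slope (lt_le_trans x0 xz))).
rewrite in_itv/= => /andP[xc cy] E; rewrite -subr_gt0 E mulr_gt0 ?subr_gt0//.
by apply: slope_deriv_gt0; [exact: lt_trans xc|exact: le_trans ix (idx_mono (ltW xc))].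
Qed.

(** Cauchy's mean value theorem for idx^2 against w^2. *)
Lemma idx_mvt x y : 0 < x -> x < y -> exists2 c, x < c < y &
  idx y ^+ 2 - idx x ^+ 2 = slope c * (y ^+ 2 - x ^+ 2).
Proof.
move=> x0 xy.
pose k := (idx y ^+ 2 - idx x ^+ 2) / (y ^+ 2 - x ^+ 2).
have yx : 0 < y ^+ 2 - x ^+ 2 by rewrite subr_gt0 ltr_pXn2r ?nnegrE// ltW// (lt_trans x0).
pose h w := idx w ^+ 2 - k * w ^+ 2.
have dh w : is_derive w (1:R) h (2 * idx w * idx' w - k * (2 * w)).
  have d1 := is_derive_idx w.
  by rewrite /h; apply: is_derive_eq; rewrite /GRing.scale/=; ring.
have [|c] := @MVT R h _ x y xy (fun z _ => dh z).
  by apply: continuous_subspaceT => z; exact: (is_derive_cont dh).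
rewrite in_itv/= => xcy E; exists c => //.
have hxy : h y - h x = 0.
  by rewrite /h /k; field; rewrite gt_eqF.
move: E; rewrite hxy => /esym/eqP; rewrite mulf_eq0 !subr_eq0 (gt_eqF xy) orbF.
case/andP: xcy => xc cy; have c0 := lt_trans x0 xc.
move=> /eqP E; have -> : slope c = k.
  rewrite /slope; apply: (mulIf (x := 2 * c)); first by rewrite mulf_neq0 ?gt_eqF.
  by rewrite -E; field; rewrite gt_eqF.
by rewrite /k mulfVK// gt_eqF.
Qed.

Lemma idx_om n : idx (om L s n) = n%:R * pi.
Proof. by rewrite /idx; have := om_phase L0 s0 n; rewrite -natr1 mulrDl mul1r; lra. Qed.

(** From n pi / L = om - 2 th / L, the squares differ by at most 4 om th / L. Moreover om th <= s,
    because th cos th <= sin th and om sin th = s cos th. *)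
Lemma om_sqr_bounds n : (n%:R * pi / L) ^+ 2 <= om L s n ^+ 2 <= (n%:R * pi / L) ^+ 2 + 4 * s / L.
Proof.
have o0 := om_gt0 L0 s0 n; have t0 := th_gt0 L s n; have tp := th_lt L0 s0 n.
have E := om_th L0 s0 n; have T := th_tan L s0 n.
have c0 : 0 < cos (th L s n).
  by rewrite cos_gt0_pihalf// tp andbT (lt_trans _ t0)// oppr_lt0 divr_gt0 ?pi_gt0.
have ts : om L s n * th L s n <= s.
  have := id_cos_le_sin (x := th L s n); rewrite t0 tp => /(_ isT) h.
  rewrite -(ler_pM2r c0) -T -mulrA ler_pM2l//.
have L1 : L != 0 by rewrite gt_eqF.
have nE : n%:R * pi / L = om L s n - 2 * th L s n / L.
  by rewrite -{1}[om L s n](mulfK L1) E; field.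
have tL : 0 < th L s n / L by rewrite divr_gt0.
have n0 : 0 <= om L s n - 2 * th L s n / L.
  by rewrite -nE divr_ge0 ?mulr_ge0 ?pi_ge0// ltW.
rewrite nE.
have h2 : om L s n * (th L s n / L) <= s / L by rewrite mulrA ler_pM2r ?invr_gt0.
by rewrite -!mulrA in n0 *; apply/andP; split; nra.
Qed.

End convexity.

(** * Counting the pairs of modes with a given eigenvalue *)

Section counting.
Variables (R : realType) (a b s : R) (P Q : nat).
Hypotheses (a0 : 0 < a) (b0 : 0 < b) (s0 : 0 < s) (P0 : (0 < P)%N) (Q0 : (0 < Q)%N).
Hypothesis PQ : a ^+ 2 * Q%:R = b ^+ 2 * P%:R.
Implicit Types (p : nat * nat).

Definition level p : R := om a s p.1 ^+ 2 + om b s p.2 ^+ 2.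
Definition qform p : nat := (Q * p.1 ^ 2 + P * p.2 ^ 2)%N.

(** The left side is the Neumann eigenvalue of the pair; [PQ] makes it an integer multiple of a
    fixed constant. *)
Lemma qformE p : (p.1%:R * pi / a) ^+ 2 + (p.2%:R * pi / b) ^+ 2 =
  (qform p)%:R * (pi ^+ 2 / (a ^+ 2 * Q%:R)) :> R.
Proof.
rewrite /qform natrD !natrM.
have a1 : a != 0 by rewrite gt_eqF.
have b1 : b != 0 by rewrite gt_eqF.
have P1 : P%:R != 0 :> R by rewrite gt_eqF ?ltr0n.
have Q1 : Q%:R != 0 :> R by rewrite gt_eqF ?ltr0n.
rewrite mulrDl; congr (_ + _); first by field; rewrite Q1 a1.
by rewrite PQ; field; rewrite P1 b1.
Qed.

Lemma qform_idx p :
  Q%:R * idx a s (om a s p.1) ^+ 2 + P%:R * idx b s (om b s p.2) ^+ 2 = (qform p)%:R * pi ^+ 2.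
Proof. by rewrite !idx_om// /qform natrD !natrM; ring. Qed.

(* In terms of K = w1^2 and K' = w2^2, the sum Q idx(w1)^2 + P idx(w2)^2 is
   strictly convex on the line K + K' = const, so it takes a given value at
   most twice there. *)
Lemma fiber_lt p1 p2 p3 : level p1 = level p2 -> level p2 = level p3 ->
  qform p1 = qform p2 -> qform p2 = qform p3 ->
  (p1.1 < p2.1)%N -> (p2.1 < p3.1)%N -> False.
Proof.
rewrite /level => l12 l23 q12 q23 n12 n23.
have o n := om_gt0 a0 s0 n; have o' n := om_gt0 b0 s0 n.
have om12 : om a s p1.1 < om a s p2.1 by rewrite om_mono.
have om23 : om a s p2.1 < om a s p3.1 by rewrite om_mono.
have sq (x y : R) : 0 < x -> x < y -> x ^+ 2 < y ^+ 2.
  by move=> x0 xy; rewrite ltr_pXn2r ?nnegrE// ltW// (lt_trans x0).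
have s12 := sq _ _ (o _) om12; have s23 := sq _ _ (o _) om23.
have lt' n m : om b s n ^+ 2 < om b s m ^+ 2 -> om b s n < om b s m.
  by rewrite ltr_pXn2r ?nnegrE ?ltW.
have om21' : om b s p2.2 < om b s p1.2 by apply: lt'; lra.
have om32' : om b s p3.2 < om b s p2.2 by apply: lt'; lra.
have [c1 /andP[c1l c1r] E1] := idx_mvt a s0 (o _) om12.
have [c2 /andP[c2l c2r] E2] := idx_mvt a s0 (o _) om23.
have [d1 /andP[d1l d1r] F1] := idx_mvt b s0 (o' _) om21'.
have [d2 /andP[d2l d2r] F2] := idx_mvt b s0 (o' _) om32'.
have Q1 : 0 < Q%:R :> R by rewrite ltr0n.
have P1 : 0 < P%:R :> R by rewrite ltr0n.
have i0 n : 0 <= idx a s (om a s n) by rewrite idx_om// mulr_ge0 ?pi_ge0.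
have i0' n : 0 <= idx b s (om b s n) by rewrite idx_om// mulr_ge0 ?pi_ge0.
have sc : slope a s c1 < slope a s c2.
  apply: slope_incr => //; last exact: lt_trans c2l.
  - exact: lt_trans c1l.
  - by apply: le_trans (i0 p1.1) _; apply: idx_mono => //; exact: ltW.
have sd : slope b s d2 < slope b s d1.
  apply: slope_incr => //; last exact: lt_trans d1l.
  - exact: lt_trans d2l.
  - by apply: le_trans (i0' p3.2) _; apply: idx_mono => //; exact: ltW.
have e1 := qform_idx p1; have e2 := qform_idx p2; have e3 := qform_idx p3.
rewrite q12 in e1; rewrite -q23 in e3.
have d12 : 0 < om a s p2.1 ^+ 2 - om a s p1.1 ^+ 2 by rewrite subr_gt0.
have d23 : 0 < om a s p3.1 ^+ 2 - om a s p2.1 ^+ 2 by rewrite subr_gt0.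
(* On each of the two arcs the increments of w1^2 and w2^2 are opposite, and so are those of the two
   terms of [qform]; hence the weighted slopes agree. From the first arc to the second, those of [a]
   increase and those of [b] decrease. *)
have G1 : Q%:R * slope a s c1 = P%:R * slope b s d1.
  apply: (mulIf (lt0r_neq0 d12)).
  have -> : P%:R * slope b s d1 * (om a s p2.1 ^+ 2 - om a s p1.1 ^+ 2) =
    P%:R * (slope b s d1 * (om b s p1.2 ^+ 2 - om b s p2.2 ^+ 2)).
    by rewrite -mulrA; congr (_ * (_ * _)); lra.
  by rewrite -mulrA -E1 -F1; lra.
have G2 : Q%:R * slope a s c2 = P%:R * slope b s d2.
  apply: (mulIf (lt0r_neq0 d23)).
  have -> : P%:R * slope b s d2 * (om a s p3.1 ^+ 2 - om a s p2.1 ^+ 2) =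
    P%:R * (slope b s d2 * (om b s p2.2 ^+ 2 - om b s p3.2 ^+ 2)).
    by rewrite -mulrA; congr (_ * (_ * _)); lra.
  by rewrite -mulrA -E2 -F2; lra.
have : Q%:R * slope a s c1 < Q%:R * slope a s c2 by rewrite ltr_pM2l.
have : P%:R * slope b s d2 < P%:R * slope b s d1 by rewrite ltr_pM2l.
by rewrite G1 G2 => h1 h2; have := lt_trans h1 h2; rewrite ltxx.
Qed.

Lemma qform_inj p1 p2 : qform p1 = qform p2 -> p1.1 = p2.1 -> p1 = p2.
Proof.
case: p1 p2 => [n m] [n' m'] /= + nn; rewrite /qform /= nn => /addnI/eqP.
by rewrite eqn_pmul2l// eqn_exp2r// => /eqP ->.
Qed.

(** Sorted by first index, three distinct pairs would have strictly increasing first indices, by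
    [qform_inj], against [fiber_lt]. *)
Lemma fiber_card (l : R) (N : nat) (r : seq (nat * nat)) : uniq r ->
  {in r, forall p, level p = l /\ qform p = N} -> (size r <= 2)%N.
Proof.
move=> ur h; rewrite leqNgt; apply/negP => r3.
pose r1 := sort (fun p q : nat * nat => (p.1 <= q.1)%N) r.
have pr : perm_eq r1 r by rewrite perm_sort.
have sr : sorted (fun p q : nat * nat => (p.1 <= q.1)%N) r1.
  by apply: sort_sorted => p q; exact: leq_total.
have u1 : uniq r1 by rewrite (perm_uniq pr).
have h1 p : p \in r1 -> level p = l /\ qform p = N by rewrite (perm_mem pr); exact: h.
have : (2 < size r1)%N by rewrite (perm_size pr).
case: r1 sr u1 h1 {pr} => [|p1 [|p2 [|p3 r1]]]//= /andP[h12 /andP[h23 _]] u1 h1 _.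
have [l1 q1] := h1 p1 (mem_head _ _).
have [|l2 q2] := h1 p2; first by rewrite !inE eqxx orbT.
have [|l3 q3] := h1 p3; first by rewrite !inE eqxx !orbT.
have st p q : qform p = qform q -> p != q -> (p.1 <= q.1)%N -> (p.1 < q.1)%N.
  move=> pq ne; rewrite leq_eqVlt => /orP[/eqP e|//].
  by move: ne; rewrite (qform_inj pq e) eqxx.
apply: (@fiber_lt p1 p2 p3); rewrite ?l1 ?l2 ?l3 ?q1 ?q2 ?q3//.
- apply: st => //; first by rewrite q1 q2.
  by apply: contraTneq u1 => ->; rewrite inE eqxx.
- apply: st => //; first by rewrite q3 q2.
  by apply: contraTneq u1 => ->; rewrite !inE eqxx !andbF.
Qed.

(** By [om_sqr_bounds], the level of a pair exceeds [c] times its [qform] by a number between 0 and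
    [C]; hence C / c bounds the gap. *)
Lemma qform_close : exists M : nat, forall p1 p2, level p1 = level p2 ->
  (qform p1 <= qform p2 + M)%N.
Proof.
pose c := pi ^+ 2 / (a ^+ 2 * Q%:R) : R.
have c0 : 0 < c by rewrite divr_gt0 ?exprn_gt0 ?pi_gt0// mulr_gt0 ?exprn_gt0// ltr0n.
pose C := 4 * s / a + 4 * s / b.
have C0 : 0 <= C by rewrite addr_ge0// divr_ge0 ?mulr_ge0 ?ltW.
exists (Num.bound (C / c)) => p1 p2 l12.
have B : C / c < (Num.bound (C / c))%:R by apply: archi_boundP; rewrite divr_ge0// ltW.
rewrite -(ler_nat R) natrD; apply: le_trans (_ : (qform p2)%:R + C / c <= _); last first.
  by rewrite lerD2l ltW.
rewrite -(ler_pM2r c0) mulrDl mulfVK ?gt_eqF//.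
have /andP[u1 u2] := om_sqr_bounds a0 s0 p1.1; have /andP[v1 v2] := om_sqr_bounds b0 s0 p1.2.
have /andP[u3 u4] := om_sqr_bounds a0 s0 p2.1; have /andP[v3 v4] := om_sqr_bounds b0 s0 p2.2.
by rewrite -!qformE; move: l12; rewrite /level /C; lra.
Qed.

(** The values of [qform] fall in a window of 2 M + 1 integers around one of them, and each is taken
    at most twice. *)
Lemma level_card : exists M : nat, forall (l : R) (r : seq (nat * nat)), uniq r ->
  {in r, forall p, level p = l} -> (size r <= M)%N.
Proof.
have [M HM] := qform_close; exists (2 * (2 * M + 1))%N => l r ur hl.
case: r ur hl => [//|p0 r0]; set r := p0 :: r0 => ur hl.
(* If [M] exceeds [qform p0], the truncated difference is 0 and the window still reaches past
   [qform p0 + M]. *)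
pose w := iota (qform p0 - M) (2 * M + 1).
have inw p : p \in r -> qform p \in w.
  move=> pr; have lp : level p = level p0 by rewrite !hl// mem_head.
  have h1 := HM _ _ lp; have h2 := HM _ _ (esym lp).
  rewrite mem_iota; apply/andP; split; first by rewrite leq_subLR addnC.
  rewrite addnA; case: (leqP M (qform p0)) => hM.
    by rewrite mul2n -addnn addnA subnK// addn1 ltnS.
  rewrite (eqP (ltnW hM : qform p0 - M == 0)%N) add0n addn1 ltnS.
  by rewrite (leq_trans h1)// mul2n -addnn leq_add2r ltnW.
have -> : size r = (\sum_(v <- w) count (fun p => qform p == v) r)%N.
  rewrite -sum1_size; under [RHS]eq_bigr do rewrite -sum1_count.
  rewrite (exchange_big_dep xpredT)//=.
  rewrite big_seq [RHS]big_seq; apply: eq_bigr => p pr.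
  rewrite sum1_count (eq_count (a2 := pred1 (qform p))); last first.
    by move=> v /=; rewrite eq_sym.
  by rewrite count_uniq_mem ?iota_uniq// inw.
apply: leq_trans (_ : \sum_(v <- w) 2 <= _)%N; last first.
  by rewrite big_const_seq count_predT size_iota iter_addn_0.
apply: leq_sum => v _; rewrite -size_filter.
apply: (@fiber_card l v); first exact: filter_uniq.
by move=> p; rewrite mem_filter => /andP[/eqP -> pr]; split => //; exact: hl.
Qed.

End counting.

(** * Sums of cosines on sets of positive measure *)

Section turan.
Variable R : realType.
Implicit Types (l : seq (R * R * R)) (p : R -> R).

(** A triple holds an amplitude, an initial angle and the increment of the angle per step. *)
Definition tsum l (j : nat) : R :=
  \sum_(t <- l) t.1.1 * cos (t.1.2 + j%:R * t.2).

(* The second difference u(j) - 2 cos B u(j+1) + u(j+2) kills cos(A + j B)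
   and maps the other frequencies to themselves. *)
Lemma tsum_bound l (M : R) : 0 <= M ->
  (forall j, (1 <= j <= 2 * size l)%N -> `|tsum l j| <= M) ->
  `|tsum l 0| <= 7 ^+ size l * M.
Proof.
move Ek : (size l) => k; elim: k l Ek M => [|k IH] [|t0 l]//= Ek M M0 H.
  by rewrite /tsum big_nil normr0 mul1r.
pose l' := [seq (t.1.1 * (2 * cos t.2 - 2 * cos t0.2), t.1.2 + t.2, t.2) | t <- l].
have lE j : tsum l' j = tsum (t0 :: l) j - 2 * cos t0.2 * tsum (t0 :: l) j.+1
    + tsum (t0 :: l) j.+2.
  have key (t : R * R * R) : t.1.1 * cos (t.1.2 + j%:R * t.2) -
     2 * cos t0.2 * (t.1.1 * cos (t.1.2 + j.+1%:R * t.2)) +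
     t.1.1 * cos (t.1.2 + j.+2%:R * t.2) =
     t.1.1 * (2 * cos t.2 - 2 * cos t0.2) * cos (t.1.2 + t.2 + j%:R * t.2).
    have e1 : t.1.2 + j.+1%:R * t.2 = t.1.2 + t.2 + j%:R * t.2.
      by rewrite -natr1; ring.
    have e0 : t.1.2 + j%:R * t.2 = (t.1.2 + t.2 + j%:R * t.2) - t.2 by ring.
    have e2 : t.1.2 + j.+2%:R * t.2 = (t.1.2 + t.2 + j%:R * t.2) + t.2.
      by rewrite -natr1 -natr1; ring.
    rewrite e1 e0 e2; move: (t.1.2 + t.2 + j%:R * t.2) => X.
    by rewrite cosB cosD; ring.
  rewrite [RHS](_ : _ = \sum_(t <- t0 :: l) t.1.1 * (2 * cos t.2 - 2 * cos t0.2) *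
     cos (t.1.2 + t.2 + j%:R * t.2)); last first.
    by rewrite /tsum mulr_sumr -sumrB -big_split/=; apply: eq_bigr => t _; rewrite key.
  by rewrite big_cons subrr mulr0 mul0r add0r /tsum big_map.
have c1 : `|cos t0.2| <= 1 by rewrite ler_norml cos_geN1 cos_le1.
(* The second difference is at most M + 2 M + M = 4 M. Recovering the value at 0 adds 2 M + M, and 4
   * 7^k + 3 <= 7^(k + 1) explains the 7. *)
have Hl' : `|tsum l' 0| <= 7 ^+ k * (4 * M).
  apply: IH; first by rewrite size_map; case: Ek.
    by rewrite mulr_ge0.
  move=> j /andP[j1 jk]; rewrite lE.
  have h0 := H j; have h1 := H j.+1; have h2 := H j.+2.
  have {}h0 : `|tsum (t0 :: l) j| <= M by apply: h0; lia.
  have {}h1 : `|tsum (t0 :: l) j.+1| <= M. by apply: h1; lia.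
  have {}h2 : `|tsum (t0 :: l) j.+2| <= M by apply: h2; lia.
  apply: le_trans (ler_normD _ _) _.
  apply: le_trans (lerD (ler_normB _ _) h2) _; rewrite !normrM (ger0_norm (ler0n _ 2)).
  have : `|cos t0.2| * `|tsum (t0 :: l) j.+1| <= 1 * M by rewrite ler_pM.
  by move: h0; lra.
have h1 : `|tsum (t0 :: l) 1| <= M by apply: H; rewrite /= mulnS.
have h2 : `|tsum (t0 :: l) 2| <= M by apply: H; rewrite /= mulnS.
have -> : tsum (t0 :: l) 0 = tsum l' 0 + 2 * cos t0.2 * tsum (t0 :: l) 1 - tsum (t0 :: l) 2.
  by rewrite lE; ring.
apply: le_trans (ler_normB _ _) _.
apply: le_trans (lerD (ler_normD _ _) h2) _; rewrite !normrM (ger0_norm (ler0n _ 2)).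
have : `|cos t0.2| * `|tsum (t0 :: l) 1| <= 1 * M by rewrite ler_pM.
have k7 : 1 <= 7 ^+ k :> R by rewrite exprn_ege1// ler1n.
have : 0 <= (7 ^+ k - 1) * M by rewrite mulr_ge0// subr_ge0.
by rewrite exprS; move: Hl'; lra.
Qed.

(** A Turan-type inequality as a property of [p], uniform in the start [y] and in the step [d],
    whose sign is free. *)
Definition turanP (n : nat) (C : R) p := forall y d M, 0 <= M ->
  (forall j, (1 <= j <= n)%N -> `|p (y + j%:R * d)| <= M) -> `|p y| <= C * M.

Lemma turanP_reflect n C p : turanP n C p -> turanP n C (fun x => p (- x)).
Proof.
move=> H y d M M0 h; apply: (H (- y) (- d)) => // j jn.
by have := h j jn; rewrite opprD mulrN.
Qed.

Lemma turanP_cos (I : Type) (r : seq I) (c be ga : I -> R) (K : nat) : (size r <= K)%N ->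
  turanP (2 * K) (7 ^+ K) (fun y => \sum_(i <- r) c i * cos (be i * y - ga i)).
Proof.
move=> rK y d M M0 H.
pose l := [seq (c i, be i * y - ga i, be i * d) | i <- r].
have lE j : tsum l j = \sum_(i <- r) c i * cos (be i * (y + j%:R * d) - ga i).
  rewrite /tsum big_map; apply: eq_bigr => i _ /=; congr (_ * cos _); ring.
have -> : \sum_(i <- r) c i * cos (be i * y - ga i) = tsum l 0.
  by rewrite lE; apply: eq_bigr => i _; rewrite mul0r addr0.
apply: le_trans (tsum_bound M0 _) _.
  move=> j /andP[j1]; rewrite size_map => jr; rewrite lE; apply: H.
  by rewrite j1 (leq_trans jr)// leq_mul2l.
by rewrite size_map ler_wpM2r// ler_weXn2l// ler1n.
Qed.

End turan.

Section affine.
Variable R : realType.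
Notation mu := (leb1 R).

(** The preimage has measure [mu B] divided by [j]: [j] times the pushforward agrees with Lebesgue
    measure on intervals, hence everywhere by uniqueness. *)
Lemma leb1_affine (y : R) (j : nat) (B : set (measurableTypeR R)) : (0 < j)%N ->
  measurable B ->
  (mu ((fun d : R => y + j%:R * d)%R @^-1` B) <= mu B)%E.
Proof.
move=> j0 mB.
have jp : 0 < j%:R :> R by rewrite ltr0n.
pose f : measurableTypeR R -> measurableTypeR R := fun d => y + j%:R * d.
have mf : measurable_fun setT f.
  by apply: measurable_funD => //; exact: measurable_funM.
pose nu : {measure set (measurableTypeR R) -> \bar R} := pushforward mu f.
pose nu' := mscale (NngNum (ltW jp)) (nu mf).
have E : mu B = nu' B.
  apply: (@lebesgue_measure_unique R nu') => //= _ [[u v]] _ <-.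
  rewrite /nu' /mscale/= /pushforward.
  have -> : f @^-1` `]u, v]%classic = `](u - y) / j%:R, (v - y) / j%:R]%classic.
    apply/seteqP; split => x /=; rewrite /f !in_itv/= ltr_pdivrMr// ler_pdivlMr//;
      by rewrite [x * _]mulrC ltrBlDl lerBrDl.
  have := @lebesgue_measure_itv R `](u - y) / j%:R, (v - y) / j%:R].
  rewrite /leb1 => /= ->; rewrite lebesgue_measure_itv/=.
  rewrite !lte_fin ltr_pM2r ?invr_gt0// ltrD2r; case: ifP => _; last by rewrite mule0.
  rewrite -!EFinB -EFinM; congr EFin; field; rewrite gt_eqF//.
rewrite E /nu' /mscale/= /pushforward -[leLHS]mul1e lee_wpmul2r//.
by rewrite lee_fin ler1n.
Qed.

End affine.

(** * Bounds on a line from a set of positive measure *)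

Section observability.
Variable R : realType.
Notation mu := (leb1 R).
Implicit Types (p : R -> R) (E : set (measurableTypeR R)).

Lemma leb1_oo (u v : R) : u < v -> leb1 R `]u, v[%classic = (v - u)%:E.
Proof.
move=> uv; have := @lebesgue_measure_itv R `]u, v[; rewrite /leb1 => /= ->.
by rewrite lte_fin uv -EFinB.
Qed.

(* If E fills most of ]c, d[, every y in the left half starts an arithmetic
   progression y + d, ..., y + n d inside E. *)
Lemma progression (n : nat) (c d : R) E y : (0 < n)%N -> c < d -> measurable E ->
  c < y <= (c + d) / 2 ->
  (mu (`]c, d[ `\` E) < ((d - c) / (2 * n%:R ^+ 2))%:E)%E ->
  exists h : R, forall j, (1 <= j <= n)%N -> E (y + j%:R * h) /\ c < y + j%:R * h < d.
Proof.
move=> n0 cd mE /andP[cy yd] muE; apply: contrapT => H.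
have np : 0 < n%:R :> R by rewrite ltr0n.
(* Steps below [w] keep the progression in []c, d[], as [y] is in the left half. Bad steps lie in
   [n] preimages of [B], of total measure at most n mu(B) < w. *)
pose w := (d - c) / (2 * n%:R).
have w0 : 0 < w by rewrite divr_gt0 ?subr_gt0// mulr_gt0.
have nw : n%:R * w = (d - c) / 2 by rewrite /w; field; rewrite gt_eqF.
pose B := `]c, d[%classic `\` E.
have mB : measurable B by apply: measurableD.
pose f j (h : R) : R := y + j.+1%:R * h.
have mf j (X : set (measurableTypeR R)) : measurable X ->
    measurable (f j @^-1` X : set (measurableTypeR R)).
  move=> mX; rewrite -[_ @^-1` _]setTI.
  have mf : measurable_fun (setT : set (measurableTypeR R)) (f j).
    by apply: measurable_funD => //; exact: measurable_funM.
  exact: mf.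
have sub : `]0, w[%classic `<=` \big[setU/set0]_(j < n) (f j @^-1` B).
  move=> h /=; rewrite in_itv/= => /andP[h0 hw]; apply: contrapT => hB.
  have inJ j : (1 <= j <= n)%N -> c < y + j%:R * h < d.
    move=> /andP[j1 jn].
    have jp : 0 < j%:R :> R by rewrite ltr0n.
    have j2 : j%:R * h <= n%:R * h by rewrite ler_pM2r// ler_nat.
    have j3 : n%:R * h < n%:R * w by rewrite ltr_pM2l.
    have j4 : 0 < j%:R * h by rewrite mulr_gt0.
    by apply/andP; split; lra.
  apply: H; exists h => j /[dup] jn /inJ yJ; split => //.
  apply: contrapT => nE; apply: hB.
  case: j jn yJ nE => [//|j] /= jn yJ nE.
  suff : (\bigcup_(k < n) (f k @^-1` B)) h by rewrite bigcup_mkord.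
  by exists j => //=; split => //=; rewrite in_itv.
have le1 : (mu `]0%R, w[%classic <= mu (\big[setU/set0]_(j < n) (f j @^-1` B)))%E.
  apply: le_measure => //; rewrite inE; first exact: measurable_itv.
  by apply: bigsetU_measurable => j _; exact: mf.
have le2 : (mu (\big[setU/set0]_(j < n) (f j @^-1` B)) <= \sum_(j < n) mu (f j @^-1` B))%E.
  exact: (@Boole_inequality _ _ _ mu (fun j => f j @^-1` B) n (fun j _ => mf j _ mB)).
have le3 : (\sum_(j < n) mu (f j @^-1` B) <= \sum_(j < n) mu B)%E.
  by apply: lee_sum => j _; exact: leb1_affine.
have := le_trans le1 (le_trans le2 le3); rewrite leb1_oo// subr0.
have muB : mu B \is a fin_num.
  by rewrite ge0_fin_numE// (lt_trans muE)// ltry.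
rewrite -(fineK muB) sumEFin lee_fin sumr_const card_ord -mulr_natl.
move: muE; rewrite -/B -(fineK muB) lte_fin => muE.
rewrite leNgt => /negP; apply.
apply: lt_le_trans (_ : n%:R * ((d - c) / (2 * n%:R ^+ 2)) <= _).
  by rewrite ltr_pM2l.
by rewrite /w le_eqVlt; apply/orP; left; apply/eqP; field; rewrite gt_eqF.
Qed.

(** The interval grows by h = (d - c) / (n + 1) at the cost of one factor [C]: for a new point y,
    all of y - h, ..., y - n h lie where the bound is already known. *)
Lemma turan_extend (n : nat) (C c d M : R) p r : (0 < n)%N -> 1 <= C -> c < d -> 0 <= M ->
  turanP n C p -> (forall y, c < y < d -> `|p y| <= M) ->
  forall y, c < y < d + r%:R * ((d - c) / n.+1%:R) -> `|p y| <= C ^+ r * M.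
Proof.
move=> n0 C1 cd M0 Tp; have np : 0 < n%:R :> R by rewrite ltr0n.
have C0 : 0 <= C by rewrite (le_trans _ C1).
pose h := (d - c) / n.+1%:R; rewrite -/h.
have h0 : 0 < h by rewrite divr_gt0// subr_gt0.
have nh : n%:R * h = d - c - h.
  by rewrite -[d - c](mulfVK (_ : n.+1%:R != 0 :> R))// -/h -natr1; ring.
elim: r => [|r IH] pM y; first by rewrite mul0r addr0 mul1r; exact: pM.
move=> /andP[cy yd].
have [yd'|yd'] := ltP y (d + r%:R * h).
  apply: le_trans (IH pM y _) _; first by rewrite cy.
  by rewrite ler_wpM2r// ler_weXn2l.
rewrite exprS -mulrA; apply: (Tp y (- h)).
  by rewrite mulr_ge0// exprn_ge0.
move=> j /andP[j1 jn]; apply: IH => //.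
have j2 : j%:R * h <= n%:R * h by rewrite ler_pM2r// ler_nat.
have j3 : 1 * h <= j%:R * h by rewrite ler_pM2r// ler1n.
have r0 : 0 <= r%:R * h by rewrite mulr_ge0// ltW.
move: yd; rewrite -natr1 mulrDl => yd.
by rewrite mulrN; apply/andP; split; lra.
Qed.

(** Chebyshev's inequality removes from [E] the points where [p] exceeds a multiple of its norm on
    [E]. What is left satisfies [progression], which bounds [p] on the left half of []c, d[];
    [turan_extend] then reaches [lo] and [hi]. The constant [k] is chosen before [p] and [E]. *)
Lemma observable (n : nat) (C c d lo hi : R) : (0 < n)%N -> 1 <= C -> c < d ->
  exists2 k, 0 < k & forall p, continuous p -> turanP n C p ->
    forall E, measurable E -> (mu (`]c, d[ `\` E) <= ((d - c) / (4 * n%:R ^+ 2))%:E)%E ->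
    forall y, lo <= y <= hi -> ((k * p y ^+ 2)%:E <= \int[mu]_(x in E `&` `]c, d[) (p x ^+ 2)%:E)%E.
Proof.
move=> n0 C1 cd; have np : 0 < n%:R :> R by rewrite ltr0n.
have C0 : 0 < C by rewrite (lt_le_trans _ C1).
pose m := (c + d) / 2.
have cm : c < m by rewrite /m; lra.
have md : m < d by rewrite /m; lra.
pose h := (m - c) / n.+1%:R.
have h0 : 0 < h by rewrite divr_gt0// subr_gt0.
have [r [rhi rlo]] : exists r : nat, `|hi - m| < r%:R * h /\ `|lo - c| < r%:R * h.
  exists (addn (Num.bound (`|hi - m| / h)) (Num.bound (`|lo - c| / h))).
  have bd (x : R) : `|x| < (Num.bound (`|x| / h))%:R * h.
    by rewrite -ltr_pdivrMr//; apply: archi_boundP; rewrite divr_ge0// ltW.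
  by rewrite natrD mulrDl; split; [apply: lt_le_trans (bd _) _; rewrite lerDl|
     apply: lt_le_trans (bd _) _; rewrite lerDr]; rewrite mulr_ge0// ltW.
pose D := C ^+ r * (C ^+ r * C).
have Cr : 0 < C ^+ r by rewrite exprn_gt0.
have D0 : 0 < D by apply: mulr_gt0 => //; exact: mulr_gt0.
(* 1 / th is the measure allowed for the removed part: added to the same allowance for the
   complement of [E], it meets the threshold of [progression]. *)
pose th := 4 * n%:R ^+ 2 / (d - c).
have th0 : 0 < th by rewrite divr_gt0 ?subr_gt0// mulr_gt0// exprn_gt0.
exists ((D ^+ 2 * th)^-1); first by rewrite invr_gt0 mulr_gt0// exprn_gt0.
move=> p cp Tp E mE muE y /andP[loy yhi].
have mEJ : measurable (E `&` `]c, d[) by apply: measurableI.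
set I := (\int[mu]_(x in E `&` `]c, d[) (p x ^+ 2)%:E)%E.
have I0 : (0 <= I)%E by apply: integral_ge0 => x _; rewrite lee_fin sqr_ge0.
have [Ioo|Ifin] := eqVneq I +oo%E; first by rewrite Ioo leey.
have fI : I \is a fin_num by rewrite ge0_fin_numE// lt_neqAle Ifin leey.
pose A := fine I.
have A0 : 0 <= A by exact: fine_ge0.
rewrite -(fineK fI) lee_fin -/A.
have mp : measurable_fun (setT : set (measurableTypeR R)) p by exact: continuous_measurable_fun.
have key e : 0 < e -> p y ^+ 2 <= D ^+ 2 * (th * A + e).
  (* Chebyshev at height T gives measure below 1 / th; [e] keeps T positive when the integral [A] is
     0. *)
  move=> e0; pose T := Num.sqrt (th * A + e).
  have T2 : T ^+ 2 = th * A + e by rewrite sqr_sqrtr// addr_ge0 ?(ltW e0)// mulr_ge0// ltW.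
  have T0 : 0 < T by rewrite sqrtr_gt0 ltr_wpDl// mulr_ge0// ltW.
  pose B := [set x : R | T < `|p x|] : set (measurableTypeR R).
  have mB : measurable B.
    rewrite (_ : B = (fun x => `|p x|) @^-1` `]T, +oo[%classic).
      rewrite -[_ @^-1` _]setTI.
      have mn : measurable_fun (setT : set (measurableTypeR R)) (fun x => `|p x|).
        by apply: measurableT_comp mp; exact: normr_measurable.
      exact: mn.
    by apply/seteqP; split => x; rewrite /B/= in_itv/= andbT.
  pose E' := E `\` B.
  have mE' : measurable E' by exact: measurableD.
  have muB : (mu (E `&` `]c, d[ `&` B) < ((d - c) / (4 * n%:R ^+ 2))%:E)%E.
    have mX : measurable (E `&` `]c, d[ `&` B) by exact: measurableI.
    have : ((T ^+ 2)%:E * mu (E `&` `]c, d[ `&` B) <= A%:E)%E.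
      rewrite -integral_cst// fineK//.
      apply: le_trans (_ : \int[mu]_(x in E `&` `]c, d[ `&` B) (p x ^+ 2)%:E <= _)%E.
        apply: ge0_le_integral => //.
        - by move=> x _; rewrite lee_fin sqr_ge0.
        - by apply/measurable_EFinP/measurable_funX; exact: measurable_funTS.
        - move=> x [_ Bx]; rewrite lee_fin -[p x ^+ 2]real_normK ?num_real//.
          by rewrite ltW// ltr_pXn2r// ?nnegrE ltW.
      apply: ge0_subset_integral => //.
      - by apply/measurable_EFinP/measurable_funX; exact: measurable_funTS.
      - by move=> x _; rewrite lee_fin sqr_ge0.
    set z := mu _ => zA.
    have zf : z \is a fin_num.
      rewrite ge0_fin_numE ?measure_ge0//.
      apply: le_lt_trans (_ : mu `]c, d[%classic < +oo)%E; last by rewrite leb1_oo// ltry.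
      by apply: le_measure; rewrite ?inE// => x [[]].
    move: zA; rewrite -(fineK zf) -EFinM lee_fin lte_fin T2 => zA.
    have z0 : 0 <= fine z by apply: fine_ge0; exact: measure_ge0.
    rewrite (_ : (d - c) / _ = th^-1); last by rewrite /th invf_div.
    rewrite -(ltr_pM2l th0) mulfV ?gt_eqF//.
    rewrite ltNge; apply/negP => th1.
    have : th * A * 1 <= th * A * (th * fine z) by rewrite ler_wpM2l// mulr_ge0// ltW.
    have : e * 1 <= e * (th * fine z) by rewrite ler_pM2l.
    have : th * ((th * A + e) * fine z) <= th * A by rewrite ler_pM2l.
    nra.
  have muE' : (mu (`]c, d[ `\` E') < ((d - c) / (2 * n%:R ^+ 2))%:E)%E.
    apply: le_lt_trans (_ : mu (`]c, d[ `\` E) + mu (E `&` `]c, d[ `&` B) < _)%E.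
      apply: le_trans (_ : mu ((`]c, d[ `\` E) `|` (E `&` `]c, d[ `&` B)) <= _)%E.
        apply: le_measure; rewrite ?inE.
        - exact: measurableD.
        - by apply: measurableU; [exact: measurableD|exact: measurableI].
        - move=> x [xJ xE']; have [xE|xE] := pselect (E x); last by left.
          right; split => //; apply: contrapT => xB; exact: xE'.
      by apply: measureU2; [exact: measurableD|exact: measurableI].
    rewrite (_ : (d - c) / (2 * _) = (d - c) / (4 * n%:R ^+ 2) + (d - c) / (4 * n%:R ^+ 2)).
      by rewrite EFinD; apply: lee_ltD => //; rewrite ge0_fin_numE ?measure_ge0// (le_lt_trans muE)// ltry.
    by field; rewrite gt_eqF.
  have s1 z : c < z < m -> `|p z| <= C * T.
    move=> /andP[cz zm].
    have [|q Hq] := progression n0 cd mE' _ muE' (y := z); first by rewrite cz ltW.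
    apply: (Tp z q); first exact: ltW.
    move=> j jn; have [[_ nB] _] := Hq j jn.
    by rewrite leNgt; apply/negP.
  have CT : 0 <= C * T by rewrite mulr_ge0// ltW.
  have s2 z : c < z < m + r%:R * h -> `|p z| <= C ^+ r * (C * T).
    exact: (turan_extend n0 C1 cm CT Tp s1).
  (* Reflection turns the extension to the right into one to the left. *)
  have s3 z : - m < z < - c + r%:R * h -> `|p (- z)| <= C ^+ r * (C * T).
    rewrite (_ : h = (- c - - m) / n.+1%:R); last by rewrite /h opprK addrC.
    apply: (turan_extend n0 C1 _ CT (turanP_reflect Tp)); first by rewrite ltrN2.
    by move=> w /andP[w1 w2]; apply: s1; rewrite ltrNr w2 ltrNl w1.
  have py : `|p y| <= C ^+ r * (C * T).
    have [ym|ym] := ltP y m.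
      rewrite -[y]opprK; apply: s3; rewrite ltrN2 ym/=.
      by have := ler_norm (c - lo); rewrite distrC; lra.
    apply: s2; rewrite (lt_le_trans cm ym)/=.
    by have := ler_norm (hi - m); lra.
  have pD : `|p y| <= D * T.
    apply: le_trans py _; rewrite /D -!mulrA ler_peMl//.
      by rewrite mulr_ge0// exprn_ge0// ltW.
    exact: exprn_ege1.
  rewrite -T2 -exprMn -[p y ^+ 2]real_normK ?num_real//.
  by rewrite ler_pXn2r ?nnegrE// mulr_ge0// ltW.
have Dth : 0 < D ^+ 2 * th by apply: mulr_gt0 => //; exact: exprn_gt0.
rewrite mulrC ler_pdivrMr//.
apply/ler_addgt0Pr => e e0.
have De : 0 < e / D ^+ 2 by rewrite divr_gt0// exprn_gt0.
apply: le_trans (key _ De) _.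
by rewrite mulrDr [D ^+ 2 * (e / _)]mulrCA mulfV ?gt_eqF ?exprn_gt0// mulr1 lerD2r; lra.
Qed.

End observability.

(** * Intervals almost filled by a set of positive measure *)

Section density.
Variable R : realType.
Notation mu := (leb1 R).

(** Near a density point x, a ball of radius r misses [E] by less than eps r / 2. The endpoints
    chosen inside it are more than r apart; they are rational so that [slice_interval] can range
    over countably many intervals. *)
Lemma density_interval (E : set (measurableTypeR R)) (eps : R) : measurable E ->
  mu E != 0%E -> 0 < eps ->
  exists c d : rat, (ratr c : R) < ratr d /\
    (mu (`](ratr c : R), (ratr d : R)[ `\` E) <= (eps * (ratr d - ratr c))%:E)%E.
Proof.
move=> mE E0 e0.
have [x [Ex dx]] : exists x : R, E x /\
    (mu (E `&` ball x r) * (mu (ball x r))^-1)%E @[r --> 0^'+] --> (\1_E x)%:E.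
  apply: contrapT => H; move/eqP : E0; apply.
  have := lebesgue_density mE; case => N [mN N0 sub].
  apply: (subset_measure0 (B := N)) => // x Ex; apply: sub => /= hx.
  by apply: H; exists x; split.
rewrite indicE mem_set//= in dx.
have : \forall r \near 0^'+, ((1 - eps / 4)%:E < mu (E `&` ball x r) * (mu (ball x r))^-1)%E.
  have lt1 : ((1 - eps / 4)%:E < 1%:E :> \bar R)%E by rewrite lte_fin; lra.
  exact: (dx _ (open_ereal_gt' lt1)).
move=> near1; near (0:R)^'+ => r.
have r0 : 0 < r by near: r; exact: nbhs_right_gt.
have h1 : ((1 - eps / 4)%:E < mu (E `&` ball x r) * (mu (ball x r))^-1)%E.
  by near: r; exact: near1.
have [c] : exists c : rat, ratr c \in `](x - r), (x - r / 2)[.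
  by apply: rat_in_itvoo; lra.
have [d] : exists d : rat, ratr d \in `](x + r / 2), (x + r)[.
  by apply: rat_in_itvoo; lra.
rewrite !in_itv/= => /andP[d1 d2] /andP[c1 c2].
exists c, d; split; first by lra.
have bE : ball x r = `](x - r), (x + r)[%classic by exact: ball_itv.
have mb : mu (ball x r) = (2 * r)%:E.
  by rewrite bE leb1_oo; [congr EFin; ring|lra].
rewrite mb inver in h1.
apply: le_trans (_ : mu (ball x r `\` E) <= _)%E.
  apply: le_measure; rewrite ?inE.
  - exact: measurableD.
  - by apply: measurableD => //; rewrite bE; exact: measurable_itv.
  - move=> y [/=]; rewrite in_itv/= => /andP[y1 y2] yE; split => //.
    by rewrite bE/= in_itv/=; apply/andP; split; lra.
have mbr : measurable (ball x r : set (measurableTypeR R)) by rewrite bE; exact: measurable_itv.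
have add : (mu (ball x r) = mu (ball x r `\` E) + mu (ball x r `&` E))%E.
  by rewrite -measureDI.
have f1 : mu (ball x r `&` E) \is a fin_num.
  rewrite ge0_fin_numE ?measure_ge0// (@le_lt_trans _ _ (mu (ball x r)))//.
    by apply: le_measure; rewrite ?inE//; exact: measurableI.
  by rewrite mb ltry.
have f2 : mu (ball x r `\` E) \is a fin_num.
  rewrite ge0_fin_numE ?measure_ge0// (@le_lt_trans _ _ (mu (ball x r)))//.
    by apply: le_measure; rewrite ?inE//; exact: measurableD.
  by rewrite mb ltry.
rewrite (setIC E) in h1; move: add h1; rewrite mb -(fineK f1) -(fineK f2) -EFinD => -[add].
rewrite (_ : (2 * r == 0) = false); last by rewrite gt_eqF// mulr_gt0.
rewrite -EFinM lte_fin lee_fin ltr_pdivlMr ?mulr_gt0// => h1.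
have {}add : 2 * r = fine (mu (ball x r `\` E)) + fine (mu (ball x r `&` E)) := add.
have : eps * r <= eps * (ratr d - ratr c) by rewrite ler_pM2l//; lra.
have : 0 < eps * r by exact: mulr_gt0.
lra.
Unshelve. all: by end_near. Qed.

End density.

(** * Eigenfunctions of the rectangle *)

(* B need not be measurable: the integral of a nonnegative function is a
   supremum over simple functions. *)
Lemma ge0_subset_integral_sup d (T : measurableType d) (R : realType)
    (mu : {measure set T -> \bar R}) (A B : set T) (f : T -> \bar R) :
  (forall x, (0 <= f x)%E) -> A `<=` B ->
  (\int[mu]_(x in A) f x <= \int[mu]_(x in B) f x)%E.
Proof.
move=> f0 AB; rewrite !ge0_integralE//.
apply: le_ereal_sup => _ [h /= hA <-]; exists h => //= x.
apply: le_trans (hA x) _; rewrite !patchE.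
case: ifPn => [/set_mem xA|_]; first by rewrite mem_set//; exact: AB.
by case: ifPn.
Qed.

Section observability2.
Variable R : realType.
Notation mu1 := (leb1 R).
Notation mu := (leb2 R).
Notation T1 := (measurableTypeR R).
Notation T2 := (T1 * T1)%type.

Lemma leb2_section (E : set T2) (f : R * R -> R) : measurable E -> continuous f ->
  (forall z, 0 <= f z) -> (\int[mu]_(z in E) (f z)%:E =
    \int[mu1]_x \int[mu1]_(y in xsection E x) (f (x, y))%:E)%E /\
  measurable_fun (setT : set T1)
    (fun x => \int[mu1]_(y in xsection E x) (f (x, y))%:E)%E.
Proof.
move=> mE cf f0.
have mf : measurable_fun setT ((fun z => (f z)%:E) \_ E : T2 -> \bar R).
  apply/(measurable_restrictT _ mE); apply: measurable_funTS.
  by apply/measurable_EFinP; exact: continuous_measurable2.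
have pf z : (0 <= ((fun z => (f z)%:E) \_ E : T2 -> \bar R) z)%E.
  by rewrite patchE; case: ifP; rewrite // lee_fin.
have sec : (fun x => \int[mu1]_(y in xsection E x) (f (x, y))%:E)%E =
    fubini_F mu1 ((fun z => (f z)%:E) \_ E : T2 -> \bar R).
  apply/funext => x; rewrite /fubini_F [LHS]integral_mkcond; congr (integral _ _ _).
  by apply/funext => y; rewrite !patchE mem_xsection.
split; last by rewrite sec; exact: measurable_fun_fubini_tonelli_F.
by rewrite integral_mkcond sec /leb2 fubini_tonelli1.
Qed.

(** Every slice of positive measure almost fills some rational interval. There are countably many of
    these, so if each served only a null set of abscissae, almost all slices would be null and so
    would [E]. *)
Lemma slice_interval (E : set T2) (eps : R) : measurable E -> mu E != 0%E -> 0 < eps ->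
  exists c d : R, c < d /\ exists X : set T1, [/\ measurable X, mu1 X != 0%E &
    forall x, X x -> (mu1 (`]c, d[ `\` xsection E x) <= (eps * (d - c))%:E)%E].
Proof.
move=> mE E0 e0.
pose G (cd : rat * rat) : set T2 := (setT `*` `](ratr cd.1 : R), (ratr cd.2)[) `\` E.
have mG cd : measurable (G cd) by apply: measurableD => //; exact: measurableX.
have xG cd x : xsection (G cd) x = `](ratr cd.1 : R), (ratr cd.2)[ `\` xsection E x.
  rewrite /G xsectionD; congr (_ `\` _).
  by apply/seteqP; split => y; rewrite /xsection/= inE/=; [move=> []|].
pose X (cd : rat * rat) : set T1 :=
  [set x | ((ratr cd.1 : R) < ratr cd.2) /\
    (mu1 (xsection (G cd) x) <= (eps * (ratr cd.2 - ratr cd.1))%:E)%E].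
have mX cd : measurable (X cd).
  rewrite /X; case: (boolP ((ratr cd.1 : R) < ratr cd.2)) => h; last first.
    by rewrite (_ : [set _ | _] = set0) //; apply/seteqP; split => x // -[].
  rewrite (_ : [set _ | _] = setT `&` [set x | (mu1 (xsection (G cd) x) <=
     (eps * (ratr cd.2 - ratr cd.1))%:E)%E]).
    by apply: emeasurable_fun_le => //; exact: measurable_fun_xsection.
  by apply/seteqP; split => x /=; [move=> [_]|move=> [_]].
have [[cd Xcd]|H] := pselect (exists cd, mu1 (X cd) != 0%E).
  exists (ratr cd.1), (ratr cd.2).
  have [lt|nlt] := boolP ((ratr cd.1 : R) < ratr cd.2).
    split => //; exists (X cd); split => // x [_]; by rewrite xG.
  move: Xcd; rewrite (_ : X cd = set0) ?measure0 ?eqxx//.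
  by apply/seteqP; split => x // -[]; rewrite (negbTE nlt).
exfalso; move/eqP: E0; apply.
suff : mu1.-negligible [set x | mu1 (xsection E x) != 0%E].
  move=> [N [mN N0 sub]].
  rewrite [LHS](_ : _ = \int[mu1]_x `|(mu1 \o xsection E) x|)%E; last first.
    by apply: eq_integral => x _; rewrite gee0_abs.
  apply/ae_eq_integral_abs => //; first exact: measurable_fun_xsection.
  by exists N; split => // x /= H'; apply: sub => /=; apply/eqP => h; apply: H'.
apply: negligibleS (_ : mu1.-negligible (\bigcup_(k : nat) (if unpickle k is Some cd then X cd else set0))).
  move=> x /= xE.
  have [c [d [cd h]]] := density_interval (measurable_xsection x mE) xE e0.
  have [k kE] : exists k, unpickle k = Some (c, d).
    by exists (pickle (c, d)); rewrite pickleK.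
  by exists k; [exact: I|rewrite kE; split; [exact: cd|rewrite xG; exact: h]].
apply: negligible_bigcup => k; case: (unpickle k) => [cd|]; last exact: negligible_set0.
apply/negligibleP => //; apply: contrapT => /eqP h; by apply: H; exists cd.
Qed.

(** For [x] in [X], one interval serves all slices, and [observable] in the second variable bounds
    F(x, y0)^2 by the integral over the slice at [x]. Integrating over [X], [observable] in the
    first variable reaches (x0, y0). *)
Lemma observable2 (n : nat) (C a b : R) (E : set T2) : (0 < n)%N -> 1 <= C ->
  measurable E -> mu E != 0%E ->
  exists2 k, 0 < k & forall F, continuous F ->
    (forall y, turanP n C (fun x => F (x, y))) ->
    (forall x, turanP n C (fun y => F (x, y))) ->
    forall z, rect a b z -> ((k * F z ^+ 2)%:E <= \int[mu]_(z in E) (F z ^+ 2)%:E)%E.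
Proof.
move=> n0 C1 mE E0.
(* The defect that [observable] tolerates, relative to the length of the interval. *)
pose eps : R := (4 * n%:R ^+ 2)^-1.
have e0 : 0 < eps by rewrite invr_gt0 mulr_gt0// exprn_gt0// ltr0n.
have [c [d [cd [X [mX X0 HX]]]]] := slice_interval mE E0 e0.
have [c' [d' [cd' HX']]] := density_interval mX X0 e0.
have [k1 k10 O1] := observable 0 b n0 C1 cd.
have [k2 k20 O2] := observable 0 a n0 C1 cd'.
exists (k2 * k1); first exact: mulr_gt0.
move=> F cF T1F T2F [x0 y0] [/=]; rewrite !in_itv/= => /andP[x01 x02] /andP[y01 y02].
have cF2 : continuous (fun z => F z ^+ 2).
  by move=> z; apply: (@cvgM _ _ _ _ F F); exact: cF.
have [-> mI] := leb2_section mE cF2 (fun z => sqr_ge0 _).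
set I := (fun x => _) in mI *.
have I0 x : (0 <= I x)%E by apply: integral_ge0 => y _; rewrite lee_fin sqr_ge0.
have step1 x : X x -> ((k1 * F (x, y0) ^+ 2)%:E <= I x)%E.
  move=> Xx; apply: (@le_trans _ _
      (\int[mu1]_(y in xsection E x `&` `]c, d[) (F (x, y) ^+ 2)%:E)%E).
  - apply: (O1 _ (continuous_slice2 cF) (T2F x) _ (measurable_xsection x mE)).
      by have := HX x Xx; rewrite mulrC.
    by rewrite !ltW.
  - by apply: ge0_subset_integral_sup => [y|y []//]; rewrite lee_fin sqr_ge0.
have step2 := O2 _ (continuous_slice1 cF) (T1F y0) _ mX _ x0 _.
have mXJ : measurable (X `&` `](ratr c' : R), (ratr d')[ : set T1) by exact: measurableI.
apply: le_trans (_ : \int[mu1]_(x in X `&` `](ratr c' : R), (ratr d')[) I x <= _)%E; last first.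
  exact: ge0_subset_integral_sup.
apply: le_trans (_ : \int[mu1]_(x in X `&` `](ratr c' : R), (ratr d')[) (k1 * F (x, y0) ^+ 2)%:E <= _)%E; last first.
  apply: ge0_le_integral => //.
  - by move=> x _; rewrite lee_fin mulr_ge0 ?sqr_ge0// ltW.
  - apply: measurable_funTS; apply/measurable_EFinP; apply: measurable_funM => //.
    apply: measurable_funX; apply: continuous_measurable_fun; exact: continuous_slice1.
  - exact: measurable_funTS.
  - by move=> x [Xx _]; exact: step1.
under eq_integral do rewrite EFinM.
rewrite ge0_integralZl//; last 3 first.
- apply: measurable_funTS; apply/measurable_EFinP; apply: measurable_funX.
  apply: continuous_measurable_fun; exact: continuous_slice1.
- by move=> x _; rewrite lee_fin sqr_ge0.
- by rewrite lee_fin ltW.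
rewrite mulrAC mulrC EFinM lee_pmul2l ?lte_fin//.
by apply: step2; [rewrite mulrC|rewrite !ltW].
Qed.

End observability2.

Section expansion.
Variables (R : realType) (a b s : R).
Hypotheses (a0 : 0 < a) (b0 : 0 < b) (s0 : 0 < s).
Notation mu := (leb2 R).
Notation T2 := (measurableTypeR R * measurableTypeR R)%type.
Notation D := (rect a b : set T2).
Notation ip2 := (ip mu D).
Implicit Types (p q : nat * nat) (U : R * R -> R).

Let mD : measurable D. Proof. exact: mrect. Qed.

Let L2_mode p : L2 mu D (mode a b s p.1 p.2).
Proof. by apply: continuous_L2_2 => //; exact: mode_cont. Qed.

Lemma mode_ip p q : ip2 (mode a b s p.1 p.2) (mode a b s q.1 q.2) =
  ip (leb1 R) `]0, a[%classic (md a s p.1) (md a s q.1) *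
  ip (leb1 R) `]0, b[%classic (md b s p.2) (md b s q.2).
Proof. by apply: ip_tensor => //; exact: md_cont. Qed.

Lemma mode_orth p q : p != q -> ip2 (mode a b s p.1 p.2) (mode a b s q.1 q.2) = 0.
Proof.
case: p q => [p1 p2] [q1 q2]; rewrite mode_ip/= => /eqP pq.
have [e1|n1] := eqVneq p1 q1; last by rewrite md_orth// mul0r.
have [e2|n2] := eqVneq p2 q2; last by rewrite [X in _ * X]md_orth// mulr0.
by case: pq; rewrite e1 e2.
Qed.

Lemma mode_ip_neq0 p : ip2 (mode a b s p.1 p.2) (mode a b s p.1 p.2) != 0.
Proof. by rewrite mode_ip mulf_neq0// gt_eqF// md_ip_gt0. Qed.

Definition modesum (r : seq (nat * nat)) (c : nat * nat -> R) (z : R * R) : R :=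
  \sum_(p <- r) c p * mode a b s p.1 p.2 z.

Lemma modesum_cont r c : continuous (modesum r c).
Proof.
elim: r => [|p r IH].
  rewrite (_ : modesum _ _ = fun=> 0); first by move=> z; exact: cvg_cst.
  by apply/funext => z; rewrite /modesum big_nil.
rewrite (_ : modesum _ _ = fun z => c p * mode a b s p.1 p.2 z + modesum r c z); last first.
  by apply/funext => z; rewrite /modesum big_cons.
move=> z; apply: cvgD; last exact: IH.
by apply: cvgM; [exact: cvg_cst|exact: mode_cont].
Qed.

Lemma modesum_turan r c (K : nat) : (size r <= K)%N ->
  (forall y, turanP (2 * K) (7 ^+ K) (fun x => modesum r c (x, y))) /\
  (forall x, turanP (2 * K) (7 ^+ K) (fun y => modesum r c (x, y))).
Proof.
move=> rK; split => t.
  rewrite (_ : (fun _ => _) = fun x => \sum_(p <- r) (c p * md b s p.2 t) *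
     cos (om a s p.1 * x - th a s p.1)); first exact: turanP_cos.
  by apply/funext => x; apply: eq_bigr => p _; rewrite /mode /tensor/= mulrAC -mulrA.
rewrite (_ : (fun _ => _) = fun y => \sum_(p <- r) (c p * md a s p.1 t) *
   cos (om b s p.2 * y - th b s p.2)); first exact: turanP_cos.
by apply/funext => y; apply: eq_bigr => p _; rewrite /mode /tensor/= mulrA.
Qed.

(** With Fourier coefficients, [U] minus the finite sum is orthogonal to every mode, inside and
    outside [r], so [L2_complete] applies. *)
Lemma mode_expansion U r : uniq r -> L2 mu D U ->
  (forall p, p \notin r -> ip2 U (mode a b s p.1 p.2) = 0) ->
  exists c, ae_eq mu D U (modesum r c).
Proof.
move=> ur LU U0.
pose c p := ip2 U (mode a b s p.1 p.2) / ip2 (mode a b s p.1 p.2) (mode a b s p.1 p.2).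
exists c.
have LP : L2 mu D (modesum r c) by apply: continuous_L2_2 => //; exact: modesum_cont.
have ipP q : ip2 (modesum r c) (mode a b s q.1 q.2) =
    if q \in r then ip2 U (mode a b s q.1 q.2) else 0.
  rewrite ip_suml//; last by move=> p; exact: L2Z.
  under eq_bigr do rewrite ipZl//.
  case: ifPn => qr.
    rewrite (bigD1_seq q)//= big1 ?addr0; first by rewrite divfK// mode_ip_neq0.
    by move=> p pq; rewrite mode_orth// mulr0.
  rewrite big_seq big1// => p pr; rewrite mode_orth ?mulr0//.
  by apply: contraNneq qr => <-.
have := @L2_complete R a b s a0 b0 s0 (fun z => U z - modesum r c z) (L2B mD LU LP) _.
case.
  move=> n m; rewrite -[LHS]/(ip2 (fun z => U z - modesum r c z) (mode a b s (n, m).1 (n, m).2)).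
  rewrite ipBl// ipP; case: ifPn => h; first by rewrite subrr.
  by rewrite U0// subr0.
move=> N [mN N0 sub]; exists N; split => // z /= h; apply: sub => /= h'.
by apply: h => Dz; have /= [/eqP] := h' Dz; rewrite subr_eq0 => /eqP.
Qed.

End expansion.

Section robin_rectangle.
Variables (R : realType) (a b s : R).
Hypotheses (a0 : 0 < a) (b0 : 0 < b) (s0 : 0 < s).

Lemma rect_LambdaE n m : rect_Lambda s a b n m = level a b s (n, m).
Proof.
by rewrite /rect_Lambda !robin_kE ?mulr_gt0// /level /om !expr_div_n.
Qed.

Lemma rational_ratio : (exists q : rat, a ^+ 2 / b ^+ 2 = ratr q) ->
  exists P Q : nat, [/\ (0 < P)%N, (0 < Q)%N & a ^+ 2 * Q%:R = b ^+ 2 * P%:R].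
Proof.
move=> [q qE].
have q0 : 0 < q by rewrite -(ltr0q R) -qE divr_gt0// exprn_gt0.
have n0 : 0 < numq q by rewrite numq_gt0.
exists `|numq q|%N, `|denq q|%N; split.
- by rewrite absz_gt0 gt_eqF.
- by rewrite absz_gt0 denq_eq0.
rewrite !natr_absz !gtr0_norm ?denq_gt0//.
have d0 : (denq q)%:~R != 0 :> R by rewrite intr_eq0 denq_eq0.
move: qE; rewrite /ratr => qE; have b2 : b ^+ 2 != 0 by rewrite expf_neq0// gt_eqF.
have -> : a ^+ 2 = b ^+ 2 * (a ^+ 2 / b ^+ 2) by rewrite mulrCA mulfV// mulr1.
by rewrite qE -mulrA divfK.
Qed.

Section bounded_levels.
Variable M : nat.
Hypothesis HM : forall (l : R) (r : seq (nat * nat)), uniq r ->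
  {in r, forall p, level a b s p = l} -> (size r <= M)%N.

Lemma level_fset (Lam : R[i]) : exists r : seq (nat * nat), [/\ uniq r, (size r <= M)%N &
  forall p, (p \in r) = `[< (rect_Lambda s a b p.1 p.2)%:C%C = Lam >] ].
Proof.
pose A := [set p : nat * nat | (rect_Lambda s a b p.1 p.2)%:C%C = Lam].
have hr (r : seq (nat * nat)) : uniq r -> {subset r <= A} -> (size r <= M)%N.
  move=> ur rA; apply: (HM (l := complex.Re Lam)) => // -[n m] pr.
  by have := rA _ pr; rewrite inE => <-; rewrite /= rect_LambdaE.
have finA : finite_set A.
  apply: contrapT => /(infinite_set_fset M.+1)[B BA]; rewrite leqNgt ltnS.
  by rewrite hr ?finmap.fset_uniq// => p pB; rewrite inE; exact: BA.
exists (finmap.enum_fset (fset_set A)); split; first exact: finmap.fset_uniq.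
  by apply: hr => [|p]; rewrite ?finmap.fset_uniq// in_fset_set.
by move=> p; rewrite in_fset_set//; apply/idP/asboolP; rewrite inE.
Qed.

(** A modal class is the image of a pair, so there are at most as many classes as pairs. *)
Lemma kappa_rect_le (Lam : R[i]) : (kappa_rect s a b Lam <= M%:R%:E)%E.
Proof.
have [r [ur rM rE]] := level_fset Lam.
rewrite /kappa_rect.
have -> : [set p : nat * nat | (rect_Lambda s a b p.1 p.2)%:C%C = Lam] = [set` r].
  by apply/seteqP; split => p /=; rewrite rE => /asboolP.
have fr : finite_set [set` r] by exact: finite_seq.
rewrite /counting asboolT; last exact: finite_image.
rewrite lee_fin ler_nat fset_set_image//.
apply: (@leq_trans (size (finmap.enum_fset (fset_set [set` r])))).
  exact: finmap.leq_imfset_card.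
apply: leq_trans rM; rewrite uniq_leq_size ?finmap.fset_uniq//.
by move=> p; rewrite in_fset_set// inE.
Qed.

End bounded_levels.

End robin_rectangle.

Section norms.
Variables (R : realType) (a b : R).
Hypotheses (a0 : 0 < a) (b0 : 0 < b).
Notation mu := (leb2 R).
Notation T2 := (measurableTypeR R * measurableTypeR R)%type.
Notation D := (rect a b : set T2).

Lemma norm2sq_ae (E : set T2) (u : R * R -> R[i]) (P Q : R * R -> R) :
  measurable E -> E `<=` D -> cmeasurable D u -> continuous P -> continuous Q ->
  ae_eq mu D (fun z => complex.Re (u z)) P -> ae_eq mu D (fun z => complex.Im (u z)) Q ->
  norm2sq mu E u = (\int[mu]_(z in E) (P z ^+ 2)%:E + \int[mu]_(z in E) (Q z ^+ 2)%:E)%E.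
Proof.
move=> mE ED mu_ cP cQ eP eQ.
have mf (F : R * R -> R) : continuous F -> measurable_fun E (fun z => (F z ^+ 2)%:E : \bar R).
  move=> cF; apply: measurable_funTS; apply/measurable_EFinP; apply: measurable_funX.
  exact: continuous_measurable2.
rewrite -ge0_integralD//; last 4 first.
- by move=> z _; rewrite lee_fin sqr_ge0.
- exact: mf.
- by move=> z _; rewrite lee_fin sqr_ge0.
- exact: mf.
apply: ge0_ae_eq_integral => //.
- apply: (measurable_funS _ ED); first exact: mrect.
  exact: measurable_sqmod.
- by apply: emeasurable_funD; exact: mf.
- by move=> z _; rewrite lee_fin addr_ge0// sqr_ge0.
- by move=> z _; rewrite -EFinD lee_fin addr_ge0// sqr_ge0.
- move: eP eQ; apply: filterS2 => z hP hQ Ez.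
  by rewrite /sqmod hP ?hQ ?EFinD//; exact: ED.
Qed.

(** Integration of the pointwise bound over [D], whose area is [a * b]. *)
Lemma pointwise_observable (E : set T2) (P : R * R -> R) (k : R) : 0 < k -> E `<=` D ->
  continuous P ->
  (forall z, D z -> ((k * P z ^+ 2)%:E <= \int[mu]_(z in E) (P z ^+ 2)%:E)%E) ->
  ((k / (a * b))%:E * \int[mu]_(z in D) (P z ^+ 2)%:E <= \int[mu]_(z in E) (P z ^+ 2)%:E)%E.
Proof.
move=> k0 ED cP; have mD : measurable D by exact: mrect.
have LP : L2 mu D P by exact: continuous_L2_2.
have : (\int[mu]_(z in E) (P z ^+ 2)%:E)%E \is a fin_num.
  rewrite ge0_fin_numE; last by apply: integral_ge0 => z _; rewrite lee_fin sqr_ge0.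
  apply: le_lt_trans LP.2; apply: ge0_subset_integral_sup => // z.
  by rewrite lee_fin sqr_ge0.
move=> /fineK <-; set x := fine _ => H.
have H' : (\int[mu]_(z in D) (k%:E * (P z ^+ 2)%:E) <= \int[mu]_(z in D) cst x%:E z)%E.
  apply: ge0_le_integral => //.
  - by move=> z _; rewrite -EFinM lee_fin mulr_ge0 ?sqr_ge0// ltW.
  - apply/measurable_EFinP; apply: measurable_funM => //; apply: measurable_funX; exact: LP.1.
rewrite integral_cst// leb2_rect// ge0_integralZl// in H'; last 3 first.
- apply/measurable_EFinP; apply: measurable_funX; exact: LP.1.
- by move=> z _; rewrite lee_fin sqr_ge0.
- by rewrite lee_fin ltW.
move: H'; rewrite ip_sqr// -!EFinM !lee_fin => H'.
by rewrite mulrAC ler_pdivrMr// mulr_gt0.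
Qed.

(** Removing from the Borel set [A] a null set that covers its difference with [V] leaves a subset
    of [V] of the same measure. *)
Lemma measurable_inner_part (V : set (R * R)) : V `<=` rect a b ->
  leb2_measurable V -> ~ (leb2 R).-negligible V ->
  exists E : set T2, [/\ measurable E, E `<=` D, E `<=` V & mu E != 0%E].
Proof.
move=> VD [A mA [N [mN N0 sub]]] V0.
exists ((A `&` D) `\` N); split.
- by apply: measurableD => //; apply: measurableI => //; exact: mrect.
- by move=> z [[]].
- move=> z [[Az _] Nz]; apply: contrapT => Vz; apply: Nz; apply: sub; right; split => //.
- apply/eqP => E0; apply: V0.
  apply: (@negligibleS _ _ _ mu (((A `&` D) `\` N) `|` N)).
    move=> z Vz; have [Nz|Nz] := pselect (N z); [by right|left; split => //; split; last exact: VD].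
    by apply: contrapT => Az; apply: Nz; apply: sub; left; split.
  apply: negligibleU; apply/negligibleP => //.
  by apply: measurableD => //; apply: measurableI => //; exact: mrect.
Qed.

End norms.

Theorem theorem3p12 (R : realType) (a b : R) (ha : 0 < a) (hb : 0 < b)
    (hab : exists q : rat, a ^+ 2 / b ^+ 2 = ratr q)
    (sigma : R) (hsigma : 0 < sigma) :
  (K_rect sigma a b < +oo)%E /\
  (forall V : set (R * R), V `<=` rect a b ->
     leb2_measurable V -> ~ (leb2 R).-negligible V ->
     exists2 c : R, 0 < c &
       forall Lam : R[i], robin_eigenvalue sigma a b Lam ->
       forall u : R * R -> R[i], robin_ker sigma a b Lam u ->
         (c%:E * norm2sq (leb2 R) (rect a b) u <= norm2sq (leb2 R) V u)%E).
Proof.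
have [P [Q [P0 Q0 PQ]]] := rational_ratio ha hb hab.
have [M HM] := level_card ha hb hsigma P0 Q0 PQ.
split.
  apply: le_lt_trans (_ : M%:R%:E < +oo)%E; last exact: ltry.
  by apply: ge_ereal_sup => _ [Lam _ <-]; exact: kappa_rect_le.
move=> V VD mV V0; have [E [mE ED EV E0]] := measurable_inner_part VD mV V0.
(* [M.+1] ensures a positive number of sample points. [k] depends on [M] and [E] and is fixed before
   [Lam]. *)
have C1 : (1:R) <= 7 ^+ M.+1 by rewrite exprn_ege1// ler1n.
have [k k0 Hk] := observable2 a b (n := 2 * M.+1) isT C1 mE E0.
exists (k / (a * b)); first by rewrite divr_gt0// mulr_gt0.
move=> Lam _ u uker.
have L2u := robin_ker_L2 uker.
have [r [ur rM rE]] := level_fset ha hb hsigma HM Lam.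
have orth p : p \notin r -> (lam a b sigma p.1 p.2)%:C%C != Lam.
  rewrite rE => /asboolPn; rewrite rect_LambdaE// => h; exact/eqP.
have [c ReE] := mode_expansion ha hb hsigma ur (inL2_Re (mrect a b) L2u)
  (fun p pr => (robin_ker_orth ha hb hsigma uker (orth p pr)).1).
have [e ImE] := mode_expansion ha hb hsigma ur (inL2_Im (mrect a b) L2u)
  (fun p pr => (robin_ker_orth ha hb hsigma uker (orth p pr)).2).
have obs f : ((k / (a * b))%:E *
     \int[leb2 R]_(z in rect a b) (modesum a b sigma r f z ^+ 2)%:E <=
     \int[leb2 R]_(z in E) (modesum a b sigma r f z ^+ 2)%:E)%E.
  have [T1 T2] := modesum_turan a b sigma f (leqW rM).
  apply: pointwise_observable => //; first exact: modesum_cont.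
  by move=> z; apply: Hk => //; exact: modesum_cont.
apply: (@le_trans _ _ (norm2sq (leb2 R) E u)); last first.
  apply: ge0_subset_integral_sup => // z.
  by rewrite lee_fin addr_ge0// sqr_ge0.
have cm := modesum_cont.
have split_norm F mF FD := @norm2sq_ae R a b F u _ _ mF FD L2u.1
  (cm _ _ _ _ _ _) (cm _ _ _ _ _ _) ReE ImE.
rewrite (split_norm _ (mrect a b))// (split_norm _ mE ED).
rewrite ge0_muleDr; first exact: leeD (obs c) (obs e).
  by apply: integral_ge0 => z _; rewrite lee_fin sqr_ge0.
by apply: integral_ge0 => z _; rewrite lee_fin sqr_ge0.
Qed.
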